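(* Let $\mathcal{O}$ be the ring of a (reduced) algebroid complete intersection curve over an algebraically closed field $k$ of characteristic zero, with branches $\mathcal{O}_1,\ldots,\mathcal{O}_r$. Then $$\tau(\mathcal{O})=\delta+\sum_{i=1}^r(\delta_i-r_i+\Theta_i).$$
   Context: Let $k$ be an algebraically closed field of characteristic zero and $\mathcal{O}=k[[X_1,\ldots,X_n]]/\mathfrak{A}$ a one-dimensional reduced $k$-algebra of embedding dimension $n$ (the ring of an algebroid curve). It is a complete intersection if $\mathfrak{A}=\langle f_1,\ldots,f_{n-1}\rangle$ for some $n-1$ power series $f_i$. The module of Kähler differentials is $\Omega(\mathcal{O})=\mathcal{O}^{\oplus n}/\langle f_{X_1}e_1+\cdots+f_{X_n}e_n;\ f\in\mathfrak{A}\rangle$, with $f_{X_i}=\partial f/\partial X_i$; $x_i$ is the image of $X_i$ in $\mathcal{O}$ and $dx_i$ the image of $e_i$. The Jacobian ideal $\mathfrak{J}\subset\mathcal{O}$ is the smallest nonzero Fitting ideal of $\Omega(\mathcal{O})$, i.e. the nonzero ideal generated by the minors of greatest possible size of the Jacobian matrix of a set of generators of $\mathfrak{A}$. The Tjurina number is $\tau(\mathcal{O})=\ell_{\mathcal{O}}(\mathcal{O}/\mathfrak{J})$ ($\ell$ = length). Let $\wp_1,\ldots,\wp_r$ be the minimal primes of $\mathcal{O}$, $I=\{1,\ldots,r\}$, $\mathcal{O}_i=\mathcal{O}/\wp_i$ (the branches). The integral closure of $\mathcal{O}_i$ in its fraction field is $\widetilde{\mathcal{O}_i}\simeq k[[t_i]]$,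 the integral closure of $\mathcal{O}$ in its total ring of fractions is $\widetilde{\mathcal{O}}\simeq\prod_{i}k[[t_i]]$. Put $\delta=\ell_{\mathcal{O}}(\widetilde{\mathcal{O}}/\mathcal{O})$ and $\delta_i=\ell_{\mathcal{O}_i}(\widetilde{\mathcal{O}_i}/\mathcal{O}_i)$. Let $\mathcal{K}=\prod_{i=1}^r k((t_i))$, let $\varphi_i:\mathcal{O}\to\mathcal{O}_i\hookrightarrow k[[t_i]]$ be the natural maps, and let $v=(v_1,\ldots,v_r):\mathcal{K}\to(\mathbb{Z}\cup\{\infty\})^r$ with $v_i=\mathrm{ord}_{t_i}$. Define $\varphi^*:\Omega(\mathcal{O})\to\mathcal{K}$ by $\varphi^*(\sum_l g_l\,dx_l)=(\ldots,\sum_l\varphi_i(g_l)\varphi_i(x_l)'\,t_i,\ldots)$, where the dash is the derivative with respect to $t_i$; define $\varphi_i^*:\Omega(\mathcal{O}_i)\to k((t_i))$ analogously for the branch $\mathcal{O}_i$. Put $\Gamma_i=v_i(\mathcal{O}_i)$, $\Lambda=v(\varphi^*(\Omega(\mathcal{O})))$, $\Lambda_i=v_i(\varphi_i^*(\Omega(\mathcal{O}_i)))$ and $r_i=\#(\Lambda_i\setminus\Gamma_i)$. (The image of $\varphi^*$ is isomorphic to $\Omega(\mathcal{O})$ modulo torsion, and similarly for each branch.) For $J=\{j_1<\cdots<j_s\}\subset I$ let $\mathrm{pr}_J(\alpha_1,\ldots,\alpha_r)=(\alpha_{j_1},\ldots,\alpha_{j_s})$ and $\Lambda_J=\mathrm{pr}_J(\Lambda)$.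 For a value set $E\subset(\mathbb{Z}\cup\{\infty\})^{J}$ with coordinates indexed by a finite set $J$, for $\alpha\in E$ and nonempty $A\subset J$, put $F_A(E,\alpha)=\{\beta\in E;\ \beta_j=\alpha_j \text{ for } j\in A,\ \beta_i>\alpha_i \text{ for } i\in J\setminus A\}$. A point $\alpha\in E$ with all coordinates in $\mathbb{Z}$ is a maximal point of $E$ if $F_{\{i\}}(E,\alpha)=\emptyset$ for every $i\in J$; a maximal point $\alpha$ is a relative maximal if $F_A(E,\alpha)\neq\emptyset$ for every $A\subset J$ with $\#A\ge 2$. $\mathrm{RM}(E)$ denotes the set of relative maximals of $E$. Let $\mathrm{pr}_*(\alpha_1,\ldots,\alpha_s)=\alpha_s$ be the last coordinate, $[1,i]=\{1,\ldots,i\}$, and define $\Theta_1=0$ and, for $2\le i\le r$, $$\Theta_i=\#\bigcup_{\{i\}\subsetneq J\subseteq[1,i]}\mathrm{pr}_*(\mathrm{RM}(\Lambda_J)).$$ *)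

(* Defs.v *)
From HB Require Import structures.
From mathcomp Require Import all_boot all_order all_algebra.
From mathcomp Require Import mpoly.
From mathcomp Require Import boolp classical_sets functions cardinality.

Set Implicit Arguments.
Unset Strict Implicit.
Unset Printing Implicit Defensive.

Import Order.TTheory GRing.Theory.
Local Open Scope classical_set_scope.
Local Open Scope ring_scope.

(* R[[X_1, ..., X_n]]: a series is its family of coefficients.  The univariate
   ring R[[t]] is the case n = 1. *)
Record mpseries (n : nat) (R : Type) : Type :=
  MPSeries { scoef : 'X_{1..n} -> R }.

Section SeriesRing.
Variables (n : nat) (R : comNzRingType).
Implicit Types f g h : mpseries n R.

HB.instance Definition _ := gen_eqMixin (mpseries n R).
HB.instance Definition _ := gen_choiceMixin (mpseries n R).

Lemma mpseriesP f g : (forall m, scoef f m = scoef g m) -> f = g.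
Proof. by case: f g => [f] [g] /= /funext ->. Qed.

Definition s0 : mpseries n R := MPSeries (fun=> 0).
Definition sadd f g := MPSeries (fun m => scoef f m + scoef g m).
Definition sopp f := MPSeries (fun m => - scoef f m).

Fact saddA : associative sadd.
Proof. by move=> f g h; apply: mpseriesP => m /=; rewrite addrA. Qed.
Fact saddC : commutative sadd.
Proof. by move=> f g; apply: mpseriesP => m /=; rewrite addrC. Qed.
Fact sadd0 : left_id s0 sadd.
Proof. by move=> f; apply: mpseriesP => m /=; rewrite add0r. Qed.
Fact saddN : left_inverse s0 sopp sadd.
Proof. by move=> f; apply: mpseriesP => m /=; rewrite addNr. Qed.

HB.instance Definition _ :=
  GRing.isZmodule.Build (mpseries n R) saddA saddC sadd0 saddN.

Definition s1 : mpseries n R := MPSeries (fun m => (m == 0%MM)%:R).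
(* The bound on the degrees of k.1 and k.2 is implied by m = k.1 + k.2; it
   only makes the index type finite. *)
Definition smul f g : mpseries n R := MPSeries (fun m =>
  \sum_(k : 'X_{1..n < (mdeg m).+1, (mdeg m).+1} | m == (k.1 + k.2)%MM)
     scoef f k.1 * scoef g k.2).

Definition strunc (d : nat) f : {mpoly R[n]} :=
  \sum_(m : 'X_{1..n < d}) scoef f m *: 'X_[m].

Lemma struncE d f m : (mdeg m < d)%N -> (strunc d f)@_m = scoef f m.
Proof. by move=> lt_md; rewrite /strunc mcoeff_mpoly. Qed.

Lemma mcoeffM_low (p q p' q' : {mpoly R[n]}) m :
  (forall k, (mdeg k <= mdeg m)%N -> p@_k = p'@_k) ->
  (forall k, (mdeg k <= mdeg m)%N -> q@_k = q'@_k) ->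
  (p * q)@_m = (p' * q')@_m.
Proof.
move=> hp hq; rewrite !mcoeffM; apply: eq_bigr => -[k1 k2] _ /=.
by rewrite hp ?hq // -ltnS bmdeg.
Qed.

Lemma smulE d f g m : (mdeg m < d)%N ->
  scoef (smul f g) m = (strunc d f * strunc d g)@_m.
Proof.
move=> lt_md /=; rewrite mcoeffM; apply: eq_bigr => -[k1 k2] _ /=.
by rewrite !struncE //; apply: leq_trans (bmdeg _) lt_md.
Qed.

Fact smulA : associative smul.
Proof.
move=> f g h; apply: mpseriesP => m.
rewrite !(smulE _ _ (ltnSn _)).
transitivity (strunc (mdeg m).+1 f * strunc (mdeg m).+1 g
              * strunc (mdeg m).+1 h)@_m.
  rewrite -mulrA; apply: mcoeffM_low => // k le_km.
  by rewrite struncE ?ltnS // (@smulE (mdeg m).+1) ?ltnS.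
apply: mcoeffM_low => // k le_km.
by rewrite struncE ?ltnS // (@smulE (mdeg m).+1) ?ltnS.
Qed.

Fact smulC : commutative smul.
Proof.
by move=> f g; apply: mpseriesP => m; rewrite !(smulE _ _ (ltnSn _)) mulrC.
Qed.

Fact smul1 : left_id s1 smul.
Proof.
move=> f; apply: mpseriesP => m; rewrite (smulE _ _ (ltnSn _)).
rewrite -(@struncE (mdeg m).+1 f) // -[in RHS](mul1r (strunc _ f)).
apply: mcoeffM_low => // k le_km.
by rewrite struncE ?ltnS //= mcoeff1.
Qed.

Fact smulDl : left_distributive smul sadd.
Proof.
move=> f g h; apply: mpseriesP => m /=; rewrite -big_split /=.
by apply: eq_bigr => k _; rewrite mulrDl.
Qed.

Fact s1_neq0 : s1 != 0 :> mpseries n R.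
Proof.
apply/eqP => /(congr1 (fun f => scoef f 0%MM)) /= /eqP.
by rewrite eqxx oner_eq0.
Qed.

HB.instance Definition _ := GRing.Zmodule_isComNzRing.Build (mpseries n R)
  smulA smulC smul1 smulDl s1_neq0.

Definition sscale (c : R) f := MPSeries (fun m => c * scoef f m).

Fact sscaleA a b f : sscale a (sscale b f) = sscale (a * b) f.
Proof. by apply: mpseriesP => m /=; rewrite mulrA. Qed.
Fact sscale1 : left_id 1 sscale.
Proof. by move=> f; apply: mpseriesP => m /=; rewrite mul1r. Qed.
Fact sscaleDr : right_distributive sscale +%R.
Proof. by move=> c f g; apply: mpseriesP => m /=; rewrite mulrDr. Qed.
Fact sscaleDl f : {morph sscale^~ f : a b / a + b}.
Proof. by move=> a b; apply: mpseriesP => m /=; rewrite mulrDl. Qed.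

HB.instance Definition _ := GRing.Zmodule_isLmodule.Build R (mpseries n R)
  sscaleA sscale1 sscaleDr sscaleDl.

Fact sscaleAl (c : R) f g : c *: (f * g) = (c *: f) * g.
Proof.
apply: mpseriesP => m /=; rewrite mulr_sumr.
by apply: eq_bigr => k _; rewrite mulrA.
Qed.

HB.instance Definition _ :=
  GRing.Lmodule_isLalgebra.Build R (mpseries n R) sscaleAl.

Fact sscaleAr (c : R) f g : c *: (f * g) = f * (c *: g).
Proof. by rewrite mulrC sscaleAl mulrC. Qed.

HB.instance Definition _ :=
  GRing.Lalgebra_isAlgebra.Build R (mpseries n R) sscaleAr.

Definition sunit : pred (mpseries n R) := fun f => `[< exists g, g * f = 1 >].
Definition sinv f : mpseries n R :=
  if pselect (exists g, g * f = 1) is left e then projT1 (cid e) else f.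

Fact smulV : {in sunit, left_inverse 1 sinv *%R}.
Proof.
move=> f /asboolP e; rewrite /sinv; case: pselect => // e'.
exact: projT2 (cid e').
Qed.
Fact sunitPl f g : g * f = 1 -> sunit f.
Proof. by move=> e; apply/asboolP; exists g. Qed.
Fact sinv_out : {in [predC sunit], sinv =1 id}.
Proof. by move=> f /asboolP nu; rewrite /sinv; case: pselect. Qed.

HB.instance Definition _ := GRing.ComNzRing_hasMulInverse.Build (mpseries n R)
  smulV sunitPl sinv_out.

Definition svar (i : 'I_n) : mpseries n R :=
  MPSeries (fun m => (m == U_(i)%MM)%:R).

Definition sderiv (i : 'I_n) f : mpseries n R :=
  MPSeries (fun m => scoef f (m + U_(i))%MM *+ (m i).+1).

End SeriesRing.

Section SeriesDomain.
Variables (n : nat) (R : idomainType).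

Lemma series_min (f : mpseries n R) : f != 0 ->
  exists2 m, scoef f m != 0 & forall k, (k < m)%O -> scoef f k = 0.
Proof.
move=> nz; apply: contrapT => nomin; move/eqP: nz; apply.
apply: mpseriesP => m; elim/(@ltmwf n): m => m IH.
apply: contrapT => /eqP nz; apply: nomin; by exists m.
Qed.

Fact series_idomain (f g : mpseries n R) :
  f * g = 0 -> (f == 0) || (g == 0).
Proof.
move=> fg0; apply/negP => /negP; rewrite negb_or => /andP[nzf nzg].
have [a nza mina] := series_min nzf; have [b nzb minb] := series_min nzg.
have /eqP := congr1 (fun h => scoef h (a + b)%MM) fg0; apply/negP => /=.
have lta : (mdeg a < (mdeg (a + b)%MM).+1)%N by rewrite mdegD ltnS leq_addr.
have ltb : (mdeg b < (mdeg (a + b)%MM).+1)%N by rewrite mdegD ltnS leq_addl.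
rewrite (bigD1 (BMultinom lta, BMultinom ltb)) //= big1 ?addr0 ?mulf_neq0 //.
move=> -[k1 k2] /= /andP[/eqP e ne].
have [lt1|] := boolP ((k1 : 'X_{1..n}) < a)%O; first by rewrite mina ?mul0r.
have [lt2|] := boolP ((k2 : 'X_{1..n}) < b)%O; first by rewrite minb ?mulr0.
rewrite -!leNgt => le2 le1; case/negP: ne.
have e1 : (k1 : 'X_{1..n}) = a.
  apply/eqP; rewrite eq_le le1 andbT leNgt; apply/negP => lt1.
  by have := ltmc_le_add lt1 le2; rewrite -[in X in (_ < X)%O]e ltxx.
have e2 : (k2 : 'X_{1..n}) = b.
  by apply/eqP; rewrite -(eqm_add2l a) -[X in (X + _)%MM]e1 -e.
by apply/eqP; congr pair; apply/val_inj.
Qed.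

HB.instance Definition _ :=
  GRing.ComUnitRing_isIntegral.Build (mpseries n R) series_idomain.

End SeriesDomain.

Definition tcoef (R : Type) (f : mpseries 1 R) (d : nat) : R :=
  scoef f (U_(ord0) *+ d)%MM.

(* Z u {oo}, with oo = None. *)
Definition value : Type := option int.

Definition value_lt (a b : value) : bool :=
  match a, b with
  | Some x, Some y => (x < y)%R
  | Some _, None => true
  | None, _ => false
  end.

Definition ord_t (R : nmodType) (f : mpseries 1 R) : value :=
  if pselect (exists d, tcoef f d != 0) is left e then Some (ex_minn e)%:Z
  else None.

Section CommutativeAlgebra.
Variable R : comNzRingType.

Definition ideal (I : set R) : Prop :=
  [/\ I 0, forall x y, I x -> I y -> I (x + y)
    & forall a x, I x -> I (a * x)].

Definition ideal_gen (S : set R) : set R := smallest ideal S.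

Definition prime_ideal (P : set R) : Prop :=
  [/\ ideal P, ~ P 1 & forall x y, P (x * y) -> P x \/ P y].

Definition minimal_prime (P : set R) : Prop :=
  prime_ideal P /\ forall Q, prime_ideal Q -> Q `<=` P -> P `<=` Q.

Definition reduced : Prop := forall (x : R) m, x ^+ m = 0 -> x = 0.

Definition prime_chain (d : nat) : Prop :=
  exists P : nat -> set R, (forall i, (i <= d)%N -> prime_ideal (P i))
    /\ (forall i, (i < d)%N -> P i `<` P i.+1).

Definition krull_dim (d : nat) : Prop := prime_chain d /\ ~ prime_chain d.+1.

(* When R is local, this is its maximal ideal. *)
Definition nonunits : set R := [set x | ~ exists y, x * y = 1].

Definition embedding_dim (n : nat) : Prop :=
  (exists g : 'I_n -> R, ideal_gen (range g) = nonunits)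
  /\ (forall p (g : 'I_p -> R), ideal_gen (range g) = nonunits -> (n <= p)%N).

End CommutativeAlgebra.

Section Length.
Variables (R : comNzRingType) (V : zmodType) (act : R -> V -> V).

Definition submodule (W : set V) : Prop :=
  [/\ W 0, forall x y, W x -> W y -> W (x + y)
    & forall a x, W x -> W (act a x)].

(* Chains of length l of submodules of V / N, given by their preimages. *)
Definition submodule_chain (N : set V) (l : nat) : Prop :=
  exists W : nat -> set V,
    (forall i, (i <= l)%N -> submodule (W i) /\ N `<=` W i)
    /\ (forall i, (i < l)%N -> W i `<` W i.+1).

(* The R-module V / N has (finite) length l. *)
Definition quotient_length (N : set V) (l : nat) : Prop :=
  submodule_chain N l /\ ~ submodule_chain N l.+1.

End Length.

Section Curve.
Variables (k : fieldType) (n : nat) (O : comAlgType k).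
Variable pi : mpseries n k -> O.

Definition kernel (A B : zmodType) (f : A -> B) : set A := [set a | f a = 0].

Definition complete_intersection : Prop :=
  exists f : 'I_n.-1 -> mpseries n k, ideal_gen (range f) = kernel pi.

(* The j-th Fitting ideal of Omega(O) = O^n / <f_{X_1} e_1 + ... + f_{X_n} e_n>:
   it is generated by the minors of size n - j of the matrix whose rows are
   the relations, one for each f in the kernel of pi. *)
Definition kahler_fitting (j : nat) : set O :=
  ideal_gen [set x | exists (f : 'I_(n - j) -> mpseries n k)
                            (c : 'I_(n - j) -> 'I_n),
    (forall a, kernel pi (f a))
    /\ x = \det (\matrix_(a, b) pi (sderiv (c b) (f a)))].

(* The Fitting ideals increase with j, so the smallest nonzero one is the
   first nonzero one. *)
Definition jacobian_ideal : set O :=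
  [set x | exists j, [/\ kahler_fitting j x, kahler_fitting j != [set 0]
    & forall i, (i < j)%N -> kahler_fitting i = [set 0]]].

Definition tjurina (tau : nat) : Prop :=
  quotient_length (@GRing.mul O) jacobian_ideal tau.

End Curve.

Section Branch.
Variables (k : fieldType) (B : comAlgType k) (nu : B -> mpseries 1 k).

Local Notation frac s := (@tofrac (mpseries 1 k) s).

(* nu embeds B into k[[t]], and k[[t]] is the integral closure of nu(B) in
   the field of fractions of nu(B), the latter taken inside k((t)). *)
Definition integral_closure_map : Prop :=
  injective nu /\
  forall y : {fraction mpseries 1 k},
    ((exists a b, b != 0 /\ y = frac (nu a) / frac (nu b))
     /\ integralOver (fun a => frac (nu a)) y)
    <-> exists s, y = frac s.

Definition branch_delta (d : nat) : Prop :=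
  quotient_length (fun (a : B) (s : mpseries 1 k) => nu a * s) (range nu) d.

Definition branch_values : set value := [set ord_t (nu a) | a in setT].

End Branch.

(* delta of a curve, its integral closure being the product of the k[[t_i]]. *)
Definition curve_delta (k : fieldType) (O : comAlgType k) (r : nat)
    (phi : 'I_r -> O -> mpseries 1 k) (d : nat) : Prop :=
  quotient_length
    (fun (a : O) (s : {ffun 'I_r -> mpseries 1 k}) => [ffun i => phi i a * s i])
    (range (fun a : O => [ffun i => phi i a])) d.

(* The i-th component of the map phi^* from differentials to the product of the
   k((t_i)), on the class of g_1 dx_1 + ... + g_n dx_n; because of the factor
   t_i it takes its values in k[[t_i]]. *)
Definition differential_pullback (k : fieldType) (A : comAlgType k) (n : nat)
    (x : 'I_n -> A) (phi : A -> mpseries 1 k) (g : 'I_n -> A) : mpseries 1 k :=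
  (\sum_l phi (g l) * sderiv ord0 (phi (x l))) * svar k ord0.

Definition differential_values (k : fieldType) (A : comAlgType k) (n : nat)
    (x : 'I_n -> A) (I : Type) (phi : I -> A -> mpseries 1 k) :
    set (I -> value) :=
  [set (fun i => ord_t (differential_pullback x (phi i) g)) | g in setT].

Definition branch_differential_values (k : fieldType) (A : comAlgType k)
    (n : nat) (x : 'I_n -> A) (phi : A -> mpseries 1 k) : set value :=
  [set ord_t (differential_pullback x phi g) | g in setT].

Section ValueSets.
Variables (T : finType) (E : set (T -> value)).

Definition fiber (A : {set T}) (a : T -> value) : set (T -> value) :=
  [set b | [/\ E b, forall j, j \in A -> b j = a j
             & forall j, j \notin A -> value_lt (a j) (b j)]].

Definition maximal_point (a : T -> value) : Prop :=
  [/\ E a, forall j, exists z, a j = Some z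
    & forall i, fiber [set i]%SET a = set0].

Definition relative_maximals : set (T -> value) :=
  [set a | maximal_point a
           /\ forall A : {set T}, (2 <= #|A|)%N -> fiber A a !=set0].

End ValueSets.

Definition project (T : finType) (J : {set T}) (E : set (T -> value)) :
    set ({j : T | j \in J} -> value) :=
  [set (fun j => a (val j)) | a in E].
Arguments project {T} J E _.

(* The union whose cardinality is Theta_i.  As J is contained in [1, i] and
   contains i, the last coordinate is the one of index i.  For the first index
   there is no such J and the union is empty, in accordance with Theta_1 = 0. *)
Definition Theta_set (r : nat) (E : set ('I_r -> value)) (i : 'I_r) :
    set value :=
  [set z | exists (J : {set 'I_r}) (iJ : i \in J),
    [/\ ([set i] \proper J)%SET, forall j, j \in J -> (j <= i)%N
      & exists2 a, relative_maximals (project J E) a & a (exist _ i iJ) = z]].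

(* Main.v *)
(* Embed O in the product O~ of the k[[t_p]] and let M be the image of phi^*, so
   that M is the O-span of the vectors (t_p x_l')_p.

   Write D for the determinant of the matrix b in
   g(X) - g(Y) = b(X,Y) (X - Y), where g consists of the equations of the curve
   and of an element xi of O equal to t_p^N on every branch, with t^N O~ inside
   O.  On the branches p and q, D(t,s) is killed by a(t) - a(s) modulo
   t^N - s^N for every a in O; since t^N O~ is in O, D is divisible by
   t^N - s^N for p <> q, and by (t^N - s^N)/(t - s) for p = q.  Restricting the
   quotient to the diagonal gives c in O~ with c_p x_l' equal, up to sign, to
   the maximal minors of the Jacobian matrix; thus the Jacobian ideal J
   satisfies t J = c M.

   Let U be the orthogonal of O for the pairing "coefficient of t^(N-1) in the
   sum of the u_p a_p".  For u, w in U the sum of the residues of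
   c u w / t^(2N) is a double residue of u(t) w(s) D(t,s) / (t^N - s^N), which
   vanishes because D is a sum of products a(t) b(s) with a, b in O.  Hence
   c U is contained in t^N O.  Equality follows from the fact that D(X,0) is not
   in the ideal (g): it is a socle generator of k[[X]]/(g).  Comparing
   codimensions gives ord(c) = 2 delta, and so
   tau = delta + dim(O~/M) - r.

   Finally dim(O~/M) is counted along the lexicographic filtration of O~.  A
   value d of the i-th branch that is not the value of an element of M vanishing
   on the branches before i is the last coordinate of a relative maximal: take
   minimal thresholds on the earlier branches that no element with i-th value d
   exceeds, and let J consist of i and of the branches where the threshold is
   nontrivial. *)

Require Import Defs.
From HB Require Import structures.
From mathcomp Require Import all_boot all_order all_algebra.
From mathcomp Require Import mpoly boolp classical_sets functions cardinality.
From mathcomp Require Import ring zify.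

Set Implicit Arguments.
Unset Strict Implicit.
Unset Printing Implicit Defensive.

Import GRing.Theory.
Local Open Scope classical_set_scope.
Local Open Scope card_scope.
Local Open Scope ring_scope.

(** * Multivariate power series *)

(** The equality ord(c) = 2 delta is the self-duality of a complete intersection. It is produced
    here rather than quoted: [scale_perp_image] says that multiplication by c / t^N carries the
    orthogonal U of O onto O.

    The equation xi is needed because f alone gives only n - 1 rows. With it the matrix b is square,
    Cramer's rule applies, and the ideal (g) contains powers of all variables, which makes
    membership of D(X,0) decidable on one monomial. The common value t^N on all branches makes the
    double residue computable: t^N - s^N times t^N + s^N is t^2N - s^2N, and this divided by t - s
    represents a single coefficient functional.

    The obstacle is that D is a series, so it is only a limit of finite sums of products a(X) b(Y).
    Each residue sees finitely many coefficients, so a finite sum close enough to D replaces it.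

    Lengths are defined by chains of submodules. Each module here carries a filtration on whose
    steps the ring acts through its residue field, so a length is a number of jumps. All invariants
    become sums of booleans over positions (p, d) with d below a bound L, and the final identity is
    linear arithmetic. *)

Section SeriesToolkit.
Variables (n : nat) (R : comNzRingType).
Implicit Types f g h : mpseries n R.

Lemma scoefD f g m : scoef (f + g) m = scoef f m + scoef g m.
Proof. by []. Qed.

Lemma scoefN f m : scoef (- f) m = - scoef f m.
Proof. by []. Qed.

Lemma scoefB f g m : scoef (f - g) m = scoef f m - scoef g m.
Proof. by []. Qed.

Lemma scoef1 m : scoef (1 : mpseries n R) m = (m == 0%MM)%:R.
Proof. by []. Qed.

Lemma scoefZ c f m : scoef (c *: f) m = c * scoef f m.
Proof. by []. Qed.

Lemma scoefA c m : scoef (c%:A : mpseries n R) m = c * (m == 0%MM)%:R.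
Proof. by []. Qed.

Lemma scoefM f g m : scoef (f * g) m =
  \sum_(k : 'X_{1..n < (mdeg m).+1, (mdeg m).+1} | m == (k.1 + k.2)%MM)
     scoef f k.1 * scoef g k.2.
Proof. by []. Qed.

Lemma scoef_sum (I : Type) (r : seq I) (P : pred I) (F : I -> mpseries n R) m :
  scoef (\sum_(i <- r | P i) F i) m = \sum_(i <- r | P i) scoef (F i) m.
Proof. by apply: (big_morph (fun f => scoef f m)). Qed.

Definition smon (a : 'X_{1..n}) : mpseries n R :=
  MPSeries (fun m => (m == a)%:R).

Lemma scoef_smonM a f m :
  scoef (smon a * f) m = if (a <= m)%MM then scoef f (m - a) else 0.
Proof.
rewrite scoefM; case: ifPn => [le_am | nle].
  have lta : (mdeg a < (mdeg m).+1)%N by rewrite -(submK le_am) mdegD ltnS leq_addl.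
  have ltb : (mdeg (m - a)%MM < (mdeg m).+1)%N by rewrite ltnS mdegB.
  rewrite (bigD1 (BMultinom lta, BMultinom ltb)) /=; last by rewrite addmC submK.
  rewrite eqxx mul1r big1 ?addr0 // => -[k1 k2] /= /andP[/eqP e ne].
  have [e1|] := eqVneq (k1 : 'X_{1..n}) a; last by rewrite mul0r.
  case/negP: ne; apply/eqP; congr pair; apply/val_inj => //=.
  by rewrite [X in (X - _)%MM]e e1 addmC addmK.
apply: big1 => -[k1 k2] /= /eqP e.
have [e1|] := eqVneq (k1 : 'X_{1..n}) a; last by rewrite mul0r.
by case/negP: nle; rewrite e -e1 lem_addr.
Qed.

Lemma smon0 : smon 0 = 1.
Proof. by []. Qed.

Lemma smonM a b : smon a * smon b = smon (a + b).
Proof.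
apply: mpseriesP => m; rewrite scoef_smonM /=; case: ifPn => [le_am | nle].
  by rewrite -(inj_eq (@addIm _ a)) submK // addmC.
by case: eqP => // e; case/negP: nle; rewrite e lem_addr.
Qed.

Lemma svar_smon i : svar R i = smon U_(i).
Proof. by []. Qed.

Lemma svarX i d : svar R i ^+ d = smon (U_(i) *+ d).
Proof.
by elim: d => [|d IH]; rewrite ?expr0 ?mulm0n // exprS IH svar_smon smonM mulmS.
Qed.

Lemma scoef0M f g : scoef (f * g) 0 = scoef f 0 * scoef g 0.
Proof.
have lt0 : (mdeg (0%MM : 'X_{1..n}) < (mdeg (0%MM : 'X_{1..n})).+1)%N by [].
rewrite scoefM (bigD1 (BMultinom lt0, BMultinom lt0)) /=; last by rewrite addm0.
rewrite big1 ?addr0 // => -[k1 k2] /= /andP[e ne]; case/negP: ne.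
move: e; rewrite eq_sym mnmD_eq0 => /andP[/eqP e1 /eqP e2].
by apply/eqP; congr pair; apply: val_inj.
Qed.

(** The filtration by powers of the maximal ideal. It is separated ([ord_ge_eq0]), so identities of
    series are proved by showing that the defect has order at least [d] for every [d], each
    induction step gaining one factor from a variable. *)
Definition ord_ge d f := forall m, (mdeg m < d)%N -> scoef f m = 0.

Lemma ord_ge1P f : ord_ge 1 f <-> scoef f 0 = 0.
Proof.
split=> [h|h m]; first by apply: h; rewrite mdeg0.
by rewrite ltnS leqn0 mdeg_eq0 => /eqP ->.
Qed.

Lemma ord_geW d e f : (e <= d)%N -> ord_ge d f -> ord_ge e f.
Proof. by move=> le_ed h m lt; apply: h; apply: leq_trans lt le_ed. Qed.

Lemma ord_ge_zero d : ord_ge d 0.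
Proof. by []. Qed.

Lemma ord_geD d f g : ord_ge d f -> ord_ge d g -> ord_ge d (f + g).
Proof. by move=> hf hg m lt; rewrite scoefD hf ?hg ?addr0. Qed.

Lemma ord_geN d f : ord_ge d f -> ord_ge d (- f).
Proof. by move=> hf m lt; rewrite scoefN hf ?oppr0. Qed.

Lemma ord_geB d f g : ord_ge d f -> ord_ge d g -> ord_ge d (f - g).
Proof. by move=> hf hg; apply: ord_geD hf (ord_geN hg). Qed.

Lemma ord_geZ d c f : ord_ge d f -> ord_ge d (c *: f).
Proof. by move=> hf m lt; rewrite scoefZ hf ?mulr0. Qed.

Lemma ord_geM d e f g : ord_ge d f -> ord_ge e g -> ord_ge (d + e) (f * g).
Proof.
move=> hf hg m lt; rewrite scoefM big1 // => -[k1 k2] /= /eqP em.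
case: (ltnP (mdeg k1) d) => [/hf -> | le1]; first by rewrite mul0r.
rewrite [scoef g _]hg ?mulr0 //.
rewrite -(ltn_add2l (mdeg k1)) -mdegD -em; apply: leq_trans lt _.
by rewrite leq_add2r.
Qed.

Lemma ord_geMr d f g : ord_ge d g -> ord_ge d (f * g).
Proof. by move=> hg; rewrite -[d]add0n; apply: ord_geM. Qed.

Lemma ord_ge_sum d (I : Type) (r : seq I) (P : pred I) (F : I -> mpseries n R) :
  (forall i, P i -> ord_ge d (F i)) -> ord_ge d (\sum_(i <- r | P i) F i).
Proof. by move=> h; apply: big_ind => //; apply: ord_geD. Qed.

Lemma ord_geX d e f : ord_ge d f -> ord_ge (d * e) (f ^+ e).
Proof.
move=> hf; elim: e => [|e IH]; first by rewrite muln0.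
by rewrite exprS mulnS; apply: ord_geM.
Qed.

Lemma ord_ge_svar i : ord_ge 1 (svar R i).
Proof. by apply/ord_ge1P => /=; rewrite eq_sym mnm1_eq0. Qed.

Lemma ord_ge_eq0 f : (forall d, ord_ge d f) -> f = 0.
Proof. by move=> h; apply: mpseriesP => m; apply: (h (mdeg m).+1). Qed.

(* A monomial is charged to the first variable of P that it involves. *)
Lemma svar_division (P : pred 'I_n) f :
  (forall m : 'X_{1..n}, (forall l, P l -> m l = 0%N) -> scoef f m = 0) ->
  exists g : 'I_n -> mpseries n R, f = \sum_(l | P l) svar R l * g l /\
    forall d, ord_ge d.+1 f -> forall l, ord_ge d (g l).
Proof.
move=> fP.
pose free (m : 'X_{1..n}) (l : 'I_n) :=
  [forall j : 'I_n, (P j && (j < l)%N) ==> (m j == 0%N)].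
exists (fun l => MPSeries (fun m =>
  if free m l then scoef f (m + U_(l)) else 0)); split; last first.
  move=> d hf l m lt /=; case: ifP => // _; apply: hf.
  by rewrite mdegD mdeg1 addn1 ltnS.
apply: mpseriesP => m; rewrite scoef_sum.
have E l : scoef (svar R l * MPSeries (fun m =>
    if free m l then scoef f (m + U_(l)) else 0)) m =
    if (m l != 0)%N && free m l then scoef f m else 0.
  rewrite svar_smon scoef_smonM lep1mP; case: ifP => //= ml.
  rewrite submK ?lep1mP //; congr (if _ then _ else _).
  apply: eq_forallb => j; case: (boolP (P j && (j < l)%N)) => //= /andP[_ ltjl].
  rewrite mnmBE mnm1E; case: (l =P j) => [el | _]; last by rewrite /= subn0.
  by rewrite el ltnn in ltjl.
under eq_bigr => l _ do rewrite E.
have [/existsP[l0 /andP[Pl0 ml0]]|] := boolP [exists l, P l && (m l != 0)%N];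
  last first.
  rewrite negb_exists => /forallP nP.
  have z l : P l -> m l = 0%N.
    by move=> Pl; have := nP l; rewrite Pl negbK => /eqP.
  by rewrite fP // big1 // => l /z ->.
case: (@arg_minnP _ l0 (fun l => P l && (m l != 0)%N) (fun l => l : nat)) => //=.
  by rewrite Pl0.
move=> l /andP[Pl ml] minl.
rewrite (bigD1 l) //= ml /= big1 ?addr0 => [|j /andP[Pj njl]].
  rewrite (_ : free m l) //; apply/forallP => j; apply/implyP => /andP[Pj ltjl].
  apply: contraLR ltjl => mj; rewrite -leqNgt; apply: minl; by rewrite Pj.
case: ifP => // /andP[mj /forallP /(_ l)]; rewrite Pl /=.
have := minl j; rewrite Pj mj => /(_ isT) lelj.
rewrite ltn_neqAle lelj andbT (negbTE ml) implybF negbK => /eqP elj.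
by case/negP: njl; apply/eqP/val_inj; rewrite /= elj.
Qed.

Lemma series_decomp f : exists g : 'I_n -> mpseries n R,
  f = (scoef f 0)%:A + \sum_l svar R l * g l.
Proof.
have [|g [eg _]] := @svar_division predT (f - (scoef f 0)%:A).
  move=> m hm; have -> : m = 0%MM by apply/mnmP => l; rewrite hm ?mnm0E.
  by rewrite scoefB scoefA eqxx mulr1 subrr.
by exists g; rewrite -eg addrC subrK.
Qed.

Lemma smon_dvd a f :
  (forall m : 'X_{1..n}, ~~ (a <= m)%MM -> scoef f m = 0) -> exists g, f = smon a * g.
Proof.
move=> h; exists (MPSeries (fun m => scoef f (a + m))); apply: mpseriesP => m.
rewrite scoef_smonM; case: ifPn => [le|/h //] /=.
by rewrite addmC submK.
Qed.

Lemma scoef_sderiv i f m :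
  scoef (sderiv i f) m = scoef f (m + U_(i))%MM *+ (m i).+1.
Proof. by []. Qed.

Lemma sderivD i f g : sderiv i (f + g) = sderiv i f + sderiv i g.
Proof. by apply: mpseriesP => m /=; rewrite mulrnDl. Qed.

Lemma sderivA (i : 'I_n) (c : R) : sderiv i (c%:A : mpseries n R) = 0.
Proof.
apply: mpseriesP => m; rewrite /= mnmD_eq0 mnm1_eq0 andbF.
by rewrite mulr0 mul0rn.
Qed.

Lemma sderivZ i c f : sderiv i (c *: f) = c *: sderiv i f.
Proof. by apply: mpseriesP => m /=; rewrite mulrnAr. Qed.

Lemma sderiv_svar (i j : 'I_n) : sderiv i (svar R j) = (i == j)%:R.
Proof.
apply: mpseriesP => m /=.
have [<-|ne] := eqVneq i j.
  rewrite scoef1 -{2}[U_(i)%MM]add0m eqm_add2r; case: eqP => [->|_].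
    by rewrite mnm0E.
  by rewrite mul0rn.
rewrite (_ : (_ == _) = false) ?mul0rn //.
apply/eqP => /mnmP/(_ i); rewrite mnmDE !mnm1E eqxx eq_sym (negbTE ne).
by rewrite addn1.
Qed.

Lemma sderiv_sum (i : 'I_n) (I : Type) (r : seq I) (P : pred I)
    (F : I -> mpseries n R) :
  sderiv i (\sum_(j <- r | P j) F j) = \sum_(j <- r | P j) sderiv i (F j).
Proof.
apply: (big_morph (sderiv i)) => [x y|]; first exact: sderivD.
by apply: mpseriesP => m /=; rewrite mul0rn.
Qed.

Lemma sderivB i f g : sderiv i (f - g) = sderiv i f - sderiv i g.
Proof. by apply: mpseriesP => m /=; rewrite mulrnDl mulNrn. Qed.

Lemma sderiv_svarM i j f :
  sderiv i (svar R j * f) = (i == j)%:R * f + svar R j * sderiv i f.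
Proof.
apply: mpseriesP => m; rewrite scoefD scoef_sderiv mulr_natl.
rewrite !svar_smon !scoef_smonM !lep1mP mnmDE mnm1E !scoef_sderiv.
have [<-|ne] /= := eqVneq i j.
  rewrite addn1 /= addmK mulrS mulr1n; case: eqP => [->|/eqP mi].
    by rewrite mulr0n.
  rewrite submK ?lep1mP // mnmBE mnm1E eqxx subn1 prednK ?lt0n //.
rewrite addn0 add0r; case: (m j =P 0%N) => /= [_ | /eqP mj]; rewrite ?mul0rn //.
congr (scoef f _ *+ _).
  by apply/mnmP => l; rewrite !mnmE addnBAC //; case: (j =P l) => // <-; rewrite lt0n.
by rewrite mnmBE mnm1E eq_sym (negbTE ne) subn0.
Qed.

(** The defect of the Leibniz rule is additive in [f], vanishes on constants, and is multiplied by a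
    variable when [f] is. With [series_decomp] its order therefore exceeds every bound. *)
Lemma sderivM i f g : sderiv i (f * g) = sderiv i f * g + f * sderiv i g.
Proof.
apply/eqP; rewrite -subr_eq0; apply/eqP/ord_ge_eq0 => d.
elim: d f => [//|d IH] f; have [h ->] := series_decomp f.
have eD u v : sderiv i ((u + v) * g) - (sderiv i (u + v) * g +
    (u + v) * sderiv i g) =
    (sderiv i (u * g) - (sderiv i u * g + u * sderiv i g)) +
    (sderiv i (v * g) - (sderiv i v * g + v * sderiv i g)).
  by rewrite mulrDl !sderivD !mulrDl addrACA opprD addrACA.
rewrite eD sderivA mul0r add0r -!scalerAl !mul1r sderivZ subrr add0r.
rewrite mulr_suml !sderiv_sum !mulr_suml -big_split /= -sumrB.
apply: ord_ge_sum => l _; rewrite -mulrA !sderiv_svarM mulrDl.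
rewrite [X in _ - X](_ : _ = (i == l)%:R * (h l * g) +
   svar R l * (sderiv i (h l) * g + h l * sderiv i g)); last first.
  by rewrite mulrDr -!mulrA addrA.
rewrite opprD addrACA subrr add0r -mulrBr -[d.+1]add1n.
by apply: ord_geM (IH _); apply: ord_ge_svar.
Qed.

End SeriesToolkit.

(** * Algebra morphisms between power series rings *)

Section SeriesMorphisms.
Variable k : fieldType.

Lemma series_geom n (h : mpseries n k) :
  ord_ge 1 h -> exists g, g * (1 - h) = 1.
Proof.
move=> hh.
(* Powers of [h] beyond [mdeg m] have no coefficient at [m], so the infinite geometric series is
   read off from a partial sum depending on [m]. *)
pose G := MPSeries (fun m => scoef (\sum_(j < (mdeg m).+1) h ^+ j) m).
have hG d : ord_ge d (G - \sum_(j < d) h ^+ j).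
  move=> m lt_md; rewrite scoefB !scoef_sum -(subnKC lt_md) big_split_ord /=.
  rewrite !scoef_sum opprD addrA subrr add0r big1 ?oppr0 // => j _.
  by apply: (@ord_geX _ _ 1) => //; rewrite mul1n ltnS leq_addr.
exists G; apply/eqP; rewrite -subr_eq0; apply/eqP/ord_ge_eq0 => d.
rewrite -(subrK (\sum_(j < d) h ^+ j) G) mulrDl.
rewrite [X in _ + X - 1]mulrC.
have := subrX1 h d; rewrite -[h - 1]opprB mulNr => /(congr1 -%R).
rewrite opprK opprB => <-; rewrite -addrA [_ - _ - 1]addrAC subrr add0r.
apply: ord_geB; first by rewrite mulrC; apply: ord_geMr.
by have := @ord_geX _ _ 1 d _ hh; rewrite mul1n.
Qed.

Lemma series_unit n (f : mpseries n k) :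
  scoef f 0 != 0 -> exists g, g * f = 1.
Proof.
move=> nz; have [|g hg] := @series_geom n (1 - (scoef f 0)^-1 *: f).
  by apply/ord_ge1P; rewrite scoefB scoefZ scoef1 eqxx mulVf ?subrr.
exists ((scoef f 0)^-1 *: g).
by rewrite -scalerAl scalerAr -[RHS]hg opprB addrC subrK.
Qed.

Section Morphism.
Variables (n m : nat) (psi : {lrmorphism mpseries n k -> mpseries m k}).

Lemma lrmorph_alg c : psi c%:A = c%:A.
Proof. by rewrite linearZ rmorph1. Qed.

(** If [psi f] had a nonzero constant term c, then f - c would be a unit whose image has constant
    term 0. Continuity of algebra morphisms, and hence their determination by the images of the
    variables, rests on this. *)
Lemma lrmorph_local f : ord_ge 1 f -> ord_ge 1 (psi f).
Proof.
move=> /ord_ge1P f0; apply/ord_ge1P; apply/eqP/negPn/negP => nz.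
have [|g hg] := @series_unit n (f - (scoef (psi f) 0)%:A).
  by rewrite scoefB f0 scoefA eqxx mulr1 add0r oppr_eq0.
have e : psi g * (psi f - (scoef (psi f) 0)%:A) = 1.
  by rewrite -lrmorph_alg -rmorphB -rmorphM hg rmorph1.
have /eqP := congr1 (fun u => scoef u 0) e.
rewrite scoef0M scoefB scoefA eqxx mulr1 subrr mulr0 scoef1 eqxx eq_sym.
by rewrite oner_eq0.
Qed.

Lemma lrmorph_svar l : ord_ge 1 (psi (svar k l)).
Proof. exact/lrmorph_local/ord_ge_svar. Qed.

Lemma lrmorph_ord_ge d f : ord_ge d f -> ord_ge d (psi f).
Proof.
elim: d f => [//|d IH] f hf.
have [|g [ef hg]] := @svar_division _ _ predT f.
  move=> a ha; apply: hf; rewrite mdegE big1 // => l _; exact: ha.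
rewrite ef rmorph_sum /=; apply: ord_ge_sum => l _; rewrite rmorphM -[d.+1]add1n.
by apply: ord_geM (lrmorph_svar l) (IH _ (hg _ hf _)).
Qed.

Lemma lrmorph_ext (psi' : {lrmorphism mpseries n k -> mpseries m k}) :
  (forall l, psi (svar k l) = psi' (svar k l)) -> psi =1 psi'.
Proof.
move=> e f; apply/eqP; rewrite -subr_eq0; apply/eqP/ord_ge_eq0 => d.
elim: d f => [//|d IH] f; have [g ->] := series_decomp f.
rewrite !rmorphD /= !linearZ !rmorph1 opprD addrACA subrr add0r.
rewrite !rmorph_sum -sumrB; apply: ord_ge_sum => l _.
rewrite !rmorphM /= -e -mulrBr -[d.+1]add1n.
apply: ord_geM (IH _); exact: lrmorph_svar.
Qed.

(** The defect [D] of the chain rule is additive, vanishes on constants and satisfies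
    [D (svar k l * h) = psi (svar k l) * D h], so its order grows without bound as in the Leibniz
    rule. *)
Lemma lrmorph_deriv i f :
  sderiv i (psi f) = \sum_l psi (sderiv l f) * sderiv i (psi (svar k l)).
Proof.
apply/eqP; rewrite -subr_eq0; apply/eqP/ord_ge_eq0 => d.
elim: d f => [//|d IH] f.
pose D f := sderiv i (psi f) -
  \sum_l psi (sderiv l f) * sderiv i (psi (svar k l)).
have DD u v : D (u + v) = D u + D v.
  rewrite /D rmorphD sderivD addrACA -opprD -big_split; congr (_ + _ - _).
  by apply: eq_bigr => l _ /=; rewrite sderivD rmorphD mulrDl.
have D0 : D 0 = 0 by apply: (@addrI _ (D 0)); rewrite -DD !addr0.
have DX l h : D (svar k l * h) = psi (svar k l) * D h.
  rewrite /D rmorphM sderivM mulrBr [X in _ - X](_ : _ =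
    sderiv i (psi (svar k l)) * psi h +
    psi (svar k l) * (\sum_j psi (sderiv j h) * sderiv i (psi (svar k j)))).
    by rewrite opprD addrACA subrr add0r.
  rewrite mulr_sumr (bigD1 l) //= [in RHS](bigD1 l) //= addrA; congr (_ + _).
    by rewrite sderiv_svarM eqxx mul1r rmorphD rmorphM mulrDl mulrC mulrA.
  apply: eq_bigr => j /negPf nj.
  by rewrite sderiv_svarM nj mul0r add0r rmorphM mulrA.
have [g ->] := series_decomp f; rewrite -/(D _) DD.
rewrite [D _](_ : _ = 0) ?add0r; last first.
  rewrite /D lrmorph_alg sderivA sub0r big1 ?oppr0 // => l _.
  by rewrite sderivA rmorph0 mul0r.
rewrite (big_morph D DD D0); apply: ord_ge_sum => l _.
rewrite DX -[d.+1]add1n; apply: ord_geM (IH _); exact: lrmorph_svar.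
Qed.

End Morphism.

Lemma subst_exists n m (z : 'I_n -> mpseries m k) :
  (forall l, ord_ge 1 (z l)) ->
  exists psi : {lrmorphism mpseries n k -> mpseries m k},
    forall l, psi (svar k l) = z l.
Proof.
move=> hz; pose M := mmap (GRing.in_alg (mpseries m k)) z.
have MB p q : M (p - q) = M p - M q by rewrite /M rmorphB.
have hM d (p : {mpoly k[n]}) :
    (forall a, (mdeg a < d)%N -> p@_a = 0) -> ord_ge d (M p).
  move=> hp; rewrite /M /mmap; apply: ord_ge_sum => a _.
  case: (ltnP (mdeg a) d) => [/hp -> | le_d]; first by rewrite rmorph0 mul0r.
  apply/ord_geMr/(ord_geW le_d); rewrite /mmap1 mdegE.
  elim/big_rec2: _ => // i e u _ hu; apply: ord_geM hu.
  by have := @ord_geX _ _ 1 (a i) _ (hz i); rewrite mul1n.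
(* Since every [z l] has order at least 1, monomials of degree above [mdeg b] cannot contribute at
   [b]. By [SP] below, [S f] is the only series close to the substituted truncations, so each
   morphism law is checked on polynomials. *)
pose S f : mpseries m k :=
  MPSeries (fun b => scoef (M (strunc (mdeg b).+1 f)) b).
have struncN0 d f a : (strunc d f)@_a = if (mdeg a < d)%N then scoef f a else 0.
  case: ltnP => [/struncE -> // | le].
  rewrite /strunc raddf_sum /= big1 // => -[c hc] _ /=.
  rewrite mcoeffZ mcoeffX /=; case: eqP => [e | _]; last by rewrite mulr0.
  by move: hc; rewrite e ltnNge le.
have hS d f : ord_ge d (S f - M (strunc d f)).
  move=> b lt_bd; rewrite scoefB /= -scoefB -MB.
  apply: (hM (mdeg b).+1) => // a lt; rewrite mcoeffB !struncN0 lt.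
  by rewrite (leq_trans lt lt_bd) subrr.
have SP f g : (forall d, ord_ge d (g - M (strunc d f))) -> S f = g.
  move=> h; apply/eqP; rewrite -subr_eq0; apply/eqP/ord_ge_eq0 => d.
  have -> : S f - g = (S f - M (strunc d f)) - (g - M (strunc d f)).
    by rewrite opprB addrA subrK.
  by apply: (ord_geB (hS _ _)).
have sub4 (u v w x : mpseries m k) : (u - v) - (w - x) = (u - w) - (v - x).
  by rewrite !opprB ![u - _ + _]addrACA [- v - w]addrC.
have SB f g : S (f - g) = S f - S g.
  apply: SP => d.
  rewrite (_ : strunc d (f - g) = strunc d f - strunc d g); last first.
    by apply/mpolyP => a; rewrite mcoeffB !struncN0; case: ifP; rewrite ?subrr.
  rewrite MB sub4.
  by apply: (ord_geB (hS _ _) (hS _ _)).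
have SM f g : S (f * g) = S f * S g.
  apply: SP => d; rewrite -(subrK (M (strunc d f * strunc d g)) (_ * _)) -addrA.
  apply: ord_geD.
    rewrite [M _]rmorphM (_ : _ - _ = (S f - M (strunc d f)) * S g +
      M (strunc d f) * (S g - M (strunc d g))).
      by apply: ord_geD; [rewrite mulrC|]; apply/ord_geMr/hS.
    by rewrite mulrBl mulrBr addrA subrK.
  rewrite -MB; apply: hM => a lt.
  by rewrite mcoeffB struncE // -[scoef (f * g) a]/(scoef (smul f g) a) (smulE _ _ lt) subrr.
have S1 : S 1 = 1.
  apply: SP => d.
  rewrite -[1 in X in X - _](rmorph1 (mmap (GRing.in_alg (mpseries m k)) z)) -MB.
  apply: hM => a lt.
  by rewrite mcoeffB struncE // mcoeff1 scoef1 subrr.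
have SZ c f : S (c *: f) = c *: S f.
  apply: SP => d; rewrite (_ : strunc d (c *: f) = c *: strunc d f); last first.
    by apply/mpolyP => a; rewrite mcoeffZ !struncN0; case: ifP; rewrite ?mulr0.
  by rewrite /M mmapZ mulr_algl -scalerBr; apply/ord_geZ/hS.
have SX l : S (svar k l) = z l.
  apply: SP => d; have -> : z l = M 'X_l by rewrite /M mmapX mmap1U.
  rewrite -MB; apply: hM => a lt.
  by rewrite mcoeffB struncE // mcoeffX /= eq_sym subrr.
have SB' : {morph S : f g / f - g} := SB.
have SM' : monoid_morphism S by split.
have SZ' : scalable S := SZ.
pose psi : {lrmorphism mpseries n k -> mpseries m k} := HB.pack S
  (GRing.isZmodMorphism.Build _ _ S SB') (GRing.isMonoidMorphism.Build _ _ S SM')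
  (GRing.isScalable.Build _ _ _ _ S SZ').
by exists psi.
Qed.

End SeriesMorphisms.

Arguments scoef : simpl never.
Arguments tcoef : simpl never.
Arguments sderiv : simpl never.

(** * Series in one and two variables *)

Section OneVariable.
Variable R : comNzRingType.
Implicit Types f g : mpseries 1 R.

Definition tvar : mpseries 1 R := svar R ord0.

Lemma mnm1var (m : 'X_{1..1}) : m = (U_(ord0) *+ m ord0)%MM.
Proof. by apply/mnmP => i; rewrite mulmnE mnm1E (ord1 i) eqxx mul1n. Qed.

Lemma tcoef_inj f g : (forall d, tcoef f d = tcoef g d) -> f = g.
Proof. by move=> h; apply: mpseriesP => m; rewrite (mnm1var m); apply: h. Qed.

Lemma ord_ge_tcoef d f : ord_ge d f <-> forall i, (i < d)%N -> tcoef f i = 0.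
Proof.
split=> [h i lt|h m lt]; first by apply: h; rewrite mdegMn mdeg1 mul1n.
by rewrite (mnm1var m); apply: h; rewrite (mnm1var m) mdegMn mdeg1 mul1n in lt.
Qed.

Lemma tcoefD f g d : tcoef (f + g) d = tcoef f d + tcoef g d.
Proof. by []. Qed.

Lemma tcoefB f g d : tcoef (f - g) d = tcoef f d - tcoef g d.
Proof. by []. Qed.

Lemma tcoefZ c f d : tcoef (c *: f) d = c * tcoef f d.
Proof. by []. Qed.

Lemma tcoef0 d : tcoef (0 : mpseries 1 R) d = 0.
Proof. by []. Qed.

Lemma tcoef_sum (I : Type) (r : seq I) (P : pred I) (F : I -> mpseries 1 R) d :
  tcoef (\sum_(i <- r | P i) F i) d = \sum_(i <- r | P i) tcoef (F i) d.
Proof. exact: scoef_sum. Qed.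

Lemma tcoef_tXM N f d :
  tcoef (tvar ^+ N * f) d = if (N <= d)%N then tcoef f (d - N) else 0.
Proof.
rewrite /tcoef /tvar svarX scoef_smonM.
have -> : (U_(ord0 : 'I_1) *+ N <= U_(ord0) *+ d)%MM = (N <= d)%N.
  apply/mnm_lepP/idP => [/(_ ord0)|le i]; rewrite !mulmnE mnm1E ?(ord1 i) ?eqxx ?mul1n //.
case: ifP => // _; congr scoef; apply/mnmP => i.
by rewrite !mnmE (ord1 i) !mulmnE mnm1E eqxx !mul1n.
Qed.

Lemma tcoef_tX N d : tcoef (tvar ^+ N) d = (d == N)%:R.
Proof.
rewrite -[tvar ^+ N]mulr1 tcoef_tXM /tcoef scoef1 -mdeg_eq0 mdegMn mdeg1 mul1n.
by case: leqP => [le|lt]; [rewrite subn_eq0 eqn_leq le andbT | rewrite ltn_eqF].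
Qed.

Lemma ord_ge_tX N : ord_ge N (tvar ^+ N).
Proof. by apply/ord_ge_tcoef => i lt; rewrite tcoef_tX ltn_eqF. Qed.

Lemma ord_ge_tdvd N f : ord_ge N f -> exists g, f = tvar ^+ N * g.
Proof.
move=> hf; rewrite /tvar svarX; apply: smon_dvd => m nle; apply: hf.
rewrite ltnNge; apply: contra nle => le; apply/mnm_lepP => i.
by rewrite mulmnE mnm1E (ord1 i) eqxx mul1n (leq_trans le) // mdegE big_ord1.
Qed.

Lemma tsplit d f :
  exists g, f = \sum_(i < d) tcoef f i *: tvar ^+ i + tvar ^+ d * g.
Proof.
have [|g eg] := @ord_ge_tdvd d (f - \sum_(i < d) tcoef f i *: tvar ^+ i).
  apply/ord_ge_tcoef => i lt; rewrite tcoefB tcoef_sum (bigD1 (Ordinal lt)) //=.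
  rewrite tcoefZ tcoef_tX eqxx mulr1 big1 ?addr0 ?subrr // => j ne.
  rewrite tcoefZ tcoef_tX; case: eqP => [e|_]; last by rewrite mulr0.
  by case/negP: ne; apply/eqP/val_inj.
by exists g; rewrite -eg addrC subrK.
Qed.

Lemma tcoefM f g d :
  tcoef (f * g) d = \sum_(i < d.+1) tcoef f i * tcoef g (d - i).
Proof.
have [h eh] := tsplit d.+1 f; rewrite [in LHS]eh mulrDl mulr_suml tcoefD tcoef_sum.
rewrite -mulrA tcoef_tXM ltnn addr0; apply: eq_bigr => i _.
by rewrite -scalerAl tcoefZ tcoef_tXM -ltnS ltn_ord.
Qed.

Lemma tcoef0M f g : tcoef (f * g) 0 = tcoef f 0 * tcoef g 0.
Proof. by rewrite tcoefM big_ord1. Qed.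

Lemma tcoefA c d : tcoef (c%:A : mpseries 1 R) d = c * (d == 0%N)%:R.
Proof. by rewrite tcoefZ -[1]/(tvar ^+ 0) tcoef_tX. Qed.

Lemma tcoef_sderiv f d :
  tcoef (sderiv ord0 f) d = tcoef f d.+1 *+ d.+1.
Proof.
rewrite /tcoef scoef_sderiv -mulmSr mulmnE mnm1E eqxx mul1n; congr (_ *+ _).
Qed.

End OneVariable.

Section TwoVariables.
Variable k : fieldType.
Implicit Types F G : mpseries 2 k.

Definition mnm2 x y : 'X_{1..2} := (U_(ord0) *+ x + U_(ord_max) *+ y)%MM.

Lemma mnm2E (m : 'X_{1..2}) : m = mnm2 (m ord0) (m ord_max).
Proof.
apply/mnmP => i; rewrite mnmDE !mulmnE !mnm1E.
case: (unliftP ord0 i) => [j ->|->]; last by rewrite eqxx /= mul1n addn0.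
by rewrite (ord1 j) /= mul0n add0n (_ : lift _ _ = ord_max) ?eqxx ?mul1n //; apply: val_inj.
Qed.

Lemma mnm20 x y : mnm2 x y ord0 = x.
Proof. by rewrite mnmDE !mulmnE !mnm1E eqxx /= mul1n addn0. Qed.

Lemma mnm21 x y : mnm2 x y ord_max = y.
Proof. by rewrite mnmDE !mulmnE !mnm1E eqxx /= mul1n add0n. Qed.

Lemma mdeg_mnm2 x y : mdeg (mnm2 x y) = (x + y)%N.
Proof. by rewrite mdegD !mdegMn !mdeg1 !mul1n. Qed.

Lemma lem_mnm2 a b x y :
  (mnm2 a b <= mnm2 x y)%MM = (a <= x)%N && (b <= y)%N.
Proof.
apply/mnm_lepP/andP => [h | [h0 h1] i].
  by have := h ord0; have := h ord_max; rewrite !mnm20 !mnm21.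
case: (unliftP ord0 i) => [j ->|->]; last by rewrite !mnm20.
by rewrite (ord1 j) (_ : lift _ _ = ord_max) ?mnm21 //; apply: val_inj.
Qed.

Lemma mnm2B a b x y : (mnm2 x y - mnm2 a b)%MM = mnm2 (x - a) (y - b).
Proof. by rewrite [LHS]mnm2E !mnmBE !mnm20 !mnm21. Qed.

Definition wcoef F x y := scoef F (mnm2 x y).

Arguments wcoef : simpl never.

Definition Tvar : mpseries 2 k := svar k ord0.
Definition Svar : mpseries 2 k := svar k ord_max.

Lemma wcoefD F G x y : wcoef (F + G) x y = wcoef F x y + wcoef G x y.
Proof. by []. Qed.

Lemma wcoefB F G x y : wcoef (F - G) x y = wcoef F x y - wcoef G x y.
Proof. by []. Qed.

Lemma wcoefZ c F x y : wcoef (c *: F) x y = c * wcoef F x y.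
Proof. by []. Qed.

Lemma wcoef_sum (I : Type) (r : seq I) (P : pred I) (F : I -> mpseries 2 k) x y :
  wcoef (\sum_(i <- r | P i) F i) x y = \sum_(i <- r | P i) wcoef (F i) x y.
Proof. exact: scoef_sum. Qed.

Lemma TSvarX a b : Tvar ^+ a * Svar ^+ b = smon k (mnm2 a b).
Proof. by rewrite !svarX smonM. Qed.

Lemma wcoef_TSM a b F x y : wcoef (Tvar ^+ a * Svar ^+ b * F) x y =
  if (a <= x)%N && (b <= y)%N then wcoef F (x - a) (y - b) else 0.
Proof. by rewrite TSvarX /wcoef scoef_smonM lem_mnm2 mnm2B. Qed.

Lemma wcoef_TM a F x y : wcoef (Tvar ^+ a * F) x y =
  if (a <= x)%N then wcoef F (x - a) y else 0.
Proof.
by rewrite -[Tvar ^+ a]mulr1 -(expr0 Svar) wcoef_TSM leq0n andbT subn0.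
Qed.

Lemma wcoef_SM b F x y : wcoef (Svar ^+ b * F) x y =
  if (b <= y)%N then wcoef F x (y - b) else 0.
Proof.
by rewrite -[Svar ^+ b]mul1r -(expr0 Tvar) wcoef_TSM leq0n subn0.
Qed.

Lemma ord_ge_wcoef d F x y : ord_ge d F -> (x + y < d)%N -> wcoef F x y = 0.
Proof. by move=> h lt; apply: h; rewrite mdeg_mnm2. Qed.

Lemma SvarX_dvd a b F G :
  Tvar ^+ a * F = Svar ^+ b * G -> exists H, F = Svar ^+ b * H.
Proof.
move=> e; rewrite svarX; apply: smon_dvd => m nle.
have lt : (m ord_max < b)%N.
  rewrite ltnNge; apply: contra nle => le; apply/mnm_lepP => i.
  rewrite mulmnE mnm1E; case: eqP => [<-|_]; by rewrite ?mul1n ?mul0n.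
have := congr1 (fun F => wcoef F (a + m ord0) (m ord_max)) e.
rewrite /= wcoef_TM wcoef_SM leq_addr addKn leqNgt lt /= => <-.
by rewrite /wcoef -mnm2E.
Qed.

(** S^N and T^N - S^N are coprime: the hypothesis gives S^N (F + G) = T^N G, so S^N divides F + G's
    partner G, and S^N can be cancelled. *)
Lemma TSvarX_dvd N F G :
  Svar ^+ N * F = (Tvar ^+ N - Svar ^+ N) * G ->
  exists H, F = (Tvar ^+ N - Svar ^+ N) * H.
Proof.
move=> e; have [|H eH] := @SvarX_dvd N N G (F + G).
  by rewrite mulrDr e mulrBl subrK.
have nz : Svar ^+ N != 0.
  apply/eqP => /(congr1 (fun F => wcoef F 0 N)).
  rewrite -[Svar ^+ N]mulr1 wcoef_SM leqnn subnn /wcoef scoef1.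
  rewrite -mdeg_eq0 mdeg_mnm2 /= => /eqP; by rewrite oner_eq0.
exists H; apply: (mulfI nz); rewrite e eH; by rewrite mulrCA.
Qed.

Definition iota1 : {lrmorphism mpseries 1 k -> mpseries 2 k} :=
  projT1 (cid (@subst_exists k 1 2 (fun=> Tvar) (fun=> ord_ge_svar _ _))).
Definition iota2 : {lrmorphism mpseries 1 k -> mpseries 2 k} :=
  projT1 (cid (@subst_exists k 1 2 (fun=> Svar) (fun=> ord_ge_svar _ _))).
Definition diag : {lrmorphism mpseries 2 k -> mpseries 1 k} :=
  projT1 (cid (@subst_exists k 2 1 (fun=> tvar k) (fun=> ord_ge_svar _ _))).

Lemma iota1_tvar : iota1 (tvar k) = Tvar.
Proof. by rewrite /iota1; case: cid => p /= ->. Qed.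
Lemma iota2_tvar : iota2 (tvar k) = Svar.
Proof. by rewrite /iota2; case: cid => p /= ->. Qed.
Lemma diag_svar i : diag (svar k i) = tvar k.
Proof. by rewrite /diag; case: cid => p /= ->. Qed.

Lemma diag_iota1 f : diag (iota1 f) = f.
Proof.
pose h : {lrmorphism mpseries 1 k -> mpseries 1 k} := diag \o iota1.
apply: (@lrmorph_ext _ _ _ h (idfun : {lrmorphism mpseries 1 k -> mpseries 1 k})) => l /=.
by rewrite (ord1 l) -/(tvar k) iota1_tvar diag_svar.
Qed.

Lemma diag_iota2 f : diag (iota2 f) = f.
Proof.
pose h : {lrmorphism mpseries 1 k -> mpseries 1 k} := diag \o iota2.
apply: (@lrmorph_ext _ _ _ h (idfun : {lrmorphism mpseries 1 k -> mpseries 1 k})) => l /=.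
by rewrite (ord1 l) -/(tvar k) iota2_tvar diag_svar.
Qed.

Lemma wcoef_iota f g x y :
  wcoef (iota1 f * iota2 g) x y = tcoef f x * tcoef g y.
Proof.
have [f' ef] := tsplit x.+1 f; have [g' eg] := tsplit y.+1 g.
rewrite [in LHS]ef rmorphD rmorphM rmorphXn /= iota1_tvar mulrDl -[Tvar ^+ _ * _ * _]mulrA.
rewrite wcoefD [X in _ + X]wcoef_TM ltnn addr0 raddf_sum mulr_suml wcoef_sum.
rewrite (bigD1 (Ordinal (ltnSn x))) //= big1 ?addr0 => [|i ne].
  rewrite linearZ rmorphXn /= iota1_tvar -scalerAl wcoefZ wcoef_TM leqnn subnn.
  congr (_ * _); rewrite eg rmorphD rmorphM rmorphXn /= iota2_tvar.
  rewrite wcoefD [X in _ + X]wcoef_SM ltnn addr0 raddf_sum wcoef_sum.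
  rewrite (bigD1 (Ordinal (ltnSn y))) //= big1 ?addr0 => [|i ne].
    rewrite linearZ rmorphXn /= iota2_tvar wcoefZ -[Svar ^+ y]mulr1 wcoef_SM leqnn.
    rewrite subnn /wcoef scoef1 -mdeg_eq0 mdeg_mnm2 mulr1 tcoefD tcoef_sum.
    rewrite tcoef_tXM ltnn addr0 (bigD1 (Ordinal (ltnSn y))) //= tcoefZ tcoef_tX eqxx mulr1.
    rewrite big1 ?addr0 // => j ne; rewrite tcoefZ tcoef_tX.
    case: eqP => [e|_]; last by rewrite mulr0.
    by case/negP: ne; apply/eqP/val_inj.
  rewrite linearZ rmorphXn /= iota2_tvar wcoefZ -[Svar ^+ i]mulr1 wcoef_SM.
  case: ifP => [le|]; last by rewrite mulr0.
  rewrite /wcoef scoef1 -mdeg_eq0 mdeg_mnm2 add0n subn_eq0 leqNgt.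
  by rewrite ltn_neqAle le andbT (_ : (i : nat) != y) ?mulr0.
rewrite linearZ rmorphXn /= iota1_tvar -scalerAl wcoefZ wcoef_TM.
case: ifP => [le|]; last by rewrite mulr0.
rewrite eg rmorphD rmorphM rmorphXn /= iota2_tvar wcoefD [X in _ + X]wcoef_SM ltnn.
rewrite addr0 raddf_sum wcoef_sum big1 ?mulr0 //= => j _.
rewrite linearZ rmorphXn /= iota2_tvar wcoefZ -[Svar ^+ j]mulr1 wcoef_SM.
case: ifP => [le'|]; last by rewrite mulr0.
rewrite /wcoef scoef1 -mdeg_eq0 mdeg_mnm2 addn_eq0 subn_eq0 leqNgt.
by rewrite ltn_neqAle le andbT (_ : (i : nat) != x) ?mulr0.
Qed.

Lemma tcoef_diag F d : tcoef (diag F) d = \sum_(i < d.+1) wcoef F i (d - i).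
Proof.
elim: d F => [|d IH] F; have [g eg] := series_decomp F.
  rewrite big_ord1 {1}eg rmorphD tcoefD /= lrmorph_alg tcoefA mulr1.
  rewrite raddf_sum tcoef_sum big1 ?addr0 => [|i _ /=].
    by rewrite /wcoef (_ : mnm2 0 _ = 0%MM) //; apply/eqP; rewrite -mdeg_eq0 mdeg_mnm2.
  by rewrite rmorphM /= diag_svar -[tvar k]expr1 tcoef_tXM.
have eF x y : wcoef F x y = (x + y == 0)%N%:R * scoef F 0 +
    (if (0 < x)%N then wcoef (g ord0) x.-1 y else 0) +
    (if (0 < y)%N then wcoef (g ord_max) x y.-1 else 0).
  rewrite {1}eg wcoefD /wcoef scoefA -mdeg_eq0 mdeg_mnm2 mulrC -addrA; congr (_ + _).
  rewrite big_ord_recl big_ord1 scoefD (_ : lift _ _ = ord_max); last exact: val_inj.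
  congr (_ + _).
    by have := wcoef_TM 1 (g ord0) x y; rewrite expr1 subn1.
  by have := wcoef_SM 1 (g ord_max) x y; rewrite expr1 subn1.
rewrite [in LHS]eg rmorphD tcoefD /= lrmorph_alg tcoefA mulr0 add0r.
rewrite big_ord_recl big_ord1 (_ : lift _ _ = ord_max); last exact: val_inj.
rewrite rmorphD !rmorphM /= !diag_svar -[tvar k]expr1 tcoefD !tcoef_tXM /= subSS subn0.
rewrite !IH; under [RHS]eq_bigr => i _ do rewrite eF.
rewrite !big_split /= [X in _ = X + _ + _]big1 ?add0r => [|i _]; last first.
  by rewrite subnKC ?mul0r // -ltnS ltn_ord.
congr (_ + _).
  by rewrite [RHS]big_ord_recl /= add0r; apply: eq_bigr => i _; rewrite subSS.
rewrite [RHS]big_ord_recr /= subnn ltnn addr0; apply: eq_bigr => i _.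
have le : (i <= d)%N by rewrite -ltnS.
by rewrite subn_gt0 ltn_ord (subSn le).
Qed.

(* [(T^g - S^g) / (T - S)] is the reproducing kernel of the functional
   [coefficient of t^(g-1)]. *)
Lemma wcoef_kernel g F :
  wcoef ((\sum_(i < g.+1) Tvar ^+ (g - i) * Svar ^+ i) * F) g g =
  tcoef (diag F) g.
Proof.
rewrite mulr_suml wcoef_sum tcoef_diag; apply: eq_bigr => i _.
have le : (i <= g)%N by rewrite -ltnS.
by rewrite wcoef_TSM leq_subr le /= subKn.
Qed.

End TwoVariables.

(** * The socle of a complete intersection *)

Section Socle.
Variables (k : fieldType) (n : nat).
Local Notation S := (mpseries n k).
Local Notation Xv l := (svar k (l : 'I_n)).

Lemma svar_split (l : 'I_n) (f : S) : exists f0 a, f = f0 + Xv l * a /\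
  forall m : 'X_{1..n}, m l != 0%N -> scoef f0 m = 0.
Proof.
pose f0 : S := MPSeries (fun m => if m l == 0%N then scoef f m else 0).
have f0E m : scoef f0 m = if m l == 0%N then scoef f m else 0 by [].
have [|a ea] := @smon_dvd n k U_(l) (f - f0).
  by move=> m; rewrite lep1mP negbK scoefB f0E => ->; exact: subrr.
exists f0, a; split; first by rewrite svar_smon -ea addrC subrK.
by move=> m /negPf nz; rewrite f0E nz.
Qed.

Lemma svar_lreg (l : 'I_n) (f : S) : Xv l * f = 0 -> f = 0.
Proof.
move=> e; apply: mpseriesP => m; have := congr1 (fun u => scoef u (m + U_(l))) e.
by rewrite /= svar_smon scoef_smonM lem_addl addmK.
Qed.

(* Exactness of the Koszul complex of the variables in degree one. *)
Lemma koszul_ind (P : 'rV[S]_n -> Prop) :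
  P 0 -> (forall u v, P u -> P v -> P (u + v)) ->
  (forall p q a, P (a *: (Xv q *: delta_mx 0 p - Xv p *: delta_mx 0 q))) ->
  forall w : 'rV[S]_n, \sum_l w 0 l * Xv l = 0 -> P w.
Proof.
move=> P0 PD PK.
suff Q i : (i <= n)%N -> forall w : 'rV[S]_n, \sum_l w 0 l * Xv l = 0 ->
    (forall l : 'I_n, (l < n - i)%N -> w 0 l = 0) -> P w.
  by move=> w e; apply: (Q n) => // l; rewrite subnn.
elim: i => [_ w e h|i IH lt w e h].
  by rewrite (_ : w = 0) //; apply/rowP => l; rewrite h ?subn0 // mxE.
have lt0 : (n - i.+1 < n)%N by rewrite -subn_gt0 subKn.
pose l0 := Ordinal lt0.
have /choice[fa hfa] l := svar_split l0 (w 0 l).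
have /choice[a ha] := hfa.
(* Koszul relations move every multiple of X_l0 out of the later components into component l0. In
   the remaining relation X_l0 [w' 0 l0] equals a sum free of X_l0, so [w' 0 l0] vanishes and the
   support has shrunk. *)
pose w' := w - \sum_(l < n | (l0 < l)%N) a l *: (Xv l0 *: delta_mx 0 l - Xv l *: delta_mx 0 l0).
have w'E j : w' 0 j = w 0 j - (if (l0 < j)%N then Xv l0 * a j else 0)
    + (if j == l0 then \sum_(l < n | (l0 < l)%N) Xv l * a l else 0).
  rewrite !mxE summxE -addrA; congr (_ + _).
  have eT l : (a l *: (Xv l0 *: delta_mx 0 l - Xv l *: delta_mx 0 l0)
      : 'rV[S]_n) 0 j = (Xv l0 * a l) *+ (j == l) - (Xv l * a l) *+ (j == l0).
    by rewrite !mxE eqxx /= mulrBr !mulr_natr !mulrnAr ![a l * _]mulrC.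
  under eq_bigr => l _ do rewrite eT.
  rewrite sumrB opprB [RHS]addrC; congr (_ - _).
    by case: eqP => _ //; apply: big1.
  case: ifPn => [lt_j | nlt]; last first.
    apply: big1 => l ltl; case: eqP => // ej; by rewrite ej ltl in nlt.
  rewrite (bigD1 j) //= eqxx big1 ?addr0 // => l /andP[_ /negPf nl].
  by rewrite eq_sym nl.
have w'X : \sum_l w' 0 l * Xv l = 0.
  under eq_bigr => j _ do rewrite w'E mulrDl mulrBl.
  rewrite big_split sumrB /= e sub0r [X in - X + _](_ : _ =
    \sum_(l < n | (l0 < l)%N) Xv l0 * a l * Xv l).
    rewrite [X in _ + X](bigD1 l0) //= eqxx.
    rewrite [X in _ + (_ + X)]big1 => [|j /negPf ->]; last by rewrite mul0r.
    rewrite addr0 mulr_suml addrC; apply/eqP; rewrite subr_eq0; apply/eqP.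
    by apply: eq_bigr => l _; rewrite mulrC mulrA [Xv l0 * _ * _]mulrAC.
  by rewrite [RHS]big_mkcond; apply: eq_bigr => j _; case: ifP => //; rewrite mul0r.
have w'l0 : w' 0 l0 = 0.
  apply: (@svar_lreg l0); apply: mpseriesP => m.
  have [ml|ml] := eqVneq (m l0) 0%N.
    by rewrite svar_smon scoef_smonM lep1mP ml.
  have -> : Xv l0 * w' 0 l0 = - \sum_(l < n | (l0 < l)%N) fa l * Xv l.
    apply/eqP; rewrite -addr_eq0; apply/eqP; rewrite -[RHS]w'X.
    rewrite [RHS](bigD1 l0) //= [Xv l0 * _]mulrC; congr (_ + _).
    rewrite big_mkcond [RHS]big_mkcond; apply: eq_bigr => l _.
    case: (ltngtP l0 l) => [ltl|ltl|el].
    - rewrite w'E ltl (_ : l == l0 = false) ?addr0 /=; last first.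
        by apply/eqP => el; rewrite el ltnn in ltl.
      by have [-> _] := ha l; rewrite addrK.
    - rewrite w'E (_ : l == l0 = false); last by apply/eqP => el; rewrite el ltnn in ltl.
      by rewrite ltnNge ltnW //= h // subr0 addr0 mul0r.
    - by rewrite (_ : l == l0) //; apply/eqP/val_inj/esym.
  rewrite scoefN scoef_sum big1 ?oppr0 // => l ltl.
  rewrite mulrC svar_smon scoef_smonM; case: ifP => // _.
  have [_] := ha l; apply; rewrite mnmBE mnm1E (_ : l == l0 = false) ?subn0 //.
  by apply/eqP => el; rewrite el ltnn in ltl.
have -> : w = w' + \sum_(l < n | (l0 < l)%N)
    a l *: (Xv l0 *: delta_mx 0 l - Xv l *: delta_mx 0 l0) by rewrite subrK.
apply: (PD); last by apply: big_ind => // l _; apply: PK.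
apply: (IH (ltnW lt)) => //.
move=> l lt_l; have [lt'|] := ltnP l (n - i.+1).
  rewrite w'E h // sub0r ltnNge (ltnW lt') /= oppr0 add0r.
  by rewrite (_ : l == l0 = false) //; apply/eqP => el; rewrite el ltnn in lt'.
rewrite leq_eqVlt => /orP[/eqP el|]; last first.
  by rewrite ltnNge -ltnS -subSn // subSS lt_l.
by rewrite (_ : l = l0) //; apply: val_inj.
Qed.

Definition pow_ideal M (f : S) := exists h : 'I_n -> S, f = \sum_l h l * Xv l ^+ M.

Lemma pow_ideal0 M : pow_ideal M 0.
Proof. by exists (fun=> 0); rewrite big1 // => l _; rewrite mul0r. Qed.

Lemma pow_idealD M f g : pow_ideal M f -> pow_ideal M g -> pow_ideal M (f + g).
Proof.
move=> [h ->] [h' ->]; exists (fun l => h l + h' l).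
by rewrite -big_split; apply: eq_bigr => l _ /=; rewrite mulrDl.
Qed.

Lemma pow_idealM M a f : pow_ideal M f -> pow_ideal M (a * f).
Proof.
move=> [h ->]; exists (fun l => a * h l).
by rewrite mulr_sumr; apply: eq_bigr => l _; rewrite mulrA.
Qed.

Lemma pow_ideal_sum M (I : Type) (r : seq I) (P : pred I) (F : I -> S) :
  (forall i, P i -> pow_ideal M (F i)) -> pow_ideal M (\sum_(i <- r | P i) F i).
Proof.
by move=> h; apply: big_ind => //; [apply: pow_ideal0 | apply: pow_idealD].
Qed.

Lemma pow_ideal_var M l : pow_ideal M (Xv l ^+ M).
Proof.
exists (fun j => (j == l)%:R); rewrite (bigD1 l) //= eqxx mul1r big1 ?addr0 //.
by move=> j /negPf ->; rewrite mul0r.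
Qed.

Let xcol : 'cV[S]_n := \col_l Xv l.

Definition set_row (i : 'I_n) (w : 'rV[S]_n) (K : 'M[S]_n) : 'M[S]_n :=
  \matrix_(a, b) if a == i then w 0 b else K a b.

Lemma det_set_row i w (K : 'M[S]_n) :
  \det (set_row i w K) = \sum_j w 0 j * cofactor K i j.
Proof.
rewrite (expand_det_row _ i); apply: eq_bigr => j _; rewrite mxE eqxx.
congr (_ * (_ * \det _)); apply/matrixP => a b; rewrite !mxE.
by rewrite eq_sym (negPf (neq_lift _ _)).
Qed.

Lemma cofactor_set_row i w (K : 'M[S]_n) j :
  cofactor (set_row i w K) i j = cofactor K i j.
Proof.
congr (_ * \det _); apply/matrixP => a b; rewrite !mxE.
by rewrite eq_sym (negPf (neq_lift _ _)).
Qed.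

(** The determinant is linear in row [i], so by [koszul_ind] only Koszul rows matter. For these,
    Cramer's rule for [K] with row [i] replaced by the p-th unit vector gives X_q C_ip - X_p C_iq,
    with C the cofactors, as a combination of the other entries of [K *m xcol]. *)
Lemma det_syzygy M (i : 'I_n) (K : 'M[S]_n) (w : 'rV[S]_n) :
  (forall j, j != i -> pow_ideal M ((K *m xcol) j 0)) ->
  \sum_l w 0 l * Xv l = 0 -> pow_ideal M (\det (set_row i w K)).
Proof.
move=> hK; apply: (koszul_ind (P := fun w => pow_ideal M (\det (set_row i w K)))).
- rewrite det_set_row big1; first exact: pow_ideal0.
  by move=> j _; rewrite mxE mul0r.
- move=> u v; rewrite !det_set_row => hu hv.
  under eq_bigr => j _ do rewrite mxE mulrDl.
  by rewrite big_split; apply: pow_idealD.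
move=> p q a; rewrite det_set_row.
rewrite (_ : \sum_j _ = a * (Xv q * cofactor K i p - Xv p * cofactor K i q)); last first.
  under eq_bigr => j _ do rewrite !mxE eqxx /= -mulrA mulrBl.
  rewrite -mulr_sumr sumrB; congr (_ * (_ - _)).
    rewrite (bigD1 p) //= eqxx mulr1 big1 ?addr0 // => j /negPf ->.
    by rewrite mulr0 mul0r.
  rewrite (bigD1 q) //= eqxx mulr1 big1 ?addr0 // => j /negPf ->.
  by rewrite mulr0 mul0r.
apply: pow_idealM.
pose Kp := set_row i (delta_mx 0 p) K.
have detKp : \det Kp = cofactor K i p.
  rewrite det_set_row (bigD1 p) //= mxE !eqxx mul1r big1 ?addr0 // => j /negPf nj.
  by rewrite mxE nj andbF mul0r.
have /(congr1 (fun u : 'cV[S]_n => u q 0)) := mulmxA (\adj Kp) Kp xcol.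
rewrite mul_adj_mx mul_scalar_mx [RHS]mxE [RHS]mulrC [xcol q 0]mxE detKp => <-.
rewrite mxE (bigD1 i) //= [X in _ * X + _ - _](_ : _ = Xv p).
  rewrite mxE cofactor_set_row mulrC addrAC subrr add0r.
  apply: pow_ideal_sum => j nj; apply: pow_idealM.
  rewrite (_ : (Kp *m xcol) j 0 = (K *m xcol) j 0); first exact: hK.
  by rewrite !mxE; apply: eq_bigr => l _; rewrite !mxE (negPf nj).
rewrite mxE (bigD1 p) //= !mxE !eqxx mul1r big1 ?addr0 // => j /negPf nj.
by rewrite !mxE eqxx nj mul0r.
Qed.

(** The rows of [F] are exchanged for those of [E] one at a time. Two consecutive determinants
    differ by one whose exchanged row is a difference of rows, which is a syzygy of the
    variables. *)
Lemma det_independent M (E F : 'M[S]_n) :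
  E *m xcol = F *m xcol -> (forall j, pow_ideal M ((E *m xcol) j 0)) ->
  pow_ideal M (\det E - \det F).
Proof.
move=> eEF hE.
pose G i := \matrix_(a, b) (if (a < i)%N then E a b else F a b) : 'M[S]_n.
have GE i : G i *m xcol = E *m xcol.
  apply/colP => a; rewrite [LHS]mxE.
  case: (ltnP a i) => [lt|le].
    by rewrite mxE; apply: eq_bigr => b _; rewrite !mxE lt.
  by rewrite eEF mxE; apply: eq_bigr => b _; rewrite !mxE ltnNge le.
suff h i : (i <= n)%N -> pow_ideal M (\det (G i) - \det F).
  have := h n (leqnn n); congr (pow_ideal M (\det _ - _)).
  by apply/matrixP => a b; rewrite mxE ltn_ord.
elim: i => [_|i IH lt].
  rewrite (_ : G 0%N = F) ?subrr; first exact: pow_ideal0.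
  by apply/matrixP => a b; rewrite mxE.
rewrite -(subrK (\det (G i)) (\det _)) -addrA.
apply: pow_idealD; last exact/IH/ltnW.
pose i0 := Ordinal lt.
have eS (w : 'rV[S]_n) j : (forall b, w 0 b = G j i0 b) ->
    set_row i0 w (G i) = G j -> \det (G j) = \sum_b w 0 b * cofactor (G i) i0 b.
  by move=> _ <-; rewrite det_set_row.
have -> : \det (G i.+1) - \det (G i) =
    \det (set_row i0 (row i0 E - row i0 F) (G i)).
  rewrite det_set_row (eS (row i0 E) i.+1) => [|b|]; last 2 first.
  - by rewrite !mxE ltnSn.
  - apply/matrixP => a b; rewrite !mxE ltnS -val_eqE /=.
    by case: ltngtP => // ea; have -> : a = i0 by apply: val_inj.
  rewrite (eS (row i0 F) i) => [|b|]; last 2 first.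
  - by rewrite !mxE ltnn.
  - apply/matrixP => a b; rewrite !mxE -val_eqE /=.
    by case: ltngtP => // ea; have -> : a = i0 by apply: val_inj.
  rewrite -sumrB; apply: eq_bigr => b _; rewrite -mulrBl; congr (_ * _).
  by rewrite !mxE.
apply: det_syzygy => [j _|]; first by rewrite GE.
have := congr1 (fun u : 'cV[S]_n => u i0 0) eEF; rewrite !mxE => e.
apply/eqP; rewrite -[X in _ == X](subrr (\sum_j E i0 j * xcol j 0)) {2}e -sumrB.
by apply/eqP/eq_bigr => l _; rewrite !mxE mulrBl.
Qed.

Lemma prod_svarX (a : 'I_n -> nat) :
  \prod_l Xv l ^+ a l = smon k [multinom a l | l < n].
Proof.
rewrite [X in smon k X]multinomUE_id.
rewrite (big_morph (fun m => smon k m) (fun x y => esym (smonM k x y)) (smon0 n k)).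
by apply: eq_bigr => l _; rewrite svarX mnmE.
Qed.

(* Multiplying by [\det C] reduces the claim to the parameters [x_l ^ M], for
   which the determinant is the monomial with all exponents [M - 1]. *)
Lemma det_socle M (g : 'cV[S]_n) (B C : 'M[S]_n) :
  (0 < M)%N -> g = B *m xcol -> C *m g = \col_l Xv l ^+ M ->
  forall h : 'I_n -> S, \det B != \sum_j h j * g j 0.
Proof.
move=> M0 eg eC h; apply/eqP => eB.
pose D := diag_mx (\row_l Xv l ^+ M.-1) : 'M[S]_n.
have eD : D *m xcol = \col_l Xv l ^+ M.
  apply/colP => l; rewrite mul_diag_mx !mxE -exprSr prednK //.
have eCB : (C *m B) *m xcol = \col_l Xv l ^+ M by rewrite -mulmxA -eg.
have [||u eu] := @det_independent M D (C *m B); first by rewrite eD eCB.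
  by move=> j; rewrite eD mxE; apply: pow_ideal_var.
(* By [\adj C], multiplication by [\det C] sends the ideal of the [g j 0] into the ideal of the
   powers. The assumed relation for [\det B] thus puts [\det (C *m B)] there, and [\det D] with
   it. *)
have hC : pow_ideal M (\det C * \det B).
  rewrite eB mulr_sumr; apply: pow_ideal_sum => j _; rewrite mulrCA.
  apply: pow_idealM; have := mulmxA (\adj C) C g.
  rewrite mul_adj_mx mul_scalar_mx eC => /(congr1 (fun u : 'cV[S]_n => u j 0)).
  rewrite [RHS]mxE => <-; rewrite mxE; apply: pow_ideal_sum => l _.
  by apply: pow_idealM; rewrite mxE; apply: pow_ideal_var.
have : pow_ideal M (\det D).
  rewrite -(subrK (\det (C *m B)) (\det D)); apply: pow_idealD; last by rewrite det_mulmx.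
  by exists u.
rewrite det_diag => -[v].
under eq_bigr => l _ do rewrite mxE.
rewrite (prod_svarX (fun=> M.-1)) => /(congr1 (fun f => scoef f [multinom M.-1 | l < n])).
rewrite -[smon _ _]mulr1 scoef_smonM lepm_refl scoef_sum big1 => [|l _]; last first.
  rewrite mulrC svarX scoef_smonM; case: ifP => // /mnm_lepP /(_ l).
  by rewrite mulmnE mnm1E eqxx mul1n mnmE -ltnS prednK // ltnn.
rewrite scoef1 (_ : _ == _) => [/eqP|]; first by rewrite oner_eq0.
by apply/eqP/mnmP => l; rewrite mnmBE mnm0E subnn.
Qed.

End Socle.

(** * Lengths *)

Section FilteredLength.
Variables (k : fieldType) (R : comNzRingType) (V : lmodType k).
Variables (act : R -> V -> V) (al : k -> R) (ep : R -> k).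
Variables (m : nat) (chi : nat -> V -> k).

Definition flag n (v : V) := forall i, (i < n)%N -> chi i v = 0.

Hypothesis chi_lin : forall i a u v, chi i (a *: u + v) = a * chi i u + chi i v.
Hypothesis act_al : forall c v, act (al c) v = c *: v.
Hypothesis act_lin : forall a c u v, act a (c *: u + v) = c *: act a u + act a v.
Hypothesis act_ep : forall n a v, (n < m)%N -> flag n v ->
  flag n.+1 (act a v - ep a *: v).

Implicit Types N T W : set V.

(* The jumps of [W] along the flag, which count its dimension modulo
   [flag m]. *)
Definition leads W : {set 'I_m} :=
  [set i : 'I_m | `[< exists s, [/\ W s, flag i s & chi i s != 0] >]].

Lemma leadsP W (i : 'I_m) :
  i \in leads W <-> exists s, [/\ W s, flag i s & chi i s != 0].
Proof. by rewrite inE; split => /asboolP. Qed.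

Lemma chi0 i : chi i 0 = 0.
Proof. by have := chi_lin i (-1) 0 0; rewrite scaler0 addr0 mulN1r addNr. Qed.

Lemma submodule_lin N c u v :
  submodule act N -> N u -> N v -> N (c *: u + v).
Proof. by move=> [_ ND NA] Nu Nv; apply: ND => //; rewrite -act_al; apply: NA. Qed.

Lemma submoduleZ N c u : submodule act N -> N u -> N (c *: u).
Proof. by move=> [_ _ NA] Nu; rewrite -act_al; apply: NA. Qed.

Lemma leads_subset N T : N `<=` T -> leads N \subset leads T.
Proof.
move=> sub; apply/fintype.subsetP => i /leadsP[s [Ns Fs nz]]; apply/leadsP.
by exists s; split => //; apply: sub.
Qed.

(** An element of [T] is reduced by elements of [N], one flag position after another, until the
    remainder lies in [flag m], which is part of [N]. *)
Lemma leads_full N T : submodule act N -> submodule act T -> N `<=` T ->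
  flag m `<=` N -> leads T \subset leads N -> T `<=` N.
Proof.
move=> sN sT NT FN sub v Tv.
suff H n : (n <= m)%N -> exists2 w, N w & flag n ((-1) *: w + v).
  have [w Nw /FN/(submodule_lin 1 sN Nw)] := H m (leqnn m).
  by rewrite scale1r scaleN1r addNKr.
elim: n => [_|n IH lt]; first by exists 0; [case: sN | move=> i].
have [w Nw Fw] := IH (ltnW lt); set u := _ + v in Fw.
have Tu : T u by apply: submodule_lin => //; apply: NT.
have [u0|nz] := eqVneq (chi n u) 0.
  exists w => // i; rewrite ltnS leq_eqVlt => /orP[/eqP -> //|]; exact: Fw.
have /(fintype.subsetP sub)/leadsP[s [Ns Fs nzs]] : Ordinal lt \in leads T.
  by apply/leadsP; exists u.
exists ((chi n u / chi n s) *: s + w); first exact: submodule_lin.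
have -> : (-1) *: ((chi n u / chi n s) *: s + w) + v = (- (chi n u / chi n s)) *: s + u.
  by rewrite scalerDr -addrA scalerA mulN1r.
move=> i; rewrite chi_lin ltnS leq_eqVlt.
case/orP => [/eqP ->|lti]; last by rewrite (Fs i) // (Fw i) // mulr0 addr0.
by rewrite mulNr divfK // addNr.
Qed.

(** Take [v] in [T] outside [N] as deep in the flag as possible, so that everything of [T] deeper
    than [v] is in [N]. By [act_ep], a v - ep(a) v is deeper than [v]; hence N + k v is already a
    submodule, and it has exactly one new jump. This is where length over the ring becomes dimension
    over [k]. *)
Lemma leads_step N T : submodule act N -> submodule act T -> N `<=` T ->
  flag m `<=` N -> ~ (T `<=` N) ->
  exists N', [/\ submodule act N', N `<=` N', N' `<=` T
    & #|leads N'| = #|leads N|.+1].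
Proof.
move=> sN sT NT FN nTN.
pose P n := `[< (n <= m)%N /\ exists v, [/\ T v, ~ N v & flag n v] >].
have exP : exists n, P n.
  have [v Tv nNv] : exists2 v, T v & ~ N v.
    by apply: contrapT => h; apply: nTN => v Tv; apply: contrapT => nNv; apply: h; exists v.
  by exists 0%N; apply/asboolP; split => //; exists v.
have ubP n : P n -> (n <= m)%N by case/asboolP.
case: (ex_maxnP exP ubP) => n /asboolP[le [v [Tv nNv Fv]]] maxn.
have lt : (n < m)%N.
  by rewrite ltn_neqAle le andbT; apply/eqP => e; apply/nNv/FN; rewrite -e.
have inN u : T u -> flag n.+1 u -> N u.
  move=> Tu Fu; apply: contrapT => nNu; suff /maxn : P n.+1 by rewrite ltnn.
  by apply/asboolP; split => //; exists u.
have nzv : chi n v != 0.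
  apply/eqP => z; apply/nNv/inN => // i; rewrite ltnS leq_eqVlt => /orP[/eqP -> //|].
  exact: Fv.
pose N' : set V := [set u | exists c w, N w /\ u = c *: v + w].
have NN' : N `<=` N' by move=> w Nw; exists 0, w; rewrite scale0r add0r.
have sN' : submodule act N'.
  have [N0 ND NA] := sN.
  split; first exact: NN'.
    move=> _ _ [c [w [Nw ->]]] [d [x [Nx ->]]]; exists (c + d), (w + x).
    by split; [exact: ND | rewrite scalerDl addrACA].
  move=> a _ [c [w [Nw ->]]]; exists (c * ep a), (c *: (act a v - ep a *: v) + act a w).
  split; last by rewrite act_lin addrA -scalerA -scalerDr [ep a *: v + _]addrC subrK.
  apply: submodule_lin => //; last exact: NA.
  apply: inN; last exact: act_ep.
  have [_ TD TA] := sT; apply: TD; first exact: TA.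
  by rewrite -scaleNr; apply: submoduleZ.
exists N'; split => //.
  by move=> _ [c [w [Nw ->]]]; apply: submodule_lin => //; apply: NT.
have nin : Ordinal lt \notin leads N.
  apply/negP => /leadsP[s [Ns Fs nzs]]; apply: nNv.
  have : N ((-(chi n v / chi n s)) *: s + v).
    apply: inN; first by apply: submodule_lin => //; apply: NT.
    move=> i; rewrite ltnS leq_eqVlt chi_lin => /orP[/eqP ->|lti].
      by rewrite mulNr divfK // addNr.
    by rewrite (Fs i) // (Fv i) // mulr0 addr0.
  move=> /(submodule_lin (chi n v / chi n s) sN Ns).
  by rewrite scaleNr addrA addrN add0r.
suff -> : leads N' = Ordinal lt |: leads N by rewrite cardsU1 nin.
apply/setP => i; rewrite in_setU1; apply/idP/idP; last first.
  case/predU1P => [->|]; last exact: (fintype.subsetP (leads_subset NN')).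
  apply/leadsP; exists v; split => //; exists 1, 0; split; first by case: sN.
  by rewrite scale1r addr0.
move=> /leadsP[s [[c [w [Nw es]]] Fs nz]].
have Ts : T s by rewrite es; apply: submodule_lin => //; apply: NT.
rewrite -val_eqE /=; case: (ltngtP i n) => //= [lti|gti].
  have ew : w = (- c) *: v + s by rewrite es scaleNr addKr.
  apply/leadsP; exists w; rewrite ew chi_lin Fv // mulr0 add0r -ew; split => // j ltj.
  by rewrite ew chi_lin Fs // Fv ?(ltn_trans ltj) // mulr0 addr0.
apply/leadsP; exists s; split => //; apply: inN => // j ltj; apply: Fs.
by apply: leq_trans ltj _.
Qed.

Lemma leads_chain N T : submodule act N -> submodule act T -> N `<=` T ->
  flag m `<=` N -> exists W : nat -> set V,
    [/\ W 0%N = N, forall i, (i <= #|leads T| - #|leads N|)%N ->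
          [/\ submodule act (W i), N `<=` W i & W i `<=` T]
      & forall i, (i < #|leads T| - #|leads N|)%N -> W i `<` W i.+1].
Proof.
move=> sN sT NT FN; move e : (#|leads T| - #|leads N|)%N => d.
elim: d N sN NT FN e => [|d IH] N sN NT FN e.
  by exists (fun=> N); split => // i _; split.
have nTN : ~ (T `<=` N).
  move=> TN; have := subset_leq_card (leads_subset TN); rewrite -subn_eq0 e.
  by [].
have [N' [sN' NN' N'T card]] := leads_step sN sT NT FN nTN.
have [||W [W0 WP WS]] := IH N' sN' N'T; first by move=> v /FN/NN'.
  by rewrite card subnS e.
exists (fun i => if i is j.+1 then W j else N); split => //.
  case=> [_|i]; first by split.
  by rewrite ltnS => /WP[? NW ?]; split => // v /NN'/NW.
case=> [_|i]; last by rewrite ltnS; apply: WS.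
rewrite W0; split => // N'N; have := subset_leq_card (leads_subset N'N).
by rewrite card ltnn.
Qed.

Lemma leads_proper N T : submodule act N -> submodule act T ->
  flag m `<=` N -> N `<` T -> (#|leads N| < #|leads T|)%N.
Proof.
move=> sN sT FN [NT nTN]; rewrite ltn_neqAle subset_leq_card ?leads_subset // andbT.
apply/eqP => e; apply: nTN; apply: leads_full => //.
have := leads_subset NT; rewrite subEproper => /orP[/eqP -> //|].
by move=> /proper_card; rewrite e ltnn.
Qed.

(** A chain gaining one jump per step realizes the length; no chain is longer, since by
    [leads_proper] each strict inclusion costs at least one jump. *)
Lemma leads_quotient_length N : submodule act N -> flag m `<=` N ->
  quotient_length act N (#|leads setT| - #|leads N|).
Proof.
move=> sN FN; have sT : submodule act setT by split.
split.
  have [W [_ WP WS]] := leads_chain sN sT (@subsetT _ N) FN.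
  by exists W; split => // i /WP[].
move=> [W [WP WS]].
have H i : (i <= (#|leads setT| - #|leads N|).+1)%N -> (#|leads N| + i <= #|leads (W i)|)%N.
  elim: i => [_|i IH lt].
    by rewrite addn0; apply/subset_leq_card/leads_subset; have [] := WP 0%N.
  rewrite addnS; apply: leq_ltn_trans (IH (ltnW lt)) _.
  have [s1 N1] := WP i (ltnW lt); have [s2 _] := WP _ lt.
  by apply: leads_proper => //; [move=> v /FN/N1 | apply: WS].
have := H _ (leqnn _); rewrite addnS subnKC; last exact/subset_leq_card/leads_subset.
by rewrite ltnNge subset_leq_card // leads_subset.
Qed.

End FilteredLength.

(** * Lexicographic counting and the residue pairing on a product of branches *)

Section ProductOfBranches.
Variables (k : fieldType) (r : nat).
Local Notation V := {ffun 'I_r -> mpseries 1 k}.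
Implicit Types (W : set V) (p q : 'I_r) (d L : nat).

Definition ksub W := submodule (fun (a : k) (v : V) => a *: v) W.

Definition deep L : set V := [set s | forall p, ord_ge L (s p)].

(** A jump of the lexicographic filtration: branch first, then order. Exact vanishing on the earlier
    branches replaces order at least [L] there; when [W] contains [deep L] the two agree
    ([leads_lexE]), and the condition no longer mentions [L]. *)
Definition lead_at W p d : bool := `[< exists s, [/\ W s,
  forall q, (q < p)%N -> s q = 0, ord_ge d (s p) & tcoef (s p) d != 0] >].

Definition lead_count L W : nat := \sum_(p < r) \sum_(d < L) lead_at W p d.

Lemma lead_atP W p d : reflect (exists s, [/\ W s,
  forall q, (q < p)%N -> s q = 0, ord_ge d (s p) & tcoef (s p) d != 0])
  (lead_at W p d).
Proof. exact: asboolP. Qed.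

Definition single p (f : mpseries 1 k) : V := [ffun q => if q == p then f else 0].

Lemma single_deep L p f : ord_ge L f -> deep L (single p f).
Proof. by move=> hf q; rewrite ffunE; case: eqP. Qed.

Lemma ksub_lin W a u v : ksub W -> W u -> W v -> W (a *: u + v).
Proof. by move=> [_ WD WZ] Wu Wv; apply: WD => //; apply: WZ. Qed.

Lemma ksubB W u v : ksub W -> W u -> W v -> W (u - v).
Proof. by move=> sW Wu Wv; rewrite addrC -scaleN1r; apply: ksub_lin. Qed.

Lemma ksub_sum W (I : Type) (s : seq I) (P : pred I) (F : I -> V) :
  ksub W -> (forall i, P i -> W (F i)) -> W (\sum_(i <- s | P i) F i).
Proof. by move=> [W0 WD _] h; apply: big_ind. Qed.

Lemma lead_at_deep L W p d : deep L `<=` W -> (L <= d)%N -> lead_at W p d.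
Proof.
move=> LW le; apply/lead_atP; exists (single p (tvar k ^+ d)); split.
- by apply/LW/single_deep; apply: ord_geW le _; apply: ord_ge_tX.
- by move=> q lt; rewrite ffunE -val_eqE /= ltn_eqF.
- by rewrite ffunE eqxx; apply: ord_ge_tX.
by rewrite ffunE eqxx tcoef_tX eqxx oner_eq0.
Qed.

Definition lexcoef L n (s : V) : k :=
  if insub (n %/ L)%N is Some p then tcoef (s p) (n %% L) else 0.

Lemma lexcoef_lin L i a u v :
  lexcoef L i (a *: u + v) = a * lexcoef L i u + lexcoef L i v.
Proof.
by rewrite /lexcoef; case: insub => [p|]; rewrite ?mulr0 ?addr0 // !ffunE.
Qed.

Lemma lexcoefE L p d (s : V) : (d < L)%N ->
  lexcoef L (p * L + d) s = tcoef (s p) d.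
Proof.
move=> lt; have L0 : (0 < L)%N by apply: leq_ltn_trans lt.
rewrite /lexcoef divnMDl // divn_small // addn0 valK modnMDl modn_small //.
Qed.

Lemma flag_lexP L p d (s : V) : (d < L)%N ->
  flag (lexcoef L) (p * L + d) s <->
  (forall q, (q < p)%N -> ord_ge L (s q)) /\ ord_ge d (s p).
Proof.
move=> lt; split=> [F | [Fq Fp] i lti].
  split=> [q ltq|]; apply/ord_ge_tcoef => i lti.
    rewrite -(lexcoefE _ _ lti); apply: F; apply: leq_trans (leq_addr _ _).
    by apply: leq_trans (leq_mul ltq (leqnn L)); rewrite mulSn addnC ltn_add2r.
  by rewrite -(@lexcoefE L) ?(ltn_trans lti) //; apply: F; rewrite ltn_add2l.
have L0 : (0 < L)%N by apply: leq_ltn_trans lt.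
rewrite /lexcoef; case: insubP => // q _ eq.
have [ltq|lepq] := ltnP q p; first by move/ord_ge_tcoef: (Fq _ ltq); apply; rewrite ltn_mod.
have eqp : q = p.
  apply/val_inj/eqP; rewrite eqn_leq lepq andbT /= eq -ltnS ltn_divLR //.
  by apply: leq_trans lti _; rewrite mulSn addnC leq_add2r ltnW.
rewrite eqp; move/ord_ge_tcoef: Fp; apply.
by rewrite -(ltn_add2l (p * L)) -{1}eqp eq -divn_eq.
Qed.

Lemma flag_lex_full L (s : V) : (0 < L)%N -> flag (lexcoef L) (r * L) s -> deep L s.
Proof.
move=> L0 F p; apply/ord_ge_tcoef => i lt; rewrite -(lexcoefE _ _ lt); apply: F.
apply: (@leq_trans (p.+1 * L)); last by rewrite leq_mul2r ltn_ord orbT.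
by rewrite mulSn addnC ltn_add2r.
Qed.

Lemma leads_lexE L W p d (lt : (p * L + d < r * L)%N) :
  ksub W -> deep L `<=` W -> (d < L)%N ->
  (Ordinal lt \in leads (r * L) (lexcoef L) W) = lead_at W p d.
Proof.
move=> sW LW ltd; apply/idP/lead_atP => [/leadsP/= | ] [s [Ws]].
  move=> /(flag_lexP _ _ ltd)[Fq Fp]; rewrite lexcoefE // => nz.
  pose u : V := [ffun q : 'I_r => if (q < p)%N then s q else 0].
  have Wu : W u by apply: LW => q; rewrite ffunE; case: ifP => // /Fq.
  exists (s - u); split; first exact: ksubB.
  - by move=> q ltq; rewrite !ffunE ltq subrr.
  - by rewrite !ffunE ltnn subr0.
  - by rewrite !ffunE ltnn subr0.
move=> Fq Fp nz; apply/leadsP; exists s; split => //; last by rewrite lexcoefE.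
by apply/flag_lexP => //; split => // q /Fq ->.
Qed.

Lemma card_leads L W : ksub W -> deep L `<=` W ->
  #|leads (r * L) (lexcoef L) W| = lead_count L W.
Proof.
move=> sW LW.
pose A i := if insub i is Some j then (j : 'I_(r * L)) \in leads (r * L) (lexcoef L) W else false.
rewrite -sum1_card big_mkcond /=.
transitivity (\sum_(i < r * L) A i)%N.
  by apply: eq_bigr => i _; rewrite /A valK; case: ifP.
rewrite -(big_mkord xpredT (fun i => nat_of_bool (A i))) big_nat_mul big_mkord.
apply: eq_bigr => p _; rewrite -{1}[(p * L)%N]add0n mulSn big_addn addnK big_mkord.
apply: eq_bigr => d _; congr nat_of_bool; rewrite addnC /A.
have lt : (p * L + d < r * L)%N.
  apply: (@leq_trans (p.+1 * L)); last by rewrite leq_mul2r ltn_ord orbT.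
  by rewrite mulSn addnC ltn_add2r.
by rewrite insubT leads_lexE.
Qed.

Lemma lead_count_full L : lead_count L setT = (r * L)%N.
Proof.
rewrite /lead_count; under eq_bigr => p _.
  under eq_bigr => d _ do rewrite (@lead_at_deep 0 setT) //.
  rewrite sum_nat_const card_ord muln1; over.
by rewrite sum_nat_const card_ord.
Qed.

Lemma lead_count_deep L : lead_count L (deep L) = 0%N.
Proof.
rewrite /lead_count big1 // => p _; rewrite big1 // => d _.
case: lead_atP => // -[s [Ls _ _ /eqP []]].
by move/ord_ge_tcoef: (Ls p); apply.
Qed.

Lemma ksub_deep L : ksub (deep L).
Proof.
split=> [p|u v hu hv p|a u hu p]; rewrite !ffunE //; first exact: ord_geD.
exact: ord_geZ.
Qed.

(** The sum of the residues of b a dt / t^(L+1). Modulo [deep L.+1] it is a perfect pairing, whence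
    the shift of index in the lemmas below. *)
Definition pairing L (b a : V) : k := \sum_p tcoef (b p * a p) L.

Lemma pairing_linr L b c u v :
  pairing L b (c *: u + v) = c * pairing L b u + pairing L b v.
Proof.
rewrite /pairing mulr_sumr -big_split; apply: eq_bigr => p _ /=.
by rewrite !ffunE mulrDr -scalerAr tcoefD tcoefZ.
Qed.

Lemma pairingC L b a : pairing L b a = pairing L a b.
Proof. by apply: eq_bigr => p _; rewrite mulrC. Qed.

Lemma pairing_linl L b c u v :
  pairing L (c *: u + v) b = c * pairing L u b + pairing L v b.
Proof. by rewrite !(pairingC _ _ b) pairing_linr. Qed.

Lemma pairing_deep L b a : deep L.+1 b -> pairing L b a = 0.
Proof.
move=> hb; rewrite /pairing big1 // => p _.
have /ord_ge_tcoef : ord_ge L.+1 (b p * a p) by rewrite mulrC; apply: ord_geMr.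
by apply.
Qed.

Definition perp L W : set V := [set b | forall a, W a -> pairing L b a = 0].

Lemma ksub_perp L W : ksub (perp L W).
Proof.
split=> [a _|u v hu hv a Wa|c u hu a Wa].
- by apply: pairing_deep => p; rewrite ffunE.
- by rewrite -[u]scale1r pairing_linl hu // hv // mulr0 addr0.
- by rewrite -[c *: u]addr0 pairing_linl hu // mulr0 add0r pairing_deep // => p; rewrite ffunE.
Qed.

Lemma perp_deep L W : deep L.+1 `<=` perp L W.
Proof. by move=> b hb a _; apply: pairing_deep. Qed.

(* The functionals [pairing L b] separate the points of [V / deep L.+1]. *)
Lemma perp_separates L W v : ksub W -> deep L.+1 `<=` W -> ~ W v ->
  exists2 b, perp L W b & pairing L b v = 1.
Proof.
move=> sW LW nWv.
pose co (s : V) : 'rV[k]_(r * L.+1) :=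
  mxvec (\matrix_(p < r, x < L.+1) tcoef (s p) x).
have coE s p x : co s 0 (mxvec_index p x) = tcoef (s p) x by rewrite mxvecE mxE.
have co_lin a u w : co (a *: u + w) = a *: co u + co w.
  apply/rowP => j; case/mxvec_indexP: j => p x.
  by rewrite mxE coE mxE !coE !ffunE.
(* A matrix of maximal rank whose rows come from [W] has the coordinates of [W] as its row space;
   the kernel column [cokermx G] then supplies the separating functional. *)
pose good n (G : 'M[k]_(n, r * L.+1)) :=
  (forall i, exists2 a, W a & row i G = co a) /\ \rank G = n.
pose P n := `[< exists G, @good n G >].
have P0 : exists n, P n.
  exists 0%N; apply/asboolP; exists 0; split; first by case.
  by rewrite mxrank0.
have ubP n : P n -> (n <= r * L.+1)%N.
  by case/asboolP => G [_ <-]; apply: rank_leq_col.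
case: (ex_maxnP P0 ubP) => n /asboolP[G [rG rkG]] maxn.
have WG s : W s -> (co s <= G)%MS.
  move=> Ws; apply: contraT => nle; suff /maxn : P (1 + n)%N by rewrite ltnn.
  apply/asboolP; exists (col_mx (co s) G); split.
    move=> i; case: (splitP i) => [j e|j e].
      exists s => //; rewrite (_ : i = lshift n j); last exact: val_inj.
      by rewrite rowKu (ord1 j); apply/rowP => l; rewrite mxE.
    have [a Wa ea] := rG j; exists a => //; rewrite -ea.
    by rewrite (_ : i = rshift 1 j) ?rowKd //; apply: val_inj.
  have ltG : (G < col_mx (co s) G)%MS.
    rewrite ltmxE -addsmxE addsmxSr; apply: contra nle => h.
    by apply: submx_trans h; rewrite -addsmxE; apply: addsmxSl.
  apply/eqP; rewrite eqn_leq rank_leq_row /=.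
  by move: ltG; rewrite ltmxErank rkG => /andP[].
have GW s : (co s <= G)%MS -> W s.
  case/submxP => u eu.
  have /choice[a ha] : forall i, exists a, W a /\ row i G = co a.
    by move=> i; have [a] := rG i; exists a.
  pose w : V := \sum_i u 0 i *: a i.
  have Ww : W w.
    apply: ksub_sum => // i _; have [_ _ WZ] := sW; apply: WZ; by have [] := ha i.
  have ew : co s = co w.
    rewrite eu mulmx_sum_row /w.
    have co0 : co 0 = 0.
      by apply/rowP => j; case/mxvec_indexP: j => p x; rewrite coE mxE ffunE.
    elim/big_rec2: _ => // i x y _ ->; by have [_ ->] := ha i; rewrite co_lin.
  rewrite -(subrK w s) -[s - w]scale1r; apply: ksub_lin => //.
  apply: LW => p; apply/ord_ge_tcoef => i lt; rewrite !ffunE tcoefB.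
  have := congr1 (fun u : 'rV_ _ => u 0 (mxvec_index p (Ordinal lt))) ew.
  by rewrite !coE /= => ->; rewrite subrr.
have : ~~ (co v <= G)%MS by apply/negP => /GW.
rewrite submxE => nz.
have /existsP[j nzj] : [exists j, (co v *m cokermx G) 0 j != 0].
  apply: contraNT nz; rewrite negb_exists => /forallP h.
  by apply/eqP/rowP => j; have := h j; rewrite negbK mxE => /eqP ->; rewrite mxE.
pose y p x := cokermx G (mxvec_index p x) j.
(* The exponent is reversed because t^(L-x) is the element whose pairing reads off the coefficient
   of t^x. *)
pose b0 : V := [ffun p => \sum_(x < L.+1) y p x *: tvar k ^+ (L - x)].
have pE s : pairing L b0 s = (co s *m cokermx G) 0 j.
  rewrite mxE (reindex (uncurry (@mxvec_index r L.+1))) /=; last exact: curry_mxvec_bij.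
  transitivity (\sum_p \sum_x co s 0 (mxvec_index p x) * y p x); last first.
    by rewrite pair_bigA; apply: eq_bigr => -[p x] _.
  apply: eq_bigr => p _; rewrite ffunE mulr_suml tcoef_sum; apply: eq_bigr => x _.
  rewrite -scalerAl tcoefZ tcoef_tXM leq_subr subKn; last by rewrite -ltnS.
  by rewrite coE mulrC.
exists ((pairing L b0 v)^-1 *: b0 + 0).
  move=> a /WG; rewrite submxE => /eqP e.
  rewrite pairing_linl (pE a) e mxE mulr0 add0r; apply: pairing_deep => p; by rewrite ffunE.
rewrite pairing_linl [X in _ + X]pairing_deep ?addr0; last by move=> p; rewrite ffunE.
by rewrite mulVf // pE.
Qed.

Lemma perpK L W v : ksub W -> deep L.+1 `<=` W -> perp L (perp L W) v -> W v.
Proof.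
move=> sW LW h; apply: contrapT => nWv.
have [b hb /eqP] := perp_separates sW LW nWv.
by rewrite pairingC h // eq_sym oner_eq0.
Qed.

(** When a subspace grows by one jump its orthogonal shrinks strictly, by [perp_separates], so the
    sum of the two counts does not increase along an inclusion. Comparing [W] with [deep L.+1] and
    with the whole space squeezes the sum to r (L+1). *)
Lemma lead_count_perp L W : ksub W -> deep L.+1 `<=` W ->
  (lead_count L.+1 W + lead_count L.+1 (perp L W) = r * L.+1)%N.
Proof.
move=> sW LW.
pose ld W := #|leads (r * L.+1) (lexcoef L.+1) W|.
have chi_lin := @lexcoef_lin L.+1.
have act_lin (a c : k) (u v : V) : a *: (c *: u + v) = c *: (a *: u) + a *: v.
  by rewrite scalerDr !scalerA mulrC.
have act_ep n (a : k) (v : V) : (n < r * L.+1)%N -> flag (lexcoef L.+1) n v ->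
    flag (lexcoef L.+1) n.+1 (a *: v - a *: v).
  move=> _ _ i _; rewrite subrr; apply: (chi0 chi_lin).
have FW W' : deep L.+1 `<=` W' -> flag (lexcoef L.+1) (r * L.+1) `<=` W'.
  by move=> h v /(flag_lex_full (ltn0Sn L))/h.
have mono T T' : ksub T -> ksub T' -> deep L.+1 `<=` T -> T `<=` T' ->
    (ld T' + ld (perp L T') <= ld T + ld (perp L T))%N.
  move=> sT sT' LT TT'.
  have [U [U0 UP US]] := leads_chain chi_lin (fun _ _ => erefl) act_lin act_ep sT sT' TT' (FW _ LT).
  have sub : (ld T <= ld T')%N by apply/subset_leq_card/leads_subset.
  have H i : (i <= ld T' - ld T)%N -> (ld (perp L (U i)) + i <= ld (perp L T))%N.
    elim: i => [_|i IH lt]; first by rewrite U0 addn0.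
    rewrite addnS; apply: leq_trans (IH (ltnW lt)); rewrite -addSn leq_add2r.
    have [s1 T1 _] := UP i (ltnW lt); have [s2 T2 _] := UP _ lt.
    have [U12 nU21] := US i lt.
    apply: (leads_proper chi_lin (fun _ _ => erefl)) => //; try exact: ksub_perp.
      by apply: FW; apply: perp_deep.
    split; first by move=> b hb a /U12; apply: hb.
    move=> h; apply: nU21 => v U2v; apply: contrapT => nU1v.
    have [b hb /eqP] : exists2 b, perp L (U i) b & pairing L b v = 1.
      by apply: perp_separates => // u /LT/T1.
    by rewrite h // eq_sym oner_eq0.
  have := H _ (leqnn _).
  have [_ _ UT'] := UP _ (leqnn _).
  move=> h; rewrite -(subnKC sub) -addnA leq_add2l addnC; apply: leq_trans h.
  rewrite leq_add2r; apply/subset_leq_card/leads_subset => b hb a /UT'; exact: hb.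
have sD := ksub_deep L.+1; have sP := ksub_perp L.
have h1 := mono _ _ sD sW (fun _ h => h) LW.
have sT : ksub setT by split.
have h2 := mono _ _ sW sT LW (@subsetT _ W).
rewrite /ld !card_leads // in h1 h2; try exact: perp_deep; try exact: ksub_perp.
rewrite lead_count_deep lead_count_full in h1 h2.
apply/eqP; rewrite eqn_leq; apply/andP; split; last first.
  by apply: leq_trans h2; apply: leq_addr.
apply: (leq_trans h1); rewrite add0n -(lead_count_full L.+1).
rewrite -!card_leads //; try exact: perp_deep.
by apply/subset_leq_card/leads_subset/subsetT.
Qed.

Definition scale_set (c : 'I_r -> mpseries 1 k) W : set V :=
  [set s | exists2 w, W w & forall p, s p = c p * w p].

Lemma ksub_scale_set c W : ksub W -> ksub (scale_set c W).
Proof.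
move=> [W0 WD WZ]; split.
- by exists 0; [exact: W0 | move=> p; rewrite !ffunE mulr0].
- move=> s t [u Wu eu] [v Wv ev]; exists (u + v); first exact: WD.
  by move=> p; rewrite !ffunE eu ev mulrDr.
- move=> a s [u Wu eu]; exists (a *: u); first exact: WZ.
  by move=> p; rewrite !ffunE eu scalerAr.
Qed.

Lemma tcoef_lead_mul (f g : mpseries 1 k) a b : ord_ge a f -> ord_ge b g ->
  tcoef (f * g) (a + b) = tcoef f a * tcoef g b.
Proof.
move=> /ord_ge_tdvd[f' ->] /ord_ge_tdvd[g' ->].
rewrite mulrACA -exprD !tcoef_tXM !leqnn !subnn tcoef0M //.
Qed.

Lemma tord_exists (f : mpseries 1 k) : f != 0 ->
  exists d, ord_ge d f /\ tcoef f d != 0.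
Proof.
move=> nz; have ex : exists d, tcoef f d != 0.
  apply: contrapT => h; move/eqP: nz; apply; apply: tcoef_inj => d.
  by apply: contrapT => /eqP nd; apply: h; exists d.
exists (ex_minn ex); case: ex_minnP => d nd mind; split => //.
apply/ord_ge_tcoef => i lt; apply: contraTeq lt; rewrite -leqNgt; exact: mind.
Qed.

(** Multiplication by [c] moves a jump at order d of branch p to order e(p) + d. Orders below e(p)
    are then empty, and the last e(p) orders of [W] below [L] are all jumps because [deep L] lies in
    the image. *)
Lemma lead_count_scale_set L c (e : 'I_r -> nat) W :
  (forall p, ord_ge (e p) (c p) /\ tcoef (c p) (e p) != 0) ->
  deep L `<=` scale_set c W ->
  (lead_count L (scale_set c W) + \sum_p e p = lead_count L W)%N.
Proof.
move=> he Lc; rewrite /lead_count -big_split; apply: eq_bigr => p _ /=.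
have nzc q : c q != 0.
  by have [_] := he q; apply: contraNneq => ->.
have leadE d : lead_at (scale_set c W) p (e p + d) = lead_at W p d.
  apply/lead_atP/lead_atP => -[s].
    move=> [[w Ww ew] h0 h1 h2]; exists w; split => //.
    - by move=> q /h0 /eqP; rewrite ew mulf_eq0 (negPf (nzc q)) => /eqP.
    - have [w0|/tord_exists[d' [o1 o2]]] := eqVneq (w p) 0; first by rewrite w0.
      apply: (ord_geW _ o1); rewrite leqNgt; apply/negP => lt.
      have [c1 c2] := he p; have := tcoef_lead_mul c1 o1.
      move/ord_ge_tcoef: h1 => /(_ (e p + d')%N); rewrite ew ltn_add2l => /(_ lt) ->.
      by move/esym/eqP; rewrite mulf_eq0 (negPf c2) (negPf o2).
    - move: h2; rewrite ew; have [w0|/tord_exists[d' [o1 o2]]] := eqVneq (w p) 0.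
        by rewrite w0 mulr0.
      have [c1 c2] := he p.
      have [ltd|gtd|ed] := ltngtP d d'; last by rewrite ed.
        have /ord_ge_tcoef := ord_geM c1 o1; move/(_ (e p + d)%N) => ->; rewrite ?eqxx //.
        by rewrite ltn_add2l.
      move/ord_ge_tcoef: h1 => /(_ (e p + d')%N); rewrite ew ltn_add2l gtd => /(_ isT) /eqP.
      by rewrite tcoef_lead_mul // mulf_eq0 (negPf c2) (negPf o2).
  move=> [Ww h0 h1 h2]; have [c1 c2] := he p.
  exists [ffun q => c q * s q]; split.
  - by exists s; [exact: Ww | move=> q; rewrite ffunE].
  - by move=> q /h0 e0; rewrite ffunE e0 mulr0.
  - by rewrite ffunE; apply: ord_geM.
  - by rewrite ffunE tcoef_lead_mul // mulf_neq0.
have lead0 d : (d < e p)%N -> lead_at (scale_set c W) p d = false.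
  move=> lt; apply/lead_atP => -[s [[w Ww ew] _ _]]; rewrite ew => /eqP; apply.
  have [c1 _] := he p; have /ord_ge_tcoef : ord_ge (e p) (c p * w p).
    by rewrite mulrC; apply: ord_geMr.
  by apply.
have le : (e p <= L)%N.
  rewrite leqNgt; apply/negP => /lead0.
  by rewrite (lead_at_deep _ Lc).
rewrite -(subnKC le) big_split_ord /= big1 => [|i _]; last by rewrite lead0.
rewrite [in RHS](subnKC le) -[in RHS](subnK le) big_split_ord /= add0n; congr (_ + _)%N.
  by apply: eq_bigr => i _; rewrite leadE.
rewrite -[LHS]muln1 -[in LHS](card_ord (e p)) -sum_nat_const; apply: eq_bigr => i _.
rewrite -leadE (lead_at_deep _ Lc) // addnA subnKC // leq_addr //.
Qed.

End ProductOfBranches.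

(** * Orthogonality and the conductor *)

Section Doubling.
Variables (k : fieldType) (n : nat).
Local Notation S := (mpseries n k).
Local Notation S2 := (mpseries (n + n) k).

Definition Yvar (l : 'I_n) : S2 := svar k (lshift n l).
Definition Zvar (l : 'I_n) : S2 := svar k (rshift n l).

(* Series in two copies of the variables, in the coordinates [Y] and
   [Z = X - Y]. *)
Lemma inX_exists : exists h : {lrmorphism S -> S2}, forall l, h (svar k l) = Yvar l + Zvar l.
Proof. by apply: subst_exists => l; apply: ord_geD; apply: ord_ge_svar. Qed.
Definition inX := projT1 (cid inX_exists).
Lemma inX_svar l : inX (svar k l) = Yvar l + Zvar l.
Proof. exact: (projT2 (cid inX_exists)). Qed.

Lemma inY_exists : exists h : {lrmorphism S -> S2}, forall l, h (svar k l) = Yvar l.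
Proof. by apply: subst_exists => l; apply: ord_ge_svar. Qed.
Definition inY := projT1 (cid inY_exists).
Lemma inY_svar l : inY (svar k l) = Yvar l.
Proof. exact: (projT2 (cid inY_exists)). Qed.

Lemma sub_exists m (y z : 'I_n -> mpseries m k) :
  (forall l, ord_ge 1 (y l)) -> (forall l, ord_ge 1 (z l)) ->
  exists h : {lrmorphism S2 -> mpseries m k},
    (forall l, h (Yvar l) = y l) /\ (forall l, h (Zvar l) = z l).
Proof.
move=> hy hz.
have [|h eh] := @subst_exists k (n + n) m
    (fun i => match fintype.split i with inl l => y l | inr l => z l end).
  by move=> i; case: fintype.split.
by exists h; split => l; rewrite eh ?(unsplitK (inl _ l)) ?(unsplitK (inr _ l)).
Qed.

(** The ideal of the Z_l is closed: being generated by variables, it is cut out by the vanishing of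
    the coefficients of monomials free of Z, and each such condition is seen at finite order. *)
Lemma Z_ideal (G : S2) :
  (forall d, exists b, ord_ge d (G - \sum_l Zvar l * b l)) ->
  exists b, G = \sum_l Zvar l * b l.
Proof.
move=> hG.
have [|b [eb _]] := @svar_division _ _ (fun i : 'I_(n + n) => (n <= i)%N) G.
  move=> m hm; have [b /(_ m (ltnSn _))] := hG (mdeg m).+1.
  rewrite scoefB scoef_sum big1 ?subr0 // => l _.
  rewrite /Zvar svar_smon scoef_smonM lep1mP hm //= leq_addr //.
exists (fun l => b (rshift n l)); rewrite eb big_split_ord /= big_pred0 ?add0r.
  by apply: eq_bigl => l; rewrite leq_addr.
by move=> l; rewrite leqNgt ltn_ord.
Qed.

Lemma difference_quotients (g : S) :
  exists b, inX g - inY g = \sum_l Zvar l * b l.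
Proof.
apply: Z_ideal => d; elim: d g => [g|d IH g]; first by exists (fun=> 0).
have [h eh] := series_decomp g.
have /choice[b hb] := fun l => IH (h l).
exists (fun j => inY (h j) + \sum_l inX (svar k l) * b l j).
have -> : inX g - inY g = \sum_l (inX (svar k l) * (inX (h l) - inY (h l)) + Zvar l * inY (h l)).
  rewrite eh !rmorphD /= !lrmorph_alg opprD addrACA subrr add0r !rmorph_sum -sumrB.
  apply: eq_bigr => l _; rewrite !rmorphM /= inX_svar inY_svar mulrBr -addrA; congr (_ + _).
  by rewrite mulrDl opprD subrK.
have -> : \sum_j Zvar j * (inY (h j) + \sum_l inX (svar k l) * b l j) =
    \sum_l (inX (svar k l) * (\sum_j Zvar j * b l j) + Zvar l * inY (h l)).
  under eq_bigr => j _ do rewrite mulrDr mulr_sumr.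
  rewrite big_split exchange_big /= addrC -big_split; apply: eq_bigr => l _ /=.
  by congr (_ + _); rewrite mulr_sumr; apply: eq_bigr => j _; rewrite mulrCA.
rewrite -sumrB; apply: ord_ge_sum => l _.
rewrite opprD addrACA subrr addr0 -mulrBr -[d.+1]add1n.
by apply: ord_geM (hb l); apply: lrmorph_svar.
Qed.

(** Finite sums only. They form a dense subset ([tensors_approx]), which suffices for functionals
    that see finitely many coefficients. *)
Definition tensors (F : S2) := exists s : seq (S * S), F = \sum_(c <- s) inX c.1 * inY c.2.

Lemma tensorsD F G : tensors F -> tensors G -> tensors (F + G).
Proof. by move=> [s ->] [t ->]; exists (s ++ t); rewrite big_cat. Qed.

Lemma tensorsM a b F : tensors F -> tensors (inX a * inY b * F).
Proof.
move=> [s ->]; exists [seq (a * c.1, b * c.2) | c <- s].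
rewrite big_map mulr_sumr; apply: eq_bigr => c _ /=.
by rewrite !rmorphM mulrACA.
Qed.

Lemma tensors0 : tensors 0.
Proof. by exists [::]; rewrite big_nil. Qed.

Lemma tensors_approx d F : exists2 G, tensors G & ord_ge d (F - G).
Proof.
elim: d F => [F|d IH F]; first by exists 0; [exact: tensors0 | ].
have [h eh] := series_decomp F.
have /choice[t ht] : forall i, exists G, tensors G /\ ord_ge d (h i - G).
  by move=> i; have [G] := IH (h i); exists G.
have mulT i G : tensors G -> tensors (svar k i * G).
  move=> tG; case: (splitP i) => [l e|l e].
    have -> : svar k i = inX 1 * inY (svar k l).
      by rewrite rmorph1 mul1r inY_svar; congr svar; apply: val_inj.
    exact: tensorsM.
  have -> : svar k i = inX (svar k l) * inY 1 + inX (- 1) * inY (svar k l).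
    rewrite rmorphN !rmorph1 mulr1 mulN1r inX_svar inY_svar addrC addKr.
    by congr svar; apply: val_inj.
  by rewrite mulrDl; apply: tensorsD; apply: tensorsM.
exists ((scoef F 0)%:A + \sum_i svar k i * t i).
  apply: tensorsD.
    by exists [:: ((scoef F 0)%:A, 1)]; rewrite big_seq1 rmorph1 mulr1 lrmorph_alg.
  apply: big_ind => [||i _]; [exact: tensors0 | exact: tensorsD | ].
  by apply: mulT; have [] := ht i.
rewrite {1}eh opprD addrACA subrr add0r -sumrB; apply: ord_ge_sum => i _.
rewrite -mulrBr -[d.+1]add1n; apply: ord_geM; first exact: ord_ge_svar.
by have [] := ht i.
Qed.

Lemma fold_exists : exists h : {lrmorphism S2 -> S},
  (forall l, h (Yvar l) = svar k l) /\ (forall l, h (Zvar l) = 0).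
Proof. by apply: sub_exists => l //; apply: ord_ge_svar. Qed.
Definition fold := projT1 (cid fold_exists).
Lemma fold_Y l : fold (Yvar l) = svar k l.
Proof. exact: (projT2 (cid fold_exists)).1. Qed.
Lemma fold_Z l : fold (Zvar l) = 0.
Proof. exact: (projT2 (cid fold_exists)).2. Qed.

Lemma fold_inX g : fold (inX g) = g.
Proof.
pose h : {lrmorphism S -> S} := fold \o inX.
apply: (@lrmorph_ext _ _ _ h (idfun : {lrmorphism S -> S})) => l /=.
by rewrite inX_svar rmorphD /= fold_Y fold_Z addr0.
Qed.

(** Differentiation in the direction Z_l followed by Z = 0 isolates [b l] on the right and gives the
    partial derivative on the left. *)
Lemma fold_difference_quotient g b : inX g - inY g = \sum_l Zvar l * b l ->
  forall l, fold (b l) = sderiv l g.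
Proof.
move=> e l; have := congr1 (fun F => fold (sderiv (rshift n l) F)) e.
rewrite /= sderivB rmorphB sderiv_sum !rmorph_sum /=.
rewrite (bigD1 l) //= sderiv_svarM eqxx mul1r rmorphD rmorphM /= fold_Z mul0r addr0.
rewrite big1 ?addr0 => [<-|j nj]; last first.
  rewrite sderiv_svarM (inj_eq (@rshift_inj _ _)) eq_sym (negPf nj) mul0r add0r.
  by rewrite rmorphM /= fold_Z mul0r.
rewrite !lrmorph_deriv !rmorph_sum /= [X in _ - X]big1 ?subr0 => [|j _]; last first.
  rewrite inY_svar sderiv_svar (_ : (_ == _) = false) ?mulr0 ?rmorph0 //.
  by rewrite -val_eqE /= gtn_eqF // ltn_addr.
rewrite (bigD1 l) //= big1 ?addr0 => [|j nj].
  rewrite inX_svar sderivD !sderiv_svar eqxx (_ : (_ == _) = false) ?add0r ?mulr1 ?fold_inX //.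
  by rewrite -val_eqE /= gtn_eqF // ltn_addr.
rewrite inX_svar sderivD !sderiv_svar (inj_eq (@rshift_inj _ _)) [l == j]eq_sym (negPf nj) addr0.
by rewrite (_ : (_ == _) = false) ?mulr0 ?rmorph0 // -val_eqE /= gtn_eqF // ltn_addr.
Qed.

(** In the coordinates Y and Z = X - Y this is the substitution F(X, 0), with X renamed to the
    original variables. *)
Lemma origin_exists : exists h : {lrmorphism S2 -> S},
  (forall l, h (Yvar l) = 0) /\ (forall l, h (Zvar l) = svar k l).
Proof. by apply: sub_exists => l //; apply: ord_ge_svar. Qed.
Definition origin := projT1 (cid origin_exists).
Lemma origin_Y l : origin (Yvar l) = 0.
Proof. exact: (projT2 (cid origin_exists)).1. Qed.
Lemma origin_Z l : origin (Zvar l) = svar k l.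
Proof. exact: (projT2 (cid origin_exists)).2. Qed.

Lemma origin_inX g : origin (inX g) = g.
Proof.
pose h : {lrmorphism S -> S} := origin \o inX.
apply: (@lrmorph_ext _ _ _ h (idfun : {lrmorphism S -> S})) => l /=.
by rewrite inX_svar rmorphD /= origin_Y origin_Z add0r.
Qed.

Lemma origin_inY g : origin (inY g) = (scoef g 0)%:A.
Proof.
have [h eh] := series_decomp g; rewrite {1}eh !rmorphD /= !lrmorph_alg !rmorph_sum.
rewrite big1 ?addr0 // => l _.
by rewrite !rmorphM /= inY_svar origin_Y mul0r.
Qed.

Section Evaluation.
Variables phi psi : {lrmorphism S -> mpseries 1 k}.

Lemma eval_exists : exists h : {lrmorphism S2 -> mpseries 2 k},
  (forall l, h (Yvar l) = iota2 k (psi (svar k l))) /\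
  (forall l, h (Zvar l) = iota1 k (phi (svar k l)) - iota2 k (psi (svar k l))).
Proof.
by apply: sub_exists => l; try apply: ord_geB; do 2 apply: lrmorph_local; apply: ord_ge_svar.
Qed.
Definition eval := projT1 (cid eval_exists).
Lemma eval_Y l : eval (Yvar l) = iota2 k (psi (svar k l)).
Proof. exact: (projT2 (cid eval_exists)).1. Qed.
Lemma eval_Z l : eval (Zvar l) = iota1 k (phi (svar k l)) - iota2 k (psi (svar k l)).
Proof. exact: (projT2 (cid eval_exists)).2. Qed.

Lemma eval_inX g : eval (inX g) = iota1 k (phi g).
Proof.
pose h : {lrmorphism S -> mpseries 2 k} := eval \o inX.
pose h' : {lrmorphism S -> mpseries 2 k} := iota1 k \o phi.
apply: (@lrmorph_ext _ _ _ h h') => l /=.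
by rewrite inX_svar rmorphD /= eval_Y eval_Z addrC subrK.
Qed.

Lemma eval_inY g : eval (inY g) = iota2 k (psi g).
Proof.
pose h : {lrmorphism S -> mpseries 2 k} := eval \o inY.
pose h' : {lrmorphism S -> mpseries 2 k} := iota2 k \o psi.
apply: (@lrmorph_ext _ _ _ h h') => l /=.
by rewrite inY_svar eval_Y.
Qed.

End Evaluation.

Lemma diag_eval (psi : {lrmorphism S -> mpseries 1 k}) F :
  diag k (eval psi psi F) = psi (fold F).
Proof.
pose h : {lrmorphism S2 -> mpseries 1 k} := diag k \o eval psi psi.
pose h' : {lrmorphism S2 -> mpseries 1 k} := psi \o fold.
apply: (@lrmorph_ext _ _ _ h h') => i /=; case: (splitP i) => l e.
  rewrite (_ : svar k i = Yvar l); last by congr svar; apply: val_inj.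
  by rewrite eval_Y diag_iota2 fold_Y.
rewrite (_ : svar k i = Zvar l); last by congr svar; apply: val_inj.
by rewrite eval_Z rmorphB /= diag_iota1 diag_iota2 fold_Z rmorph0 subrr.
Qed.

End Doubling.

Lemma lrmorph_scoef0 (k : fieldType) n m
  (psi : {lrmorphism mpseries n k -> mpseries m k}) g : scoef (psi g) 0 = scoef g 0.
Proof.
rewrite -[in LHS](subrK (scoef g 0)%:A g) rmorphD /= lrmorph_alg scoefD scoefA eqxx mulr1.
have /ord_ge1P -> : ord_ge 1 (psi (g - (scoef g 0)%:A)); last by rewrite add0r.
by apply/lrmorph_local/ord_ge1P; rewrite scoefB scoefA eqxx mulr1 subrr.
Qed.

Definition image_set (k : fieldType) n r
    (psi : 'I_r -> {lrmorphism mpseries n k -> mpseries 1 k}) :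
    set {ffun 'I_r -> mpseries 1 k} :=
  [set s | exists g, forall p, s p = psi p g].

(** * The determinant of difference quotients and its residues *)

Section CompleteIntersection.
Variables (k : fieldType) (m r : nat).
Local Notation n := m.+1.
Local Notation S := (mpseries n k).
Local Notation V := {ffun 'I_r -> mpseries 1 k}.
Variable psi : 'I_r -> {lrmorphism S -> mpseries 1 k}.
Variable f : 'I_m -> S.
Variable N' : nat.
Local Notation N := N'.+1.
Local Notation t := (tvar k).
Local Notation T := (Tvar k).
Local Notation Sv := (Svar k).

Local Notation image_set := (image_set psi).

Hypothesis r_gt0 : (0 < r)%N.
Hypothesis kerP : forall g, (forall p, psi p g = 0) -> exists h, g = \sum_j h j * f j.
Hypothesis psi_f : forall p j, psi p (f j) = 0.
Hypothesis conductor : deep N `<=` image_set.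

Let branch0 : 'I_r := Ordinal r_gt0.

Lemma image_single p u : ord_ge N u ->
  exists a, psi p a = u /\ forall q, q != p -> psi q a = 0.
Proof.
move=> hu; have [a ha] := conductor (single_deep p hu).
exists a; split; first by rewrite -ha ffunE eqxx.
by move=> q /negPf nq; rewrite -ha ffunE nq.
Qed.

Lemma parameter_exists : exists xi, forall p, psi p xi = t ^+ N.
Proof.
have [|xi hxi] := @conductor [ffun _ => t ^+ N].
  by move=> p; rewrite ffunE; apply: ord_ge_tX.
by exists xi => p; rewrite -hxi ffunE.
Qed.
Definition xi := projT1 (cid parameter_exists).
Lemma psi_xi p : psi p xi = t ^+ N.
Proof. exact: (projT2 (cid parameter_exists)). Qed.

Definition gens (j : 'I_n) : S := if unlift ord_max j is Some i then f i else xi.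

Lemma gens_max : gens ord_max = xi.
Proof. by rewrite /gens unlift_none. Qed.

Lemma gens_lift j : gens (lift ord_max j) = f j.
Proof. by rewrite /gens liftK. Qed.

Definition dq j := projT1 (cid (difference_quotients (gens j))).
Lemma dqP j : inX k n (gens j) - inY k n (gens j) = \sum_l Zvar k l * dq j l.
Proof. exact: (projT2 (cid (difference_quotients (gens j)))). Qed.

Definition bezout : mpseries (n + n) k := \det (\matrix_(j, l) dq j l).

Definition jac (g : 'I_n -> S) : 'M[S]_n := \matrix_(j, l) sderiv l (g j).

Lemma fold_bezout : fold k n bezout = \det (jac gens).
Proof.
rewrite -det_map_mx; congr (\det _); apply/matrixP => j l; rewrite !mxE.
exact: fold_difference_quotient (dqP j) l.
Qed.

Lemma bezout_Z l : exists h, bezout * Zvar k l =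
  \sum_j h j * (inX k n (gens j) - inY k n (gens j)).
Proof.
set B := \matrix_(j, l) dq j l.
exists (fun j => \adj B l j).
have := mulmxA (\adj B) B (\col_l Zvar k l).
rewrite mul_adj_mx mul_scalar_mx => /(congr1 (fun u : 'cV__ => u l 0)).
rewrite [RHS]mxE [X in _ = _ * X]mxE => <-; rewrite mxE; apply: eq_bigr => j _.
congr (_ * _); rewrite dqP mxE; apply: eq_bigr => i _; by rewrite !mxE mulrC.
Qed.

Lemma eval_gens p q j : eval (psi p) (psi q) (inX k n (gens j) - inY k n (gens j)) =
  if j == ord_max then T ^+ N - Sv ^+ N else 0.
Proof.
rewrite rmorphB /= eval_inX eval_inY.
case: (unliftP ord_max j) => [i ->|->].
  by rewrite gens_lift !psi_f !rmorph0 subrr eq_sym (negPf (neq_lift _ _)).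
by rewrite gens_max !psi_xi eqxx !rmorphXn /= iota1_tvar iota2_tvar.
Qed.

Lemma bezout_annihilates p q a : exists E,
  eval (psi p) (psi q) bezout * (iota1 k (psi p a) - iota2 k (psi q a)) =
  (T ^+ N - Sv ^+ N) * E.
Proof.
have [b hb] := difference_quotients a.
have /choice[h hh] := bezout_Z.
exists (\sum_l eval (psi p) (psi q) (h l ord_max) * eval (psi p) (psi q) (b l)).
have := congr1 (fun F => eval (psi p) (psi q) (bezout * F)) hb.
rewrite /= rmorphM rmorphB /= eval_inX eval_inY => ->.
rewrite mulr_sumr rmorph_sum mulr_sumr; apply: eq_bigr => l _.
rewrite /= mulrA rmorphM /= hh rmorph_sum /= (bigD1 ord_max) //= rmorphM /= eval_gens eqxx.
rewrite big1 ?addr0; first by rewrite mulrA [X in X * _]mulrC.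
by move=> j nj; rewrite rmorphM /= eval_gens (negPf nj) mulr0.
Qed.

(** The test element is t^N on branch q and 0 on branch p. It shows that S^N times the determinant
    is divisible by T^N - S^N, and S^N is coprime to that. *)
Lemma bezout_offdiag p q : p != q -> exists H,
  eval (psi p) (psi q) bezout = (T ^+ N - Sv ^+ N) * H.
Proof.
move=> npq; have [a [aq ap]] := image_single q (@ord_ge_tX k N).
have [E] := bezout_annihilates p q a.
rewrite aq ap // rmorph0 sub0r rmorphXn /= iota2_tvar mulrN => e.
apply: (@TSvarX_dvd k N _ (- E)); by rewrite mulrN -e opprK mulrC.
Qed.

(** The test element is t^(N+1) on branch p. Since T^(N+1) - S^(N+1) = T (T^N - S^N) + S^N (T - S),
    the factor S^N (T - S) kills the determinant modulo T^N - S^N, and S^N is again removed by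
    coprimality. *)
Lemma bezout_diag p : exists C,
  (T - Sv) * eval (psi p) (psi p) bezout = (T ^+ N - Sv ^+ N) * C.
Proof.
have [|a [ap _]] := @image_single p (t ^+ N.+1).
  by apply: (@ord_geW _ _ N.+1) => //; apply: ord_ge_tX.
have [E] := bezout_annihilates p p a.
rewrite ap !rmorphXn /= iota1_tvar iota2_tvar; set D := eval _ _ _ => e.
apply: (@TSvarX_dvd k N _ (E - T * D)).
by rewrite mulrBr -e !exprS; ring.
Qed.

Lemma TS_neq0 : T - Sv != 0.
Proof.
apply/eqP => /(congr1 (fun F => wcoef F 1 0)).
have := wcoef_TM 1 (1 : mpseries 2 k) 1 0; have := wcoef_SM 1 (1 : mpseries 2 k) 1 0.
rewrite !mulr1 !expr1 wcoefB /= => -> ->; rewrite subr0 /wcoef scoef1 -mdeg_eq0 mdeg_mnm2 /=.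
by move/eqP; rewrite oner_eq0.
Qed.

(* The common ratio of the maximal minors of the Jacobian matrix to the
   derivatives of the coordinates. *)
Definition cdual p := diag k (projT1 (cid (bezout_diag p))).

(** Cancelling T - S leaves the sum of the T^(N-1-i) S^i as cofactor. On the diagonal it becomes N
    t^(N-1), which is the derivative of xi on the branch. *)
Lemma det_jac_gens p :
  psi p (\det (jac gens)) = cdual p * sderiv ord0 (psi p xi).
Proof.
rewrite /cdual; case: (cid _) => C /= eC.
have /(congr1 (diag k)) : eval (psi p) (psi p) bezout =
    (\sum_(i < N) T ^+ (N.-1 - i) * Sv ^+ i) * C.
  by apply: (mulfI TS_neq0); rewrite eC subrXX mulrA.
rewrite diag_eval fold_bezout => ->; rewrite rmorphM mulrC; congr (_ * _).
rewrite rmorph_sum (eq_bigr (fun=> t ^+ N')) => [|i _]; last first.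
  rewrite /= rmorphM !rmorphXn /= !diag_svar -exprD subnK //.
  by rewrite -ltnS.
rewrite sumr_const card_ord psi_xi; apply: tcoef_inj => d.
rewrite tcoef_sderiv -scaler_nat tcoefZ !tcoef_tX eqSS mulr_natl.
by case: eqP => [->|_]; rewrite ?mul0rn // mulr0n.
Qed.

Lemma cdualP p : (T - Sv) * eval (psi p) (psi p) bezout = (T ^+ N - Sv ^+ N) *
  projT1 (cid (bezout_diag p)).
Proof. exact: (projT2 (cid (bezout_diag p))). Qed.

Local Notation G := (N + N')%N.

(** As G + 1 = 2N, this is the double residue of u(t) w(s) F dt ds / (t^2N s^2N), summed over all
    pairs of branches. *)
Definition residue2 (u w : V) (F : mpseries (n + n) k) : k :=
  \sum_p \sum_q wcoef (iota1 k (u p) * iota2 k (w q) * eval (psi p) (psi q) F) G G.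

Definition tshift (u : V) : V := [ffun p => t ^+ N * u p].

Lemma pairing_tshift u w : pairing G (tshift u) w = pairing N' u w.
Proof.
apply: eq_bigr => p _; rewrite ffunE -mulrA tcoef_tXM leq_addr.
by rewrite addKn.
Qed.

Definition on_branches (g : S) : V := [ffun p => psi p g].

Lemma residue2_tensor u w a b : residue2 u w (inX k n a * inY k n b) =
  pairing G u (on_branches a) * pairing G w (on_branches b).
Proof.
rewrite /residue2 /pairing mulr_suml; apply: eq_bigr => p _.
rewrite mulr_sumr; apply: eq_bigr => q _.
by rewrite rmorphM /= eval_inX eval_inY mulrACA -!rmorphM wcoef_iota !ffunE.
Qed.

Lemma residue2D u w F F' : residue2 u w (F + F') = residue2 u w F + residue2 u w F'.
Proof.
rewrite /residue2 -big_split; apply: eq_bigr => p _; rewrite -big_split.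
by apply: eq_bigr => q _; rewrite rmorphD mulrDr wcoefD.
Qed.

Lemma residue2_high u w F : ord_ge (G + G).+1 F -> residue2 u w F = 0.
Proof.
move=> hF; rewrite /residue2 big1 // => p _; rewrite big1 // => q _.
apply: (@ord_ge_wcoef k (G + G).+1) => //; apply: ord_geMr.
exact: lrmorph_ord_ge.
Qed.

Lemma on_branchesD a b : on_branches (a + b) = on_branches a + on_branches b.
Proof. by apply/ffunP => p; rewrite !ffunE rmorphD. Qed.

Lemma pairingDr L (u v w : V) :
  pairing L u (v + w) = pairing L u v + pairing L u w.
Proof. by rewrite -[v]scale1r pairing_linr mul1r scale1r. Qed.

(* A second factor acting on the ring as the evaluation at the origin, up to a
   constant, evaluates [Y] at the origin. *)
Lemma residue2_origin u w e F :
  (forall b, pairing G w (on_branches b) = e * scoef b 0) ->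
  residue2 u w F = e * pairing G u (on_branches (origin k n F)).
Proof.
move=> hw; have [F' [s eF'] hF] := tensors_approx (G + G).+1 F.
rewrite -(subrK F' F) residue2D residue2_high // add0r.
rewrite rmorphD on_branchesD pairingDr.
rewrite [pairing G u (on_branches (origin k n (F - F')))]pairingC pairing_deep ?add0r; last first.
  move=> p; rewrite ffunE; do 2 apply: lrmorph_ord_ge; apply: (ord_geW _ hF).
  by rewrite ltnS leq_addr.
rewrite eF'; elim: s {eF'} => [|c s IH].
  rewrite !big_nil residue2_high; last by move=> ? _.
  rewrite rmorph0 pairingC pairing_deep ?mulr0 // => p; rewrite ffunE rmorph0; exact: ord_ge_zero.
rewrite !big_cons residue2D residue2_tensor hw IH.
rewrite rmorphD on_branchesD pairingDr mulrDr; congr (_ + _).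
have -> : on_branches (origin k n (inX k n c.1 * inY k n c.2)) = scoef c.2 0 *: on_branches c.1 + 0.
  apply/ffunP => p; rewrite addr0 !ffunE rmorphM /= origin_inX origin_inY.
  by rewrite mulr_algr linearZ.
rewrite pairing_linr [X in _ + X]pairingC [X in _ + X]pairing_deep ?addr0; last first.
  by move=> p; rewrite ffunE; apply: ord_ge_zero.
by rewrite mulrC -mulrA.
Qed.

Lemma residue2_kill_left u w F :
  (forall a, pairing G u (on_branches a) = 0) -> residue2 u w F = 0.
Proof.
move=> hu; have [F' [s eF'] hF] := tensors_approx (G + G).+1 F.
rewrite -(subrK F' F) residue2D residue2_high // add0r.
rewrite eF'; elim: s {eF'} => [|c s IH].
  by rewrite big_nil residue2_high // => ? _.
by rewrite big_cons residue2D residue2_tensor hu mul0r add0r.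
Qed.

Lemma wcoef_pow_vanish d e (F H : mpseries 2 k) : (d < e)%N ->
  wcoef (F * ((T ^+ e - Sv ^+ e) * H)) d d = 0.
Proof.
by move=> lt; rewrite mulrCA mulrBl wcoefB wcoef_TM wcoef_SM leqNgt lt subrr.
Qed.

(** The sum of the residues of c u w dt / t^2N. *)
Definition trace3 (u w : V) : k := \sum_p tcoef (cdual p * (u p * w p)) G.

(* [(t^N - s^N) (t^N + s^N) = t^2N - s^2N] kills the off-diagonal components
   and turns the diagonal ones into the kernel of [tcoef _ G]. *)
Lemma double_residue u w :
  trace3 u w = residue2 (tshift u) w bezout + residue2 u (tshift w) bezout.
Proof.
have powE : T ^+ N.*2 - Sv ^+ N.*2 = (T ^+ N - Sv ^+ N) * (T ^+ N + Sv ^+ N).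
  by rewrite -muln2 !exprM subr_sqr.
rewrite -big_split; apply: eq_bigr => p _; rewrite -big_split /=.
have E q : wcoef (iota1 k (tshift u p) * iota2 k (w q) * eval (psi p) (psi q) bezout) G G +
    wcoef (iota1 k (u p) * iota2 k (tshift w q) * eval (psi p) (psi q) bezout) G G =
    wcoef (iota1 k (u p) * iota2 k (w q) *
      ((T ^+ N + Sv ^+ N) * eval (psi p) (psi q) bezout)) G G.
  rewrite -wcoefD !ffunE !rmorphM !rmorphXn /= iota1_tvar iota2_tvar.
  by congr wcoef; move: (T ^+ N) (Sv ^+ N) => x y; ring.
under eq_bigr => q _ do rewrite E.
rewrite (bigD1 p) //= [X in _ + X]big1 ?addr0 => [|q]; last first.
  rewrite eq_sym => /bezout_offdiag[H ->].
  rewrite (_ : (T ^+ N + Sv ^+ N) * _ = (T ^+ N.*2 - Sv ^+ N.*2) * H).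
    by apply: wcoef_pow_vanish; rewrite -addnn ltn_add2l.
  by rewrite powE; move: (T ^+ N) (Sv ^+ N) => x y; ring.
have eC := cdualP p; rewrite /cdual; move: (projT1 _) eC => C eC.
have -> : (T ^+ N + Sv ^+ N) * eval (psi p) (psi p) bezout =
    (\sum_(i < G.+1) T ^+ (G - i) * Sv ^+ i) * C.
  apply: (mulfI TS_neq0); rewrite mulrCA eC.
  rewrite [RHS]mulrA -(subrXX T Sv G.+1) -addnS addnn powE.
  by rewrite mulrA [X in X * _]mulrC.
rewrite [in RHS]mulrCA wcoef_kernel !rmorphM /= diag_iota1 diag_iota2.
by rewrite mulrC.
Qed.

Lemma ksub_image : ksub image_set.
Proof.
split.
- by exists 0 => p; rewrite ffunE rmorph0.
- by move=> u v [a ha] [b hb]; exists (a + b) => p; rewrite ffunE ha hb rmorphD.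
- by move=> c u [a ha]; exists (c *: a) => p; rewrite ffunE ha linearZ.
Qed.

Lemma image_on_branches a : image_set (on_branches a).
Proof. by exists a => p; rewrite ffunE. Qed.

Let U := perp N' image_set.

Lemma trace3_perp u w : U u -> U w -> trace3 u w = 0.
Proof.
move=> hu hw; rewrite double_residue residue2_kill_left ?add0r => [|a].
  rewrite (@residue2_origin _ _ 0) ?mul0r // => b.
  by rewrite mul0r pairing_tshift hw //; apply: image_on_branches.
by rewrite pairing_tshift hu //; apply: image_on_branches.
Qed.

(** Pairing with the monomials t^(N + N' - i) on one branch, which lie in [U] by the conductor
    bound, kills the coefficients of c u below t^N. The quotient by t^N is then orthogonal to all of
    [U], and biduality puts it into the image of the ring. *)
Lemma perp_image_div u : U u -> exists2 z, image_set z &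
  forall p, cdual p * u p = t ^+ N * z p.
Proof.
move=> hu.
have /choice[z hz] : forall p, exists z, cdual p * u p = t ^+ N * z.
  move=> p; apply: ord_ge_tdvd; apply/ord_ge_tcoef => i lt.
  have Ud : U (single p (t ^+ (N + (N' - i)))).
    by apply/perp_deep/single_deep; apply: (ord_geW _ (@ord_ge_tX k _)); apply: leq_addr.
  have := trace3_perp hu Ud.
  rewrite /trace3 (bigD1 p) //= big1 ?addr0 => [|q /negPf nq]; last first.
    by rewrite !ffunE nq !mulr0 tcoef0.
  rewrite ffunE eqxx mulrA mulrC tcoef_tXM leq_add2l leq_subr subnDl.
  by rewrite subKn // -ltnS.
pose zz : V := [ffun p => z p].
have tz p : cdual p * u p = t ^+ N * zz p by rewrite ffunE.
exists zz => //; apply: (@perpK _ _ N') => [|//|w hw]; first exact: ksub_image.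
rewrite -pairing_tshift -(trace3_perp hu hw); apply: eq_bigr => p _.
by rewrite ffunE -tz mulrA.
Qed.

(** An element equal to t^N b on every branch differs from xi b by a combination of the equations.
    So D(X,0) would lie in the ideal of [gens], against [det_socle]. *)
Lemma socle_not_in : ~ scale_set (fun=> t ^+ N) image_set (on_branches (origin k n bezout)).
Proof.
case=> w [a ha] hw.
have gensE (g b : S) : (forall p, psi p g = t ^+ N * psi p b) ->
    exists h, g = \sum_j h j * gens j.
  move=> e; have [|h eh] := @kerP (g - xi * b).
    by move=> p; rewrite rmorphB rmorphM /= psi_xi e subrr.
  exists (fun j => if unlift ord_max j is Some i then h i else b).
  rewrite big_ord_recr /= unlift_none gens_max [b * xi]mulrC.
  rewrite -[LHS](subrK (xi * b)) eh; congr (_ + _); apply: eq_bigr => i _.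
  have -> : widen_ord (leqnSn m) i = lift ord_max i.
    by apply/val_inj/esym/lift_max.
  by rewrite liftK gens_lift.
have [h eh] : exists h, origin k n bezout = \sum_j h j * gens j.
  by apply: (gensE _ a) => p; rewrite -ha -hw ffunE.
(* In the exponent 2N one N is the factor xi, and the other puts the cofactor into the conductor,
   hence into the image. *)
have /choice[C hC] : forall l, exists h, svar k l ^+ N.*2 = \sum_j h j * gens j.
  move=> l; have /choice[s hs] : forall p, exists s,
      psi p (svar k l ^+ N.*2) = t ^+ N * (t ^+ N * s).
    move=> p; have [|s es] := @ord_ge_tdvd _ N.*2 (psi p (svar k l ^+ N.*2)).
      apply: lrmorph_ord_ge; rewrite svarX => u lt.
      by rewrite -[smon _ _]mulr1 scoef_smonM; case: ifP => // /mnm_lepP/(_ l);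
         rewrite mulmnE mnm1E eqxx mul1n leqNgt => /negP[]; apply: leq_ltn_trans lt;
         rewrite mdegE (bigD1 l) //= leq_addr.
    by exists s; rewrite es mulrA -exprD addnn.
  have [|b hb] := @conductor [ffun p => t ^+ N * s p].
    by move=> p; rewrite ffunE mulrC; apply/ord_geMr/ord_ge_tX.
  by apply: (gensE _ b) => p; rewrite hs -hb ffunE.
(* At Y = 0 the difference quotients express each [gens j] through the variables, because all of
   them vanish at the origin. *)
pose B : 'M[S]_n := \matrix_(j, l) origin k n (dq j l).
have detB : \det B = origin k n bezout.
  by rewrite -det_map_mx; congr (\det _); apply/matrixP => j l; rewrite !mxE.
have eB : \col_j gens j = B *m \col_l svar k l.
  apply/colP => j; have := congr1 (origin k n) (dqP j).
  rewrite rmorphB rmorph_sum /= origin_inX origin_inY [scoef _ _](_ : _ = 0).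
    rewrite scale0r subr0 !mxE => ->; apply: eq_bigr => l _.
    by rewrite !mxE rmorphM /= origin_Z mulrC.
  rewrite -(lrmorph_scoef0 (psi branch0)); case: (unliftP ord_max j) => [i ->|->].
    by rewrite gens_lift psi_f.
  by rewrite gens_max psi_xi -[0%MM]/(U_(ord0) *+ 0)%MM -/(tcoef _ 0) tcoef_tX.
have eC : (\matrix_(l, j) C l j) *m \col_j gens j = \col_l svar k l ^+ N.*2.
  by apply/colP => l; rewrite !mxE hC; apply: eq_bigr => j _; rewrite !mxE.
have /eqP := det_socle (ltn0Sn _ : (0 < N.*2)%N) eB eC h; apply.
by rewrite detB eh; apply: eq_bigr => j _; rewrite mxE.
Qed.

(** The vector [u] is chosen orthogonal to t^N O with residue 1 against D(X,0), and [w] acts on the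
    ring as evaluation at the origin. The double residue of [u] and [w] is then 1. Computed instead
    through c u = t^N a it is the constant term of [a], so [a] is a unit. *)
Lemma unit_in_perp : exists u a, [/\ U u, scoef a 0 = 1 &
  forall p, cdual p * u p = t ^+ N * psi p a].
Proof.
have kt : ksub (scale_set (fun=> t ^+ N) image_set) by apply/ksub_scale_set/ksub_image.
have dt : deep G.+1 `<=` scale_set (fun=> t ^+ N) image_set.
  move=> s hs; have /choice[z hz] : forall p, exists z, s p = t ^+ N * (t ^+ N * z).
    move=> p; have [z ez] := ord_ge_tdvd (hs p); exists z.
    by rewrite ez mulrA -exprD addnS.
  exists [ffun p => t ^+ N * z p]; last by move=> p; rewrite ffunE.
  by apply: conductor => p; rewrite ffunE mulrC; apply/ord_geMr/ord_ge_tX.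
have [u hu uD] := perp_separates kt dt socle_not_in.
have Uu : U u.
  move=> a Ia; rewrite pairingC -pairing_tshift pairingC; apply: hu.
  by exists a => // p; rewrite ffunE.
pose M : set V := [set s | exists2 a, scoef a 0 = 0 & s = on_branches a].
have kM : ksub M.
  split.
  - by exists 0 => //; apply/ffunP => p; rewrite !ffunE rmorph0.
  - move=> x y [a a0 ->] [b b0 ->]; exists (a + b); last by rewrite on_branchesD.
    by rewrite scoefD a0 b0 addr0.
  - move=> c x [a a0 ->]; exists (c *: a); first by rewrite scoefZ a0 mulr0.
    by apply/ffunP => p; rewrite !ffunE linearZ.
have dM : deep N `<=` M.
  move=> s hs; have [a ha] := conductor hs; exists a; last by apply/ffunP => p; rewrite ffunE.
  rewrite -(lrmorph_scoef0 (psi branch0)) -ha; apply: (hs branch0).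
  by rewrite mdeg0.
have n1 : ~ M (on_branches 1).
  case=> a a0 /ffunP/(_ branch0); rewrite !ffunE rmorph1 => /(congr1 (fun F => scoef F 0)).
  by rewrite lrmorph_scoef0 a0 scoef1 eqxx => /eqP; rewrite oner_eq0.
have [w hw w1] := perp_separates kM dM n1.
have wE b : pairing N' w (on_branches b) = scoef b 0.
  have -> : on_branches b = scoef b 0 *: on_branches 1 + on_branches (b - (scoef b 0)%:A).
    by apply/ffunP => p; rewrite !ffunE rmorphB /= lrmorph_alg rmorph1 addrC subrK.
  rewrite pairing_linr w1 mulr1 hw ?addr0 //.
  exists (b - (scoef b 0)%:A) => //; by rewrite scoefB scoefA eqxx mulr1 subrr.
have [z [a ha] hz] := perp_image_div Uu.
exists u, a; split => //; last by move=> p; rewrite hz ha.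
have : trace3 u w = 1.
  rewrite double_residue residue2_kill_left ?add0r => [|b]; last first.
    by rewrite pairing_tshift Uu //; apply: image_on_branches.
  rewrite (@residue2_origin _ _ 1) ?mul1r // => b.
  by rewrite pairing_tshift wE mul1r.
rewrite -wE pairingC -pairing_tshift => <-; apply: eq_bigr => p _.
by rewrite !ffunE mulrA hz ha.
Qed.

Lemma cdual_neq0 p : cdual p != 0.
Proof.
have [u [a [_ a1 ha]]] := unit_in_perp.
apply/eqP => c0; have := ha p; rewrite c0 mul0r => /esym/(congr1 (fun F => tcoef F N)).
rewrite tcoef_tXM leqnn subnn tcoef0 /tcoef lrmorph_scoef0 a1 => /eqP.
by rewrite oner_eq0.
Qed.

(** [U] is a module over the ring and contains an element that c sends to t^N times a unit, so its
    multiples reach all of t^N O. *)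
Lemma scale_perp_image : scale_set cdual U = scale_set (fun=> t ^+ N) image_set.
Proof.
have [u [a [Uu a1 ha]]] := unit_in_perp.
have [|a' ea] := @series_unit k n a; first by rewrite a1 oner_eq0.
apply/seteqP; split=> s [w hw hs].
  have [z Iz hz] := perp_image_div hw; exists z => // p; by rewrite hs hz.
have [b hb] := hw.
exists [ffun p => u p * psi p (a' * b)]; last first.
  move=> p; rewrite ffunE mulrA ha hs hb -mulrA -rmorphM; congr (_ * psi p _).
  by rewrite mulrA [a * a']mulrC ea mul1r.
move=> x [d hd]; rewrite -[RHS](Uu (on_branches (a' * b * d))); last exact: image_on_branches.
by apply: eq_bigr => p _; rewrite !ffunE hd !rmorphM !mulrA.
Qed.

Lemma lead_count_deeper L (W : set V) M : deep L `<=` W ->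
  (lead_count (L + M) W = lead_count L W + r * M)%N.
Proof.
move=> LW; rewrite /lead_count.
under eq_bigr => p _.
  rewrite big_split_ord /= [X in (_ + X)%N](eq_bigr (fun=> 1%N)) => [|i _]; last first.
    by rewrite (lead_at_deep _ LW) ?leq_addr.
  rewrite sum1_card card_ord; over.
by rewrite big_split /= sum_nat_const card_ord.
Qed.

(* The codimension of the image is the delta invariant and [cdual] generates
   the conductor. *)
Lemma cdual_order (e : 'I_r -> nat) :
  (forall p, ord_ge (e p) (cdual p) /\ tcoef (cdual p) (e p) != 0) ->
  (\sum_p e p + 2 * lead_count N image_set = 2 * (r * N))%N.
Proof.
move=> he.
have d2 : deep (N + N) `<=` scale_set (fun=> t ^+ N) image_set.
  move=> s hs; have /choice[z hz] : forall p, exists z, s p = t ^+ N * (t ^+ N * z).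
    move=> p; have [z ez] := ord_ge_tdvd (hs p); exists z.
    by rewrite ez mulrA -exprD.
  exists [ffun p => t ^+ N * z p]; last by move=> p; rewrite ffunE.
  by apply: conductor => p; rewrite ffunE mulrC; apply/ord_geMr/ord_ge_tX.
have h1 := @lead_count_scale_set k r (N + N) cdual e U he.
rewrite scale_perp_image in h1; move/(_ d2) in h1.
have ht (p : 'I_r) : ord_ge N (t ^+ N) /\ tcoef (t ^+ N) N != 0.
  by split; [apply: ord_ge_tX | rewrite tcoef_tX eqxx oner_eq0].
have h2 := @lead_count_scale_set k r (N + N) (fun=> t ^+ N) (fun=> N) image_set ht d2.
rewrite sum_nat_const card_ord in h2.
have eU : (lead_count (N + N) U = lead_count N U + r * N)%N.
  by apply: lead_count_deeper; apply: perp_deep.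
have eI : (lead_count (N + N) image_set = lead_count N image_set + r * N)%N.
  exact: lead_count_deeper.
rewrite eU in h1; rewrite eI in h2.
have h3 := lead_count_perp ksub_image conductor.
rewrite -/U in h3; rewrite mul2n -addnn.
move: h1 h2 h3; set A := lead_count N U; set B := lead_count N image_set.
set X := lead_count _ _; set Y := (r * N)%N; set E := (\sum_p e p)%N; lia.
Qed.

End CompleteIntersection.

(** * Branches *)

Section BranchConductor.
Variable k : fieldType.
Local Notation t := (tvar k).

Lemma ord_ge_dvd (c s : mpseries 1 k) d :
  ord_ge d c -> tcoef c d != 0 -> ord_ge d s -> exists s', s = c * s'.
Proof.
move=> /ord_ge_tdvd[c' ->]; rewrite tcoef_tXM leqnn subnn => nz /ord_ge_tdvd[s' ->].
have [|w ew] := @series_unit k 1 c'; first exact: nz.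
by exists (w * s'); rewrite -mulrA [c' * _]mulrA [c' * w]mulrC ew mul1r.
Qed.

(** Weierstrass division by [chi t], iterated: the remainder of the d-th quotient provides the
    degree d coefficients of all the [h j]. *)
Lemma power_basis (chi : {lrmorphism mpseries 1 k -> mpseries 1 k}) e :
  (0 < e)%N -> ord_ge e (chi t) -> tcoef (chi t) e != 0 ->
  forall s, exists h : 'I_e -> mpseries 1 k, s = \sum_(j < e) t ^+ j * chi (h j).
Proof.
move=> e0 ou nz; have /choice[st hst] : forall s, exists s1,
    s = \sum_(j < e) tcoef s j *: t ^+ j + chi t * s1.
  move=> s; have [g eg] := tsplit e s.
  have [|s1 es1] := @ord_ge_dvd _ (t ^+ e * g) e ou nz.
    by rewrite mulrC; apply/ord_geMr/ord_ge_tX.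
  by exists s1; rewrite -es1.
pose h s (j : 'I_e) : mpseries 1 k := MPSeries (fun m => tcoef (iter (m ord0) st s) j).
have hc s j d : tcoef (h s j) d = tcoef (iter d st s) j.
  by rewrite {1}/tcoef /scoef /= mulmnE mnm1E eqxx mul1n.
have hE s j : h s j = (tcoef s j)%:A + t * h (st s) j.
  apply: tcoef_inj => d; rewrite tcoefD tcoefA -[t]expr1 tcoef_tXM !hc.
  by case: d => [|d]; rewrite ?mulr1 ?addr0 // mulr0 add0r subn1 -iterSr.
pose err s := s - \sum_(j < e) t ^+ j * chi (h s j).
have errE s : err s = chi t * err (st s).
  rewrite {1}/err {1}(hst s) mulrBr mulr_sumr.
  under [X in _ - X = _]eq_bigr => j _ do
    rewrite hE rmorphD rmorphM /= lrmorph_alg mulrDr mulr_algr.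
  rewrite big_split /= opprD addrACA subrr add0r; congr (_ - _).
  by apply: eq_bigr => j _; rewrite mulrCA.
move=> s; exists (h s); apply/eqP; rewrite -subr_eq0 -/(err s).
apply/eqP/ord_ge_eq0 => d; elim: d s => [//|d IH] s.
rewrite errE -[d.+1]add1n; apply: ord_geM (IH _); exact: ord_geW ou.
Qed.

(** Write t = psi(a) / psi(b), with psi(a) of order d + 1. Every series is a combination of 1, t,
    ..., t^d over the series in psi(a), and the factor psi(b)^(d+1) clears the denominators of these
    powers of t. Its order is the bound [M]. *)
Lemma branch_conductor n (psi : {lrmorphism mpseries n k -> mpseries 1 k}) :
  (forall s, exists a b, psi b != 0 /\ s * psi b = psi a) ->
  exists M, forall s, ord_ge M s -> exists a, psi a = s.
Proof.
move=> frac; have [a [b [nzb eab]]] := frac t.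
have [d [ob nb]] := tord_exists nzb.
have oa : ord_ge d.+1 (psi a).
  by rewrite -eab -[d.+1]add1n; apply: (ord_geM _ ob); apply: ord_ge_svar.
have na : tcoef (psi a) d.+1 != 0.
  by rewrite -eab -[t]expr1 tcoef_tXM /= subn1.
have [|chi hchi] := @subst_exists k 1 n (fun=> a).
  move=> _; apply/ord_ge1P; rewrite -(lrmorph_scoef0 psi).
  by apply/ord_ge1P; apply: ord_geW oa.
pose chi' : {lrmorphism mpseries 1 k -> mpseries 1 k} := psi \o chi.
have basis := @power_basis chi' d.+1 (ltn0Sn d).
rewrite /chi' /= hchi in basis; have {}basis := basis oa na.
have nzc : psi b ^+ d.+1 != 0 by rewrite expf_neq0.
have [M [oM nM]] := tord_exists nzc.
exists M => s /(ord_ge_dvd oM nM)[s' ->].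
have [h ->] := basis s'.
exists (\sum_(j < d.+1) a ^+ j * b ^+ (d.+1 - j) * chi (h j)).
rewrite rmorph_sum mulr_sumr; apply: eq_bigr => j _.
rewrite /= !rmorphM !rmorphXn /= -eab mulrA; congr (_ * _).
by rewrite exprMn -mulrA -exprD (subnKC (ltnW (ltn_ord j))) mulrC.
Qed.

Lemma conductor_exists n r (psi : 'I_r -> {lrmorphism mpseries n k -> mpseries 1 k}) :
  (forall p s, exists a b, psi p b != 0 /\ s * psi p b = psi p a) ->
  (forall p, exists z, psi p z != 0 /\ forall q, q != p -> psi q z = 0) ->
  exists N, deep N.+1 `<=` image_set psi.
Proof.
move=> frac sep.
have /choice[M hM] : forall p, exists M, forall s, ord_ge M s ->
    exists a, psi p a = s /\ forall q, q != p -> psi q a = 0.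
  move=> p; have [M hM] := branch_conductor (frac p).
  have [z [nz zq]] := sep p; have [d [oz nz']] := tord_exists nz.
  (* The first d orders pay for division by [z], which confines the element to branch p; the
     remaining [M] put the quotient into the conductor of that branch. *)
  exists (d + M)%N => s /ord_ge_tdvd[s1 ->]; rewrite exprD -mulrA.
  have [|w hw] := @ord_ge_dvd (psi p z) (t ^+ d) d oz nz'; first exact: ord_ge_tX.
  have [|a ha] := hM (w * (t ^+ M * s1)).
    by apply: ord_geMr; rewrite mulrC; apply/ord_geMr/ord_ge_tX.
  exists (z * a); split; first by rewrite rmorphM /= ha hw -mulrA.
  by move=> q /zq e; rewrite rmorphM /= e mul0r.
exists (\sum_p M p)%N => s hs.
have /choice[a ha] : forall p, exists a, psi p a = s p /\ forall q, q != p -> psi q a = 0.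
  move=> p; apply: hM; apply: ord_geW (hs p); apply: leqW.
  by rewrite (bigD1 p) //= leq_addr.
exists (\sum_p a p) => p; rewrite rmorph_sum (bigD1 p) //=.
have [-> _] := ha p; rewrite big1 ?addr0 // => q nq.
by have [_] := ha q; apply; rewrite eq_sym.
Qed.

End BranchConductor.

(** * Minimal primes of a reduced ring *)

Section MinimalPrimes.
Variable R : comNzRingType.
Implicit Types (P Q M : set R) (x y : R).

Lemma prime_exp P x m : prime_ideal P -> P (x ^+ m) -> P x.
Proof.
move=> [[_ _ _] nP1 PM]; elim: m => [|m IH]; first by rewrite expr0.
by rewrite exprS => /PM[].
Qed.

(* The complement of a maximal multiplicative set avoiding zero is a minimal
   prime. *)
Lemma minimal_prime_avoiding a : (forall m, a ^+ m != 0) ->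
  exists P, minimal_prime P /\ ~ P a.
Proof.
move=> nil.
(* Requiring x a^m to be nonzero for all m allows the powers of [a] to be adjoined, so a maximal [M]
   contains [a] by itself. The empty set satisfies the condition vacuously, as Zorn's lemma needs
   for the empty chain. *)
pose F : set (set R) := [set M | (forall x y, M x -> M y -> M (x * y)) /\
  forall x m, M x -> x * a ^+ m != 0].
have [G FG tot|M [[MM Ma] maxM]] := @Zorn_bigcup R F.
  split=> [x y [A GA Ax] [B GB By]|x m [A GA Ax]]; last by have [_] := FG A GA; apply.
  have [AB|BA] := tot A B GA GB.
    by exists B => //; have [+ _] := FG B GB; apply => //; apply: AB.
  by exists A => //; have [+ _] := FG A GA; apply => //; apply: BA.
have ext x : (forall y m i, (M y \/ y = 1) -> y * x ^+ i * a ^+ m != 0) -> M x.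
  move=> h; apply: contrapT => nMx.
  apply: (maxM [set z | exists y i, (M y \/ y = 1) /\ z = y * x ^+ i]); split.
  - by move=> y My; exists y, 0%N; split; [left | rewrite expr0 mulr1].
  - move=> M'M; apply/nMx/M'M; exists 1, 1%N; split; first by right.
    by rewrite mul1r expr1.
  - move=> _ _ [y [i [hy ->]]] [z [j [hz ->]]]; exists (y * z), (i + j)%N.
    rewrite exprD mulrACA; split=> //.
    case: hy hz => [My|->] [Mz|->]; rewrite ?mul1r ?mulr1; [left|left|left|right] => //.
    exact: MM.
  - by move=> _ m [y [i [hy ->]]]; apply: h.
have M1 : M 1.
  apply: ext => y m i; rewrite expr1n mulr1 => -[My|->]; first exact: Ma.
  by rewrite mul1r.
have Maa : M a.
  apply: ext => y m i; rewrite -mulrA -exprD => -[My|->]; first exact: Ma.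
  by rewrite mul1r.
have MX x m : M x -> M (x ^+ m).
  by move=> Mx; elim: m => [|m IH]; rewrite ?expr0 // exprS; apply: MM.
have M0 x : M x -> x != 0 by move=> /(Ma _ 0%N); rewrite expr0 mulr1.
have PE x : ~ M x -> exists y i, M y /\ y * x ^+ i = 0.
  move=> nMx; apply: contrapT => h; apply: nMx; apply: ext => y m i hy.
  have My : M y by case: hy => [|->].
  apply/eqP => e; apply: h; exists (y * a ^+ m), i; split; first exact/MM/MX.
  by rewrite mulrAC.
have EP x y i : M y -> y * x ^+ i = 0 -> ~ M x.
  by move=> My e Mx; have := M0 _ (MM _ _ My (MX _ i Mx)); rewrite e eqxx.
have primeP : prime_ideal (fun x => ~ M x).
  split; last by move=> x y nM; apply: contrapT => /not_orP[/contrapT ? /contrapT ?]; apply/nM/MM.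
    split.
    - by move=> /M0; rewrite eqxx.
    - move=> x y /PE[u [i [Mu eu]]] /PE[v [j [Mv ev]]].
      apply: (@EP _ (u * v) (i + j)%N); first exact: MM.
      rewrite exprDn mulr_sumr big1 // => l _.
      have [le|lt] := leqP j l.
        by rewrite -(subnK le) [y ^+ _]exprD mulrnAr mulrACA [v * _]mulrCA ev mulr0 mulr0 mul0rn.
      have le : (i <= i + j - l)%N by rewrite -addnBA ?leq_addr // ltnW.
      by rewrite -(subnK le) [x ^+ _]exprD mulrnAr mulrACA [u * _]mulrCA eu mulr0 mul0r mul0rn.
    - move=> b x /PE[y [i [My e]]]; apply: (@EP _ y i) => //.
      by rewrite exprMn mulrCA e mulr0.
  by apply.
exists (fun x => ~ M x); split; last by apply.
split=> // Q primeQ QP x /PE[y [i [My e]]].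
have [[Q0 _ _] _ QM] := primeQ.
have /QM[Qy|] : Q (y * x ^+ i) by rewrite e.
  by case: (QP _ Qy).
exact: prime_exp.
Qed.

Lemma minimal_primes_meet : reduced R ->
  forall a, (forall P, minimal_prime P -> P a) -> a = 0.
Proof.
move=> red a h; apply/eqP; apply: contraT => nz.
have [|P [mP nPa]] := @minimal_prime_avoiding a; last by case: nPa; apply: h.
by move=> m; apply: contra nz => /eqP/red ->.
Qed.

Lemma minimal_primes_separated r (wp : 'I_r -> set R) :
  injective wp -> (forall i, minimal_prime (wp i)) ->
  forall i, exists z, ~ wp i z /\ forall j, j != i -> wp j z.
Proof.
move=> inj mp i.
have /choice[x hx] : forall j, exists x, ~ wp i x /\ (j != i -> wp j x).
  move=> j; have [->|nj] := eqVneq j i.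
    by exists 1; split => //; have [[]] := mp i.
  apply: contrapT => h; case/negP: nj; apply/eqP/inj/seteqP.
  have sub : wp j `<=` wp i.
    by move=> x wx; apply: contrapT => nx; apply: h; exists x.
  split => //; have [_ min] := mp i; apply: min sub; by have [] := mp j.
have [[_ n1 pM] _] := mp i.
exists (\prod_j x j); split.
  apply: (big_ind (fun z => ~ wp i z)) => //; first by move=> a b na nb /pM[].
  by move=> j _; have [] := hx j.
move=> j nj; rewrite (bigD1 j) //= mulrC.
have [[[_ _ +] _ _] _] := mp j; apply; have [_] := hx j; exact.
Qed.

End MinimalPrimes.

Lemma card_nat_values (q : pred nat) L (A : set value) :
  (forall z, A z <-> exists d, [/\ (d < L)%N, q d & z = Some d%:Z]) ->
  A #= `I_(\sum_(d < L) q d).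
Proof.
elim: L A => [|L IH] A hA.
  rewrite big_ord0 II0 card_eq0; apply/eqP/seteqP; split=> z //.
  by move=> /hA[d []].
rewrite big_ord_recr /=; case: (boolP (q L)) => qL; last first.
  rewrite addn0; apply: IH => z; rewrite hA; split=> -[d [lt qd ->]]; exists d; split => //.
    by move: lt; rewrite ltnS leq_eqVlt => /orP[/eqP e|//]; rewrite e (negPf qL) in qd.
  exact: ltnW.
rewrite addn1; apply/eq_cardSP; exists (Some L%:Z); first by apply/hA; exists L.
apply: IH => z; split.
  move=> [/hA[d [lt qd ->]] /= nz]; exists d; split => //.
  by move: lt; rewrite ltnS leq_eqVlt => /orP[/eqP e|//]; rewrite e in nz.
move=> [d [lt qd ->]]; split; first by apply/hA; exists d; split => //; apply: ltnW.
by move=> /= [] e; rewrite e ltnn in lt.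
Qed.

Lemma sum_indicator (R : pzSemiRingType) (T : finType) (B : {set T}) :
  \sum_x (x \in B)%:R = #|B|%:R :> R.
Proof.
by rewrite -natr_sum -sum1_card [in RHS]big_mkcond; congr _%:R; apply: eq_bigr => x _; case: ifP.
Qed.

(** * Relative maximals as values not attained by vanishing on earlier branches *)

Section RelativeMaximals.
Variables (k : fieldType) (r : nat).
Hypothesis char0 : forall i, i.+1%:R != 0 :> k.
Local Notation V := {ffun 'I_r -> mpseries 1 k}.
Implicit Types (f : mpseries 1 k) (d : nat).

Lemma ord_tP f d : ord_t f = Some d%:Z <-> ord_ge d f /\ tcoef f d != 0.
Proof.
rewrite /ord_t; case: pselect => [ex|nex]; last first.
  by split => // -[_ nz]; case: nex; exists d.
case: ex_minnP => e nz mine; split => [[<-]|[/ord_ge_tcoef o nz']].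
  split => //; apply/ord_ge_tcoef => i lt; apply: contraTeq lt; rewrite -leqNgt.
  exact: mine.
congr (Some (Posz _)); apply/eqP; rewrite eqn_leq mine //= leqNgt.
by apply: contraNN nz => /o ->.
Qed.

Lemma ord_t0 : ord_t (0 : mpseries 1 k) = None.
Proof.
rewrite /ord_t; case: pselect => // ex; exfalso.
by case: ex => d; rewrite tcoef0 eqxx.
Qed.

Lemma ord_t_cases f : f = 0 \/ exists d, ord_t f = Some d%:Z.
Proof.
have [->|/tord_exists[d h]] := eqVneq f 0; first by left.
by right; exists d; apply/ord_tP.
Qed.

Lemma value_lt_ord_t d f : value_lt (Some d%:Z) (ord_t f) <-> ord_ge d.+1 f.
Proof.
case: (ord_t_cases f) => [->|[e he]]; first by rewrite ord_t0; split.
rewrite he /=; move/ord_tP: he => [o nz]; split => [lt|h].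
  by apply: ord_geW o.
rewrite ltz_nat ltnNge; apply: contra nz => le; move/ord_ge_tcoef: h => -> //.
Qed.

Lemma ord_ge_lead d f : ord_ge d f -> tcoef f d = 0 -> ord_ge d.+1 f.
Proof.
move=> /ord_ge_tcoef o z; apply/ord_ge_tcoef => i; rewrite ltnS leq_eqVlt.
by case/orP => [/eqP ->|/o].
Qed.

Variables (W : set V) (L : nat).
Hypothesis sW : ksub W.
Hypothesis LW : deep L `<=` W.

Definition value_set : set ('I_r -> value) :=
  [set (fun p => ord_t (s p)) | s in W].

(** An element vanishing on the earlier branches has value infinity there, so it would lie in the
    fiber over the single index [i], which is empty at a maximal point. *)
Lemma relative_maximal_lead (i : 'I_r) (J : {set 'I_r}) (iJ : i \in J) a d :
  (forall j, j \in J -> (j <= i)%N) ->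
  maximal_point (project J value_set) a -> a (exist _ i iJ) = Some d%:Z ->
  ~~ lead_at W i d.
Proof.
move=> Ji [_ fin maxa] ai; apply/negP => /lead_atP[s [Ws s0 o nz]].
have : fiber (project J value_set) [set exist _ i iJ]%SET a
    (fun j => ord_t (s (val j))).
  split.
  - by exists (fun p => ord_t (s p)) => //; exists s.
  - by move=> j; rewrite finset.in_set1 => /eqP ->; rewrite ai; apply/ord_tP.
  move=> j; rewrite finset.in_set1 => nj; rewrite s0.
    by have [z ->] := fin j; rewrite ord_t0.
  rewrite ltn_neqAle Ji ?(valP j) // andbT; apply: contra nj => /eqP e.
  by apply/eqP/val_inj/val_inj.
by rewrite maxa.
Qed.

Lemma relative_maximal_exists (i : 'I_r) d :
  (exists2 s, W s & ord_t (s i) = Some d%:Z) -> ~~ lead_at W i d ->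
  Theta_set value_set i (Some d%:Z).
Proof.
move=> [s0 Ws0 os0] nlead.
pose U (b : 'I_r -> nat) := ~ exists s, [/\ W s, ord_t (s i) = Some d%:Z
  & forall j : 'I_r, (j < i)%N -> ord_ge (b j) (s j)].
pose P m := `[< exists b, U b /\ (\sum_(j < r) b j)%N = m >].
have exP : exists m, P m.
  (* The thresholds [L] cannot be reached: otherwise the part on the earlier branches lies in
     [deep L], and subtracting it produces a lead at (i, d). *)
  exists (\sum_(j < r) L)%N; apply/asboolP; exists (fun=> L); split => //.
  case=> s [Ws /ord_tP[o nz] hs]; case/negP: nlead.
  pose u : V := [ffun j : 'I_r => if (j < i)%N then s j else 0].
  have Wu : W u by apply: LW => j; rewrite ffunE; case: ifP => // /hs.
  apply/lead_atP; exists (s - u); split; first exact: ksubB.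
  - by move=> j lt; rewrite !ffunE lt subrr.
  - by rewrite !ffunE ltnn subr0.
  - by rewrite !ffunE ltnn subr0.
case: (ex_minnP exP) => m /asboolP[b [Ub bm]] minm.
have low j : (0 < b j)%N -> exists s, [/\ W s, ord_t (s i) = Some d%:Z
    & forall l : 'I_r, (l < i)%N -> ord_ge (b l - (l == j)) (s l)].
  move=> bj; apply: contrapT => h.
  have : (m <= (\sum_(l < r) (b l - (l == j))))%N.
    by apply: minm; apply/asboolP; exists (fun l => b l - (l == j))%N.
  rewrite -bm leqNgt => /negP; apply.
  rewrite (bigD1 j) //= [X in (_ < X)%N](bigD1 j) //= eqxx subn1.
  rewrite -addSn prednK // leq_add2l leq_sum // => l /negPf ->; by rewrite subn0.
have bi (j : 'I_r) : ~~ (j < i)%N -> b j = 0%N.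
  move=> nlt; apply/eqP; rewrite -leqn0 leqNgt; apply/negP => bj.
  have [s [Ws os hs]] := low j bj; apply: Ub; exists s; split => // l lt.
  have := hs l lt; rewrite (_ : l == j = false) ?subn0 //.
  by apply/eqP => e; rewrite -e lt in nlt.
pose J := (i |: [set j : 'I_r | (0 < b j)%N])%SET.
have iJ : i \in J by rewrite finset.setU11.
have Jle j : j \in J -> (j <= i)%N.
  rewrite in_setU1 inE => /orP[/eqP -> //|bj]; apply: ltnW.
  by apply: contraLR bj => /bi ->.
pose x0 : {j | j \in J} := exist _ i iJ.
have Jpos (x : {j | j \in J}) : x != x0 -> (0 < b (val x))%N /\ (val x < i)%N.
  move=> nx; have nxi : val x != i by apply: contra nx => /eqP e; apply/eqP/val_inj.
  have := valP x; rewrite in_setU1 (negPf nxi) inE /= => bx; split => //.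
  by apply: contraLR bx => /bi ->.
(* By minimality, lowering one threshold by 1 makes it reachable. The witness [e x] misses the
   threshold on branch x by exactly one order, reaches it on the other earlier branches, and is
   normalized to leading coefficient 1 on branch i. *)
have /choice[e he] : forall x : {j | j \in J}, exists s, x != x0 ->
    [/\ W s, ord_ge d (s i), tcoef (s i) d = 1,
      forall l : 'I_r, (l < i)%N -> l != val x -> ord_ge (b l) (s l)
    & ord_ge (b (val x)).-1 (s (val x)) /\ tcoef (s (val x)) (b (val x)).-1 != 0].
  move=> x; have [->|nx] := eqVneq x x0; first by exists 0.
  have [bx lx] := Jpos x nx; have [s [Ws os hs]] := low _ bx.
  have [o nz] := (ord_tP _ _).1 os.
  exists ((tcoef (s i) d)^-1 *: s) => _; split.
  - by have [_ _] := sW; apply.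
  - by rewrite ffunE; apply: ord_geZ.
  - by rewrite ffunE tcoefZ mulVf.
  - by move=> l lt /negPf nl; rewrite ffunE; apply: ord_geZ; have := hs l lt; rewrite nl subn0.
  have ox := hs _ lx; rewrite eqxx subn1 in ox.
  rewrite ffunE; split; first exact: ord_geZ.
  rewrite tcoefZ mulf_neq0 ?invr_neq0 //; apply/eqP => z; apply: Ub; exists s; split => //.
  move=> l lt; have [->|nl] := eqVneq l (val x).
    by rewrite -(prednK bx); apply: ord_ge_lead.
  by have := hs l lt; rewrite (negPf nl) subn0.
pose a (x : {j | j \in J}) : value := if x == x0 then Some d%:Z else Some (b (val x)).-1%:Z.
pose E := project J value_set.
(* In a combination of the [e x], the term of critical order on branch x comes from [c x] alone,
   while on branch i it is the sum of all [c x]. Membership in the fiber over [A] is thus a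
   condition on which of these scalars vanish. *)
have fiberU (A : {set {j | j \in J}}) (c : {j | j \in J} -> k) :
    c x0 = 0 -> (forall x, x != x0 -> (c x != 0) = (x \in A)) ->
    (\sum_x c x != 0) = (x0 \in A) -> fiber E A a !=set0.
  move=> c0 cA sA; pose s : V := \sum_x c x *: e x.
  have sE l : s l = \sum_(x | x != x0) c x *: e x l.
    rewrite /s sum_ffunE (bigD1 x0) //= ffunE c0 scale0r add0r.
    by apply: eq_bigr => x _; rewrite ffunE.
  have Ws : W s.
    apply: ksub_sum => // x _; have [->|nx] := eqVneq x x0.
      by rewrite c0 scale0r; case: sW.
    by have [Wx _ _ _ _] := he x nx; have [_ _] := sW; apply.
  have si : ord_ge d (s i) /\ tcoef (s i) d = \sum_x c x.
    rewrite sE; split.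
      by apply: ord_ge_sum => x nx; apply: ord_geZ; have [] := he x nx.
    rewrite tcoef_sum [RHS](bigD1 x0) //= c0 add0r; apply: eq_bigr => x nx.
    by have [_ _ e1 _ _] := he x nx; rewrite tcoefZ e1 mulr1.
  have sx x : x != x0 -> ord_ge (b (val x)).-1 (s (val x)) /\
      tcoef (s (val x)) (b (val x)).-1 = c x * tcoef (e x (val x)) (b (val x)).-1.
    move=> nx; have [bx lx] := Jpos x nx.
    have oy y : y != x0 -> y != x -> ord_ge (b (val x)) (e y (val x)).
      move=> ny nyx; have [_ _ _ h _] := he y ny; apply: h => //.
      by apply: contra nyx => /eqP exy; apply/eqP/val_inj.
    rewrite sE; split.
      apply: ord_ge_sum => y ny; apply: ord_geZ; have [->|nyx] := eqVneq y x.
        by have [_ _ _ _ []] := he x nx.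
      by apply: ord_geW (oy y ny nyx); apply: leq_pred.
    rewrite tcoef_sum (bigD1 x) //= big1 ?addr0 ?tcoefZ // => y /andP[ny nyx].
    rewrite tcoefZ; move/ord_ge_tcoef: (oy y ny nyx) => -> //; first by rewrite mulr0.
    by rewrite prednK.
  exists (fun x => ord_t (s (val x))); split.
  - by exists (fun p => ord_t (s p)) => //; exists s.
  - move=> x xA; rewrite /a; have [ex|nx] := eqVneq x x0.
      rewrite ex; apply/ord_tP; rewrite /= si.2 sA -ex; split => //; exact: si.1.
    apply/ord_tP; have [o ->] := sx x nx; split => //.
    by have [_ _ _ _ [_ nz]] := he x nx; rewrite mulf_neq0 // cA.
  - move=> x xA; rewrite /a; have [ex|nx] := eqVneq x x0.
      rewrite ex; apply/value_lt_ord_t/ord_ge_lead; first exact: si.1.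
      by rewrite /= si.2; apply/eqP; rewrite -[_ == _]negbK sA -ex.
    apply/value_lt_ord_t; have [o et] := sx x nx; apply: ord_ge_lead => //.
    by rewrite et; have := cA x nx; rewrite (negPf xA) => /negbFE/eqP ->; rewrite mul0r.
have natn0 m' : (0 < m')%N -> m'%:R != 0 :> k by case: m'.
have fiberA (A : {set {j | j \in J}}) : (2 <= #|A|)%N -> fiber E A a !=set0.
  move=> A2; case: (boolP (x0 \in A)) => xA.
    apply: (fiberU A (fun x => (x \in (A :\ x0)%SET)%:R)).
    - by rewrite in_setD1 eqxx.
    - by move=> x nx; rewrite in_setD1 nx /=; case: (x \in A); rewrite ?oner_eq0 ?eqxx.
    rewrite sum_indicator xA natn0 //.
    by move: A2; rewrite (cardsD1 x0 A) xA add1n ltnS.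
  have [x1 x1A] : exists x1, x1 \in A.
    by apply/set0Pn; rewrite -card_gt0; apply: leq_trans A2.
  have n10 : x1 != x0 by apply: contraNneq xA => <-.
  (* Here the coefficients must sum to 0, so the one at [x1] becomes 1 - #|A|. It is nonzero because
     [A] has at least two elements and the characteristic is 0. *)
  apply: (fiberU A (fun x => (x \in A)%:R - #|A|%:R * (x \in [set x1]%SET)%:R)).
  - by rewrite (negPf xA) finset.in_set1 eq_sym (negPf n10) mulr0 subr0.
  - move=> x nx; rewrite finset.in_set1; have [->|n1] := eqVneq x x1.
      rewrite x1A mulr1 -opprB oppr_eq0 -natrB ?natn0 ?subn_gt0 //.
      exact: leq_trans A2.
    by rewrite mulr0 subr0; case: (x \in A); rewrite ?oner_eq0 ?eqxx.
  by rewrite sumrB -mulr_sumr !sum_indicator cards1 mulr1 subrr eqxx (negPf xA).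
have [x1 n10] : exists x1, x1 != x0.
  apply: contrapT => h; apply: Ub; exists s0; split => // j lt.
  suff -> : b j = 0%N by [].
  apply/eqP; rewrite -leqn0 leqNgt; apply/negP => bj.
  have jJ : j \in J by rewrite in_setU1 inE bj orbT.
  apply: h; exists (exist _ j jJ); apply/eqP => /(congr1 val) /= ej.
  by rewrite ej ltnn in lt.
have cJ : (2 <= #|[set: {j | j \in J}]%SET|)%N.
  rewrite (cardsD1 x0) finset.in_setT add1n ltnS card_gt0; apply/set0Pn; exists x1.
  by rewrite in_setD1 n10 finset.in_setT.
exists J, iJ; split.
- rewrite properE finset.sub1set iJ; apply/subsetPn; exists (val x1); first exact: valP.
  by rewrite finset.in_set1; apply: contra n10 => /eqP ei; apply/eqP/val_inj.
- exact: Jle.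
exists a; last by rewrite /a eqxx.
split; last exact: fiberA.
have [v [Ev va _]] := fiberA _ cJ.
have ev : v = a by apply/funext => x; apply: va; rewrite finset.in_setT.
split; first by rewrite -ev.
  by move=> x; rewrite /a; case: ifP => _; [exists d%:Z | exists (b (val x)).-1%:Z].
move=> x; apply/seteqP; split=> // _ [[_ [s Ws <-] <-] ex gx].
have ax y : y != x0 -> a y = Some (b (val y)).-1%:Z by rewrite /a => /negPf ->.
have {}gx y : y != x -> value_lt (a y) (ord_t (s (val y))).
  by move=> ny; apply: gx; rewrite finset.in_set1.
have {}ex : ord_t (s (val x)) = a x by apply: ex; rewrite finset.in_set1.
have gb y : y != x -> y != x0 -> ord_ge (b (val y)) (s (val y)).
  move=> /gx + ny; rewrite ax // => /value_lt_ord_t.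
  by have [bp _] := Jpos y ny; rewrite prednK.
have outJ (l : 'I_r) u : (l < i)%N ->
    (forall y : {j | j \in J}, val y = l -> ord_ge (b l) u) -> ord_ge (b l) u.
  move=> lt h; have [lJ|nlJ] := boolP (l \in J); first exact: (h (exist _ l lJ)).
  suff -> : b l = 0%N by [].
  apply/eqP; rewrite -leqn0 leqNgt; apply: contra nlJ => bl.
  by rewrite in_setU1 inE bl orbT.
(* For x = i the fiber element itself reaches all thresholds. Otherwise a multiple of it cancels the
   leading term of [e x] on branch x, leaving the value d on branch i unchanged; again all
   thresholds are reached. *)
have [e0|nx] := eqVneq x x0.
  apply: Ub; exists s; split => //; first by rewrite e0 /a eqxx in ex.
  move=> l lt; apply: outJ => // y ey; rewrite -ey; apply: gb; rewrite ?e0 //;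
    by apply/eqP => /(congr1 val) /= e1; rewrite -ey /= e1 ltnn in lt.
have [bx lx] := Jpos x nx.
rewrite ax // in ex; have [ox nzx] := (ord_tP _ _).1 ex.
have [We od e1 eo [oe nze]] := he x nx.
have od' : ord_ge d.+1 (s i).
  by apply/value_lt_ord_t; have := gx x0; rewrite /a eqxx eq_sym; apply.
apply: Ub.
exists (e x - (tcoef (e x (val x)) (b (val x)).-1 / tcoef (s (val x)) (b (val x)).-1) *: s).
split.
- by apply: ksubB => //; have [_ _] := sW; apply.
- rewrite !ffunE; apply/ord_tP; split.
    by apply: ord_geB => //; apply: ord_geZ; apply: ord_geW od'.
  rewrite tcoefB tcoefZ e1; move/ord_ge_tcoef: od' => -> //.
  by rewrite mulr0 subr0 oner_eq0.
move=> l lt; rewrite !ffunE; have [->|nl] := eqVneq l (val x).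
  rewrite -(prednK bx); apply: ord_ge_lead.
    by apply: ord_geB => //; apply: ord_geZ.
  by rewrite tcoefB tcoefZ divfK // subrr.
apply: ord_geB; first exact: eo.
apply: ord_geZ; apply: outJ => // y ey; rewrite -ey; apply: gb.
  by apply: contra nl => /eqP <-; rewrite ey.
by apply/eqP => /(congr1 val) /= e2; rewrite -ey /= e2 ltnn in lt.
Qed.

Lemma Theta_setP (i : 'I_r) z : Theta_set value_set i z <->
  exists d, [/\ (d < L)%N, `[< exists2 s, W s & ord_t (s i) = Some d%:Z >]
    && ~~ lead_at W i d & z = Some d%:Z].
Proof.
split=> [[J [iJ [_ Ji [a [ma _] az]]]]|[d [_ /andP[/asboolP ex nl] ->]]]; last first.
  exact: relative_maximal_exists.
have [[b [s Ws eb] ab] fin _] := ma.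
have [x ax] := fin (exist _ i iJ).
have es : ord_t (s i) = Some x by rewrite -ax -ab -eb.
have [s0|[d ed]] := ord_t_cases (s i); first by rewrite s0 ord_t0 in es.
have nl : ~~ lead_at W i d.
  by apply: (relative_maximal_lead Ji ma); rewrite ax -es ed.
exists d; split; last by rewrite -az ax -es.
  by rewrite ltnNge; apply: contra nl; apply: lead_at_deep.
by rewrite nl andbT; apply/asboolP; exists s.
Qed.

End RelativeMaximals.

Definition branch_map (k : fieldType) n r (O : comAlgType k)
    (pi : {lrmorphism mpseries n k -> O})
    (phi : 'I_r -> {lrmorphism O -> mpseries 1 k}) p :
  {lrmorphism mpseries n k -> mpseries 1 k} := phi p \o pi.

(** * The Jacobian ideal and differentials *)

Section JacobianIdeal.
Variables (k : fieldType) (m r : nat) (O : comAlgType k).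
Local Notation n := m.+1.
Local Notation S := (mpseries n k).
Local Notation V := {ffun 'I_r -> mpseries 1 k}.
Local Notation t := (tvar k).
Variable pi : {lrmorphism S -> O}.
Variable phi : 'I_r -> {lrmorphism O -> mpseries 1 k}.
Local Notation psi := (branch_map pi phi).
Variable f : 'I_m -> S.
Variable N' : nat.
Local Notation N := N'.+1.

Hypothesis char0 : forall i, i.+1%:R != 0 :> k.
Hypothesis phi_inj : forall a, (forall p, phi p a = 0) -> a = 0.
Hypothesis r_gt0 : (0 < r)%N.
Hypothesis ker_pi : ideal_gen (range f) = kernel pi.
Hypothesis conductor : deep N `<=` image_set psi.

Lemma ideal_gen_ideal (R : comNzRingType) (A : set R) : ideal (ideal_gen A).
Proof.
split=> [I [[]]//|x y hx hy I hI|a x hx I hI].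
  by have [[_ ID _] _] := hI; apply: ID; [apply: hx | apply: hy].
by have [[_ _ IM] _] := hI; apply: IM; apply: hx.
Qed.

Lemma ideal_gen_mul (R : comNzRingType) (A : set R) a x :
  ideal_gen A x -> ideal_gen A (a * x).
Proof. by have [_ _] := ideal_gen_ideal A; apply. Qed.

Lemma ideal_gen0 (R : comNzRingType) (A : set R) : ideal_gen A 0.
Proof. by have [] := ideal_gen_ideal A. Qed.

Lemma ideal_gen_mem (R : comNzRingType) (A : set R) x : A x -> ideal_gen A x.
Proof. by move=> Ax I [_]; apply. Qed.

Lemma ideal_gen_min (R : comNzRingType) (A I : set R) :
  ideal I -> A `<=` I -> ideal_gen A `<=` I.
Proof. by move=> iI AI x; apply; split. Qed.

Lemma ideal_sum (R : comNzRingType) (I : set R) (T : finType) (F : T -> R) :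
  ideal I -> (forall j, I (F j)) -> I (\sum_j F j).
Proof. by move=> [I0 ID _] h; apply: big_ind. Qed.

Lemma pi_f j : pi (f j) = 0.
Proof.
suff : kernel pi (f j) by [].
by rewrite -ker_pi; apply: ideal_gen_mem; exists j.
Qed.

Lemma kernel_sum g : kernel pi g -> exists h, g = \sum_j h j * f j.
Proof.
rewrite -ker_pi; apply: (@ideal_gen_min _ _ [set g | exists h, g = \sum_j h j * f j]).
  split.
  - by exists (fun=> 0); rewrite big1 // => j _; rewrite mul0r.
  - move=> x y [h ->] [h' ->]; exists (fun j => h j + h' j).
    by rewrite -big_split; apply: eq_bigr => j _; rewrite mulrDl.
  - move=> a x [h ->]; exists (fun j => a * h j).
    by rewrite mulr_sumr; apply: eq_bigr => j _; rewrite mulrA.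
move=> _ [j _ <-]; exists (fun i => (i == j)%:R).
rewrite (bigD1 j) //= eqxx mul1r big1 ?addr0 // => i /negPf ->; exact: mul0r.
Qed.

Lemma psi_f0 p j : psi p (f j) = 0.
Proof. by rewrite /= pi_f rmorph0. Qed.

Lemma psi_ker g : (forall p, psi p g = 0) -> exists h, g = \sum_j h j * f j.
Proof. by move=> h; apply: kernel_sum; apply: phi_inj. Qed.

Local Notation cd := (cdual psi_f0 conductor).
Local Notation xi := (xi conductor).

Definition tangent p (l : 'I_n) : mpseries 1 k := sderiv ord0 (psi p (svar k l)).

Lemma chain_rule p g : sderiv ord0 (psi p g) = \sum_l psi p (sderiv l g) * tangent p l.
Proof. exact: lrmorph_deriv. Qed.

Lemma xi_deriv_neq0 p : sderiv ord0 (psi p xi) != 0.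
Proof.
rewrite (psi_xi conductor); apply/eqP => /(congr1 (fun F => tcoef F N')).
by rewrite tcoef_sderiv tcoef_tX eqxx tcoef0 => /eqP; rewrite (negPf (char0 _)).
Qed.

(** On each branch the gradients of elements of the kernel annihilate the tangent vector. That
    vector is nonzero because the derivative of xi is, so the square matrix of gradients is
    singular. *)
Lemma det_jacobian_square q (h : 'I_q -> S) (c : 'I_q -> 'I_n) : q = n ->
  (forall a, kernel pi (h a)) ->
  \det (\matrix_(a, b) pi (sderiv (c b) (h a))) = 0.
Proof.
move=> eq; subst q => hker; apply: phi_inj => p.
pose A : 'M_n := \matrix_(a, l) psi p (sderiv l (h a)).
pose C : 'M[mpseries 1 k]_n := \matrix_(l, b) (l == c b)%:R.
have -> : phi p (\det (\matrix_(a, b) pi (sderiv (c b) (h a)))) = \det (A *m C).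
  rewrite -det_map_mx; congr (\det _); apply/matrixP => a b; rewrite !mxE.
  rewrite (bigD1 (c b)) //= !mxE eqxx mulr1 big1 ?addr0 // => l /negPf nl.
  by rewrite !mxE nl mulr0.
rewrite det_mulmx; suff -> : \det A = 0 by rewrite mul0r.
pose x : 'cV_n := \col_l tangent p l.
have Ax : A *m x = 0.
  apply/colP => a; rewrite !mxE; under eq_bigr => l _ do rewrite !mxE.
  rewrite -chain_rule /= (hker a) rmorph0.
  by apply: tcoef_inj => d; rewrite tcoef_sderiv !tcoef0 mul0rn.
have := mulmxA (\adj A) A x; rewrite Ax mulmx0 mul_adj_mx mul_scalar_mx => e.
apply/eqP; apply: contraT => nz; case/negP: (xi_deriv_neq0 p).
rewrite chain_rule big1 // => l _; have /esym/eqP := congr1 (fun u : 'cV__ => u l 0) e.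
by rewrite !mxE mulf_eq0 (negPf nz) => /eqP ->; rewrite mulr0.
Qed.

(** Right multiplication by this matrix selects the columns [c] and puts the directional derivative
    along [x] in the last column, so one product formula treats every minor. *)
Definition bordered (c : 'I_m -> 'I_n) (x : 'I_n -> mpseries 1 k) : 'M[mpseries 1 k]_n :=
  \matrix_(l, b) if unlift ord_max b is Some b' then (l == c b')%:R else x l.

Lemma det_bordered c : exists kap : 'I_n -> k, forall x,
  \det (bordered c x) = \sum_l kap l *: x l.
Proof.
pose C : 'M[k]_n := \matrix_(l, b) if unlift ord_max b is Some b' then (l == c b')%:R else 0.
exists (fun l => cofactor C l ord_max) => x.
rewrite (expand_det_col _ ord_max); apply: eq_bigr => l _.
rewrite mxE unlift_none mulrC -mulr_algl; congr (_ * _).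
rewrite -[_%:A]/(GRing.in_alg (mpseries 1 k) (cofactor C l ord_max)) -cofactor_map_mx.
congr (_ * \det _); apply/matrixP => a b; rewrite !mxE !liftK.
by rewrite rmorph_nat.
Qed.

Lemma det_bordered_lift (l : 'I_n) x :
  \det (bordered (lift l) x) = (-1) ^+ (l + m) * x l.
Proof.
rewrite (expand_det_row _ l) (bigD1 ord_max) //= big1 ?addr0.
  rewrite mxE unlift_none mulrC; congr (_ * _).
  rewrite /cofactor [X in _ * \det X](_ : _ = 1%:M) ?det1 ?mulr1 //.
  apply/matrixP => a b; rewrite !mxE liftK (inj_eq (@lift_inj _ l)) //.
move=> b; case: (unliftP ord_max b) => [b' ->|->]; last by rewrite eqxx.
by move=> _; rewrite mxE liftK (negPf (neq_lift _ _)) mul0r.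
Qed.

(** Multiply the Jacobian matrix of [gens] by the bordered matrix of the tangent vector. By the
    chain rule the last column becomes (0, ..., 0, xi'), so the product has determinant xi' times
    the minor. The Jacobian determinant is c xi', and xi' cancels. *)
Lemma det_minor p (c : 'I_m -> 'I_n) :
  \det (\matrix_(j, b) psi p (sderiv (c b) (f j))) =
  cd p * \det (bordered c (tangent p)).
Proof.
pose G : 'M_n := map_mx (psi p) (jac (gens f conductor)).
have Gj j l : G (lift ord_max j) l = psi p (sderiv l (f j)).
  by rewrite !mxE gens_lift.
have Gmax l : G ord_max l = psi p (sderiv l xi) by rewrite !mxE gens_max.
have detG : \det G = cd p * sderiv ord0 (psi p xi).
  by rewrite det_map_mx; exact: det_jac_gens.
apply: (mulfI (xi_deriv_neq0 p)).
rewrite mulrA [_ * cd p]mulrC -detG -det_mulmx (expand_det_col _ ord_max).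
rewrite (bigD1 ord_max) //= big1 ?addr0.
  rewrite mxE chain_rule; congr (_ * _).
    by apply: eq_bigr => l _; rewrite Gmax mxE unlift_none.
  rewrite /cofactor -signr_odd oddD addbb expr0 mul1r; congr (\det _).
  apply/matrixP => j b; rewrite !mxE (bigD1 (c b)) //= Gj !mxE liftK eqxx mulr1.
  by rewrite big1 ?addr0 // => l /negPf nl; rewrite !mxE liftK nl mulr0.
move=> j; case: (unliftP ord_max j) => [j' ->|->]; last by rewrite eqxx.
move=> _; rewrite mxE (eq_bigr (fun l => psi p (sderiv l (f j')) * tangent p l)).
  rewrite -chain_rule psi_f0.
  by rewrite (_ : sderiv _ _ = 0) ?mul0r //; apply: tcoef_inj => d;
     rewrite tcoef_sderiv !tcoef0 mul0rn.
by move=> l _; rewrite Gj mxE unlift_none.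
Qed.

Definition coord l : O := pi (svar k l).

Definition differential_set : set V :=
  [set s | exists g, forall p, s p = differential_pullback coord (phi p) g].

Lemma differential_pullbackE p g : differential_pullback coord (phi p) g =
  t * \sum_l phi p (g l) * tangent p l.
Proof. by rewrite mulrC. Qed.

Lemma ksub_differential_set : ksub differential_set.
Proof.
split.
- exists (fun=> 0) => p; rewrite ffunE differential_pullbackE big1 ?mulr0 // => l _.
  by rewrite rmorph0 mul0r.
- move=> u v [g hg] [h hh]; exists (fun l => g l + h l) => p.
  rewrite ffunE hg hh !differential_pullbackE -mulrDr -big_split; congr (_ * _).
  by apply: eq_bigr => l _; rewrite rmorphD mulrDl.
- move=> a u [g hg]; exists (fun l => a *: g l) => p.
  rewrite ffunE hg !differential_pullbackE scalerAr scaler_sumr; congr (_ * _).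
  by apply: eq_bigr => l _; rewrite linearZ scalerAl.
Qed.

Lemma differential_exact g p : differential_pullback coord (phi p) (fun l => pi (sderiv l g)) =
  t * sderiv ord0 (psi p g).
Proof. by rewrite differential_pullbackE chain_rule. Qed.

Lemma tcoef_t_deriv (s : mpseries 1 k) d : tcoef (t * sderiv ord0 s) d = tcoef s d *+ d.
Proof.
rewrite -[t]expr1 tcoef_tXM; case: d => [|d] //=.
by rewrite subn1 tcoef_sderiv.
Qed.

Lemma deep_differential_set : deep N `<=` differential_set.
Proof.
move=> s hs.
(* Termwise integration for t d/dt. At degree 0 the division by zero is harmless: [s] has no
   constant term, since N is positive. *)
pose A : V := [ffun p => MPSeries (fun u => tcoef (s p) (u ord0) / (u ord0)%:R)].
have AE p d : tcoef (A p) d = tcoef (s p) d / d%:R.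
  by rewrite /tcoef ffunE /scoef /= mulmnE mnm1E eqxx mul1n.
have [|a ha] := @conductor A.
  move=> p; apply/ord_ge_tcoef => i lt; rewrite AE.
  by move/ord_ge_tcoef: (hs p) => -> //; rewrite mul0r.
exists (fun l => pi (sderiv l a)) => p; rewrite differential_exact -ha.
apply: tcoef_inj => d; rewrite tcoef_t_deriv AE; case: d => [|d].
  by move/ord_ge_tcoef: (hs p) => ->.
by rewrite -[LHS](divfK (char0 d)) mulr_natr.
Qed.

(** On the curve, the gradients of kernel elements are combinations of those of the [f j], so the
    minor is [\det Hm] times a minor of the equations, and [det_minor] applies. *)
Lemma minor_in_differentials q (h : 'I_q -> S) (c : 'I_q -> 'I_n) : q = m ->
  (forall a, kernel pi (h a)) ->
  exists2 w, differential_set w & forall p,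
    t * phi p (\det (\matrix_(a, b) pi (sderiv (c b) (h a)))) = cd p * w p.
Proof.
move=> eq; subst q => hker.
have /choice[H hH] := fun a => kernel_sum (hker a).
have [kap hkap] := det_bordered c.
pose Hm : 'M[S]_m := \matrix_(a, j) H a j.
pose g l : O := pi (\det Hm) * (kap l)%:A.
exists [ffun p => differential_pullback coord (phi p) g].
  by exists g => p; rewrite ffunE.
move=> p; rewrite ffunE differential_pullbackE mulrCA; congr (_ * _).
transitivity (psi p (\det Hm) * \det (\matrix_(j, b) psi p (sderiv (c b) (f j)))).
  rewrite -!det_map_mx -det_mulmx; congr (\det _); apply/matrixP => a b.
  rewrite !mxE -[LHS]/(psi p (sderiv (c b) (h a))) hH sderiv_sum rmorph_sum.
  apply: eq_bigr => j _; rewrite /= sderivM !rmorphD !rmorphM /= pi_f !rmorph0 mulr0 add0r.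
  by rewrite !mxE.
rewrite det_minor mulrCA; congr (_ * _); rewrite hkap mulr_sumr.
apply: eq_bigr => l _; rewrite /g rmorphM /= -mulrA; congr (_ * _).
by rewrite linearZ rmorph1 mulr_algl.
Qed.

Lemma minor_lift_exists q (l : 'I_n) : q = m -> exists (h : 'I_q -> S) (c : 'I_q -> 'I_n),
  (forall a, kernel pi (h a)) /\ forall p,
    phi p (\det (\matrix_(a, b) pi (sderiv (c b) (h a)))) =
    (-1) ^+ (l + m) * (cd p * tangent p l).
Proof.
move=> eq; subst q; exists f, (lift l); split=> [a|p]; first exact: pi_f.
rewrite -det_map_mx (_ : map_mx _ _ = \matrix_(j, b) psi p (sderiv (lift l b) (f j))).
  by rewrite det_minor det_bordered_lift mulrCA.
by apply/matrixP => a b; rewrite !mxE.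
Qed.

Lemma fitting0 : kahler_fitting pi 0 = [set 0].
Proof.
apply/seteqP; split=> [x|_ ->]; last exact: ideal_gen0.
apply: ideal_gen_min.
  by split=> [//|u v -> ->|a u ->]; rewrite ?addr0 ?mulr0.
by move=> _ [h [c [hker ->]]]; apply: det_jacobian_square => //; rewrite subn0.
Qed.

Lemma fitting1_sub a : kahler_fitting pi 1 a ->
  exists2 w, differential_set w & forall p, t * phi p a = cd p * w p.
Proof.
have [d0 dD _] := ksub_differential_set.
move: a; apply: ideal_gen_min.
  split.
  - by exists 0 => // p; rewrite rmorph0 ffunE !mulr0.
  - move=> x y [w hw ew] [v hv ev]; exists (w + v); first exact: dD.
    by move=> p; rewrite rmorphD ffunE !mulrDr ew ev.
  - move=> a x [w [g hg] ew]; exists [ffun p => phi p a * w p].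
      exists (fun l => a * g l) => p; rewrite ffunE hg !differential_pullbackE mulrCA mulr_sumr.
      by congr (_ * _); apply: eq_bigr => l _; rewrite rmorphM mulrA.
    by move=> p; rewrite ffunE rmorphM mulrCA ew mulrCA.
move=> _ [h [c [hker ->]]]; apply: minor_in_differentials => //.
by rewrite subn1.
Qed.

Lemma fitting1_sup w : differential_set w ->
  exists2 a, kahler_fitting pi 1 a & forall p, t * phi p a = cd p * w p.
Proof.
case=> g hg.
have /choice[D hD] : forall l : 'I_n, exists d, kahler_fitting pi 1 d /\
    forall p, phi p d = (-1) ^+ (l + m) * (cd p * tangent p l).
  move=> l; have [|h [c [hker e]]] := @minor_lift_exists (n - 1)%N l; first by rewrite subn1.
  by eexists; split; last exact: e; apply: ideal_gen_mem; exists h, c.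
exists (\sum_(l < n) ((-1) ^+ (l + m) * g l) * D l).
  apply: ideal_sum => [|l]; first exact: ideal_gen_ideal.
  by apply: ideal_gen_mul; have [] := hD l.
move=> p; rewrite hg differential_pullbackE mulrCA rmorph_sum; congr (_ * _).
rewrite mulr_sumr; apply: eq_bigr => l _; have [_ e] := hD l.
rewrite /= !rmorphM /= e rmorphXn rmorphN rmorph1 mulrACA.
by rewrite -expr2 sqrr_sign mul1r mulrCA.
Qed.

(** Index 0 gives zero by [det_jacobian_square]. Index 1 does not: its elements realize c w / t for
    every [w] in the image of differentials, which contains [deep N], and c is nonzero on each
    branch. *)
Lemma jacobian_idealE : jacobian_ideal pi = kahler_fitting pi 1.
Proof.
have F1 : kahler_fitting pi 1 != [set 0].
  apply/eqP => e.
  pose p0 := Ordinal r_gt0.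
  have [|a] := @fitting1_sup (single p0 (t ^+ N)).
    by apply/deep_differential_set/single_deep/ord_ge_tX.
  rewrite e => -> /(_ p0); rewrite rmorph0 mulr0 ffunE eqxx => /esym/eqP.
  rewrite mulf_eq0 (negPf (cdual_neq0 r_gt0 psi_ker _ _ _)) /=.
  move/eqP/(congr1 (fun F => tcoef F N))/eqP.
  by rewrite tcoef_tX eqxx tcoef0 oner_eq0.
apply/seteqP; split=> x; last first.
  move=> Fx; exists 1%N; split=> // i; rewrite ltnS leqn0 => /eqP ->; exact: fitting0.
case=> -[|[|j]] [Fx nz low] //.
  by rewrite fitting0 eqxx in nz.
by case/eqP: F1; apply: low.
Qed.

End JacobianIdeal.

(** * Lengths computed inside the product of the branches *)

Section ProductLength.
Variables (k : fieldType) (r L : nat).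
Local Notation V := {ffun 'I_r -> mpseries 1 k}.

(** The coefficient of the product at a position involves only strictly smaller positions of the
    same branch, so an element of the maximal ideal raises the lexicographic position. *)
Lemma flag_lex_mul n (g : 'I_r -> mpseries 1 k) (v w : V) :
  flag (lexcoef L) n v -> (forall p, ord_ge 1 (g p)) ->
  (forall p, w p = g p * v p) -> (0 < L)%N -> flag (lexcoef L) n.+1 w.
Proof.
move=> Fv hg hw L0 i; rewrite ltnS => le; rewrite /lexcoef; case: insubP => // q _ eq.
rewrite hw tcoefM big1 // => -[[|j] lt] _ /=.
  by move/ord_ge_tcoef: (hg q) => ->; rewrite ?mul0r.
have ltL : (i %% L - j.+1 < L)%N by apply: leq_ltn_trans (leq_subr _ _) (ltn_pmod _ L0).
rewrite -(lexcoefE _ _ ltL) Fv ?mulr0 //; apply: leq_trans le.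
by rewrite [X in (_ < X)%N](divn_eq i L) -eq /= ltn_add2l ltn_subrL; move: lt; rewrite ltnS; lia.
Qed.

Variables (R : comNzRingType) (W : lmodType k) (act : R -> W -> W) (al : k -> R).
Variables (h : R -> 'I_r -> mpseries 1 k) (ep : R -> k) (F : W -> V).
Hypothesis F_lin : forall a u v, F (a *: u + v) = a *: F u + F v.
Hypothesis act_al : forall c v, act (al c) v = c *: v.
Hypothesis act_lin : forall a c u v, act a (c *: u + v) = c *: act a u + act a v.
Hypothesis F_act : forall a v p, F (act a v) p = h a p * F v p.
Hypothesis h_ep : forall a p, tcoef (h a p) 0 = ep a.
Hypothesis L_gt0 : (0 < L)%N.

(** Stated for a map [F] into the product so that it covers both the ring modulo the Jacobian ideal,
    with [F] its embedding, and the normalization modulo the ring, with [F] the identity. *)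
Lemma product_length (A : set W) : submodule act A ->
  deep L `<=` [set F a | a in A] -> (forall v, deep L (F v) -> A v) ->
  quotient_length act A (lead_count L (range F) - lead_count L [set F a | a in A]).
Proof.
move=> sA LA FA.
have ksubF (B : set W) : submodule act B -> ksub [set F a | a in B].
  move=> sB; have [B0 BD BA] := sB.
  have F0 : F 0 = 0 by have := F_lin (-1) 0 0; rewrite scaler0 addr0 scaleN1r addNr.
  split; first by exists 0.
    move=> _ _ [u Bu <-] [v Bv <-]; exists (u + v); first exact: BD.
    by rewrite -[u]scale1r F_lin !scale1r.
  move=> c _ [u Bu <-]; exists (c *: u); first by rewrite -act_al; apply: BA.
  by rewrite -[c *: u]addr0 F_lin F0 addr0.
have leadsE B : leads (r * L) (fun n v => lexcoef L n (F v)) B =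
    leads (r * L) (lexcoef L) [set F a | a in B].
  apply/setP => i; apply/idP/idP => /leadsP[s [Bs Fs nz]]; apply/leadsP.
    by exists (F s); split => //; exists s.
  by have [u Bu eu] := Bs; exists u; rewrite /flag eu.
rewrite -(card_leads (ksubF _ sA) LA) -(@card_leads _ _ _ (range F)); last 2 first.
- by apply: ksubF; split.
- by move=> v /LA[a _ <-]; exists a.
rewrite -!leadsE; apply: (leads_quotient_length (al := al) (ep := ep)) => //.
- by move=> i a u v; rewrite F_lin lexcoef_lin.
- move=> n a v _ Fv.
  apply: (@flag_lex_mul n (fun p => h a p - (ep a)%:A) (F v)) => //.
    move=> p; apply/ord_ge_tcoef => -[|//] _.
    by rewrite tcoefB tcoefA h_ep mulr1 subrr.
  move=> p; rewrite addrC -scaleNr F_lin !ffunE F_act mulrBl mulr_algl scaleNr.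
  by rewrite addrC.
by move=> v Fv; apply: FA; apply: flag_lex_full.
Qed.

End ProductLength.

Section BranchLength.
Variables (k : fieldType) (B : comAlgType k) (nu : {lrmorphism B -> mpseries 1 k}) (L : nat).
Hypothesis nu_deep : forall s, ord_ge L s -> exists b, nu b = s.

Definition has_value (A : set (mpseries 1 k)) d : bool :=
  `[< exists2 s, A s & ord_t s = Some d%:Z >].

Lemma card_leads_ord_t (A : set (mpseries 1 k)) :
  #|leads L (fun n s => tcoef s n) A| = (\sum_(d < L) has_value A d)%N.
Proof.
rewrite -sum1_card big_mkcond /=; apply: eq_bigr => d _.
suff -> : (d \in leads L (fun n s => tcoef s n) A) = has_value A d by case: has_value.
apply/idP/asboolP => [/leadsP[s [As Fs nz]]|[s As /ord_tP[o nz]]].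
  by exists s => //; apply/ord_tP; split => //; apply/ord_ge_tcoef.
by apply/leadsP; exists s; split => //; apply/ord_ge_tcoef.
Qed.

(** The delta invariant of a branch is the number of gaps of its value semigroup, all of which lie
    below [L]. *)
Lemma branch_length : branch_delta nu (L - \sum_(d < L) has_value (range nu) d).
Proof.
have -> : (L - \sum_(d < L) has_value (range nu) d)%N =
    (#|leads L (fun n (s : mpseries 1 k) => tcoef s n) setT|
    - #|leads L (fun n (s : mpseries 1 k) => tcoef s n) (range nu)|)%N.
  rewrite !card_leads_ord_t; congr (_ - _)%N.
  rewrite (eq_bigr (fun=> 1%N)) ?sum1_card ?card_ord // => d _.
  rewrite (_ : has_value _ _) //; apply/asboolP; exists (tvar k ^+ d) => //.
  by apply/ord_tP; split; [apply: ord_ge_tX | rewrite tcoef_tX eqxx oner_eq0].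
apply: (leads_quotient_length (al := fun c => c%:A) (ep := fun b => tcoef (nu b) 0)).
- by move=> i a u v; rewrite tcoefD tcoefZ.
- by move=> c v; rewrite linearZ rmorph1 mulr_algl.
- by move=> a c u v; rewrite mulrDr scalerAr.
- move=> n a v _ /ord_ge_tcoef ov; apply/ord_ge_tcoef.
  rewrite -mulr_algl -mulrBl -[n.+1]add1n; apply: ord_geM ov.
  by apply/ord_ge_tcoef => -[|//] _; rewrite tcoefB tcoefA mulr1 subrr.
- split; first by exists 0; rewrite ?rmorph0.
    by move=> _ _ [a _ <-] [b _ <-]; exists (a + b); rewrite ?rmorphD.
  by move=> a _ [b _ <-]; exists (a * b); rewrite ?rmorphM.
by move=> v Fv; have [b <-] := nu_deep ((ord_ge_tcoef _ _).2 Fv); exists b.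
Qed.

End BranchLength.

(** * The relation between tau, delta and the differentials *)

Section Invariants.
Variables (k : fieldType) (m r : nat) (O : comAlgType k).
Local Notation n := m.+1.
Local Notation V := {ffun 'I_r -> mpseries 1 k}.
Local Notation t := (tvar k).
Variable pi : {lrmorphism mpseries n k -> O}.
Variable phi : 'I_r -> {lrmorphism O -> mpseries 1 k}.
Local Notation psi := (branch_map pi phi).
Variable f : 'I_m -> mpseries n k.
Variable N' : nat.
Local Notation N := N'.+1.

Hypothesis char0 : forall i, i.+1%:R != 0 :> k.
Hypothesis pi_surj : forall a, exists g, pi g = a.
Hypothesis phi_inj : forall a, (forall p, phi p a = 0) -> a = 0.
Hypothesis r_gt0 : (0 < r)%N.
Hypothesis ker_pi : ideal_gen (range f) = kernel pi.
Hypothesis conductor : deep N `<=` image_set psi.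

(** Multiplication by c costs ord(c) = 2 delta jumps and division by t restores r of them, so t J =
    c M gives the Jacobian ideal [lead_count L M] - 2 delta + r jumps. The ring has r L - delta, and
    tau is the difference. *)
Lemma length_formula : exists L tau delta, [/\ (N <= L)%N, tjurina pi tau,
  curve_delta (fun p a => phi p a) delta
  & (tau + lead_count L (differential_set pi phi) + r = delta + r * L)%N].
Proof.
pose cd := cdual (psi_f0 phi ker_pi) conductor.
have pker := psi_ker phi_inj ker_pi.
have /choice[e he] : forall p, exists d, ord_ge d (cd p) /\ tcoef (cd p) d != 0.
  by move=> p; apply: tord_exists; apply: (cdual_neq0 r_gt0).
pose M := differential_set pi phi.
have kM : ksub M by apply: ksub_differential_set.
pose J : set V := [set [ffun p => phi p a] | a in jacobian_ideal pi].
have JE : jacobian_ideal pi = kahler_fitting pi 1.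
  exact: (jacobian_idealE char0 phi_inj r_gt0 ker_pi conductor).
have JP s : J s <-> exists2 a, kahler_fitting pi 1 a & forall p, s p = phi p a.
  rewrite /J JE; split=> [[a Fa <-]|[a Fa hs]]; exists a => //.
    by move=> p; rewrite ffunE.
  by apply/ffunP => p; rewrite ffunE hs.
have imE : range (fun a => [ffun p => phi p a] : V) = image_set psi.
  apply/seteqP; split=> [_ [a _ <-]|s [g hs]].
    by have [g eg] := pi_surj a; exists g => p; rewrite ffunE /= eg.
  by exists (pi g) => //; apply/ffunP => p; rewrite ffunE hs.
(* This leaves room on every branch to divide by c, of order [e p], and still have order [N]; so
   [deep L] lies in c M. *)
pose L := (N + \sum_p e p)%N.
have LN : (N <= L)%N by apply: leq_addr.
have deepW (A : set V) : deep N `<=` A -> deep L `<=` A.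
  by move=> h s hs; apply: h => p; apply: ord_geW (hs p).
have LcM : deep L `<=` scale_set cd M.
  move=> s hs; have /choice[w hw] : forall p, exists w, s p = cd p * (t ^+ N * w).
    move=> p; have [|s1 es1] := @ord_ge_tdvd _ (N + e p) (s p).
      by apply: ord_geW (hs p); rewrite leq_add2l (bigD1 p) //= leq_addr.
    have [o nz] := he p; have [|w ew] := @ord_ge_dvd k (cd p) (t ^+ e p * s1) _ o nz.
      by rewrite mulrC; apply/ord_geMr/ord_ge_tX.
    by exists w; rewrite es1 exprD -mulrA ew mulrCA.
  exists [ffun p => t ^+ N * w p]; last by move=> p; rewrite hw ffunE.
  apply: (deep_differential_set char0 conductor) => p; rewrite ffunE mulrC.
  exact/ord_geMr/ord_ge_tX.
have tJcM : scale_set (fun=> t) J = scale_set cd M.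
  apply/seteqP; split=> s [u].
    move=> /JP[a Fa hu] hs.
    have [w Mw ew] := @fitting1_sub _ _ _ _ _ phi _ _ char0 ker_pi conductor _ Fa.
    by exists w => // p; rewrite hs hu ew.
  move=> Mu hs; have [a Fa ea] := @fitting1_sup _ _ _ _ _ phi _ _ char0 ker_pi conductor _ Mu.
  exists [ffun p => phi p a]; last by move=> p; rewrite hs ffunE ea.
  by apply/JP; exists a => // p; rewrite ffunE.
have nzt : t != 0.
  apply/eqP => /(congr1 (fun F => tcoef F 1))/eqP.
  by rewrite -[t]expr1 tcoef_tX eqxx tcoef0 oner_eq0.
have LJ : deep L `<=` J.
  move=> s hs; have : scale_set (fun=> t) J [ffun p => t * s p].
    by rewrite tJcM; apply: LcM => p; rewrite ffunE; apply/ord_geMr/hs.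
  case=> u Ju hu; rewrite (_ : s = u) //; apply/ffunP => p.
  by apply: (mulfI nzt); rewrite -hu ffunE.
have ht (p : 'I_r) : ord_ge 1 t /\ tcoef t 1 != 0.
  by split; [apply: ord_ge_svar | rewrite -[t]expr1 tcoef_tX eqxx oner_eq0].
have c1 := @lead_count_scale_set k r L cd e M he LcM.
have c2 := @lead_count_scale_set k r L (fun=> t) (fun=> 1%N) J ht _.
rewrite tJcM sum1_card card_ord in c2; have {}c2 := c2 LcM.
have c3 := cdual_order r_gt0 pker he.
have c4 : (lead_count L (image_set psi) = lead_count N (image_set psi) + r * \sum_p e p)%N.
  exact: lead_count_deeper.
have kim : ksub (image_set psi) by apply: ksub_image.
have L0 : (0 < L)%N by apply: leq_trans LN.
pose ep a := scoef (projT1 (cid (pi_surj a))) 0.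
have phi0 a p : tcoef (phi p a) 0 = ep a.
  rewrite /ep; case: cid => g /= <-.
  exact: (lrmorph_scoef0 (psi p)).
have bound (A : set V) : ksub A -> deep L `<=` A -> (lead_count L A <= r * L)%N.
  move=> kA LA; rewrite -(card_leads kA LA).
  by apply: leq_trans (max_card _) _; rewrite card_ord.
have JI : ideal (jacobian_ideal pi) by rewrite JE; apply: ideal_gen_ideal.
have sJ : submodule (@GRing.mul O) (jacobian_ideal pi) by have [] := JI.
have kJ : ksub J.
  have [J0 JD JM] := JI; split.
  - by exists 0 => //; apply/ffunP => p; rewrite !ffunE rmorph0.
  - move=> _ _ [a ha <-] [b hb <-]; exists (a + b); first exact: JD.
    by apply/ffunP => p; rewrite !ffunE rmorphD.
  - move=> c _ [a ha <-]; exists (c%:A * a); first exact: JM.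
    by apply/ffunP => p; rewrite !ffunE mulr_algl linearZ.
have Jim : J `<=` image_set psi by rewrite -imE => _ [a _ <-]; exists a.
have cle : (lead_count L J <= lead_count L (image_set psi))%N.
  rewrite -(card_leads kJ LJ) -(card_leads kim (deepW _ conductor)).
  exact/subset_leq_card/leads_subset.
exists L, (lead_count L (image_set psi) - lead_count L J)%N,
  (r * L - lead_count L (image_set psi))%N.
split => //.
- rewrite /tjurina -imE.
  apply: (@product_length k r L O O _ (fun c => c%:A) (fun a p => phi p a) ep) => //.
  + by move=> a u v; apply/ffunP => p; rewrite !ffunE linearP.
  + by move=> c v; rewrite mulr_algl.
  + by move=> a c u v; rewrite mulrDr scalerAr.
  + by move=> a v p; rewrite !ffunE rmorphM.
  + move=> v /LJ[a Ja eva]; rewrite (_ : v = a) //.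
    apply/eqP; rewrite -subr_eq0; apply/eqP/phi_inj => p.
    by have /ffunP/(_ p) := eva; rewrite !ffunE rmorphB /= => ->; rewrite subrr.
- rewrite /curve_delta imE -(lead_count_full k r L).
  have -> : setT = range (fun v : V => v) by apply/seteqP; split=> // v _; exists v.
  rewrite -[X in (_ - lead_count _ X)%N]image_id.
  apply: (@product_length k r L O V _ (fun c => c%:A) (fun a p => phi p a) ep) => //.
  + by move=> c v; apply/ffunP => p; rewrite !ffunE linearZ rmorph1 mulr_algl.
  + by move=> a c u v; apply/ffunP => p; rewrite !ffunE mulrDr scalerAr.
  + by move=> a v p; rewrite !ffunE.
  + have [i0 iD _] := kim; split=> // a s [g hs].
    have [b eb] := pi_surj a; exists (b * g) => p.
    by rewrite ffunE hs rmorphM /= eb.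
  + rewrite image_id; exact: deepW.
  + exact: deepW.
have b1 := bound _ kim (deepW _ conductor).
have b2 := bound _ kJ LJ.
have b3 := bound _ kM (deepW _ (deep_differential_set char0 conductor)).
have eL : (r * L = r * N + r * \sum_p e p)%N by rewrite /L mulnDr.
move: c1 c2 c3 c4 b1 b2 b3 eL cle.
move: (lead_count L (scale_set cd M)) => x1; rewrite -/M.
set x2 := lead_count L M; set x3 := lead_count L J; set x4 := lead_count L (image_set psi).
set x5 := lead_count N (image_set psi); set E := (\sum_p e p)%N.
set rN := (r * N)%N; set rL := (r * L)%N; set rE := (r * E)%N.
lia.
Qed.

End Invariants.

(** * Counting values on one branch *)

Section BranchCounts.
Variables (k : fieldType) (r L : nat) (W : set {ffun 'I_r -> mpseries 1 k}).
Variables (i : 'I_r) (G : set (mpseries 1 k)).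

Definition component_value d : bool := `[< exists2 s, W s & ord_t (s i) = Some d%:Z >].

Hypothesis L_gt0 : (0 < L)%N.
Hypothesis G0 : has_value G 0.
Hypothesis W0 : ~~ component_value 0.
Hypothesis GW : forall d, has_value G d.+1 -> component_value d.+1.

(** The values of functions are values of differentials except for 0, the value of a unit. This
    single exception is the 1 on the right; summed over the branches it cancels the r of
    [length_formula]. *)
Lemma count_values :
  (\sum_(d < L) has_value G d + \sum_(d < L) (component_value d && ~~ has_value G d)%N
    = \sum_(d < L) component_value d + 1)%N.
Proof.
have -> : 1%N = (\sum_(d < L) (d == 0 :> nat))%N.
  rewrite (bigD1 (Ordinal L_gt0)) //= big1 // => d; rewrite -val_eqE /=.
  by move=> /negPf ->.
rewrite -!big_split; apply: eq_bigr => -[[|d] lt] _ /=.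
  by rewrite G0 (negPf W0).
by have := @GW d; case: has_value => [->|_]; case: component_value.
Qed.

Lemma count_leads :
  (\sum_(d < L) (component_value d && ~~ lead_at W i d)%N + \sum_(d < L) lead_at W i d
    = \sum_(d < L) component_value d)%N.
Proof.
rewrite -big_split; apply: eq_bigr => d _ /=.
case: lead_atP => [[s [Ws _ o nz]]|_]; last by rewrite andbT addn0.
by rewrite andbF (_ : component_value d) //; apply/asboolP; exists s => //; apply/ord_tP.
Qed.

End BranchCounts.

(** * Combination of the length formula with the counts on the branches *)

Theorem theorem13
  (k : closedFieldType) (char_k : [pchar k] =i pred0)
  (n : nat) (O : comAlgType k)
  (pi : {lrmorphism mpseries n k -> O}) (pi_surj : range pi = setT)
  (O_reduced : reduced O) (O_dim : krull_dim O 1) (O_edim : embedding_dim O n)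
  (O_ci : complete_intersection pi)
  (r : nat) (wp : 'I_r -> set O) (wp_inj : injective wp)
  (wp_min : range wp = [set P | minimal_prime P])
  (B : 'I_r -> comAlgType k) (rho : forall i, {lrmorphism O -> B i})
  (rho_surj : forall i, range (rho i) = setT)
  (rho_ker : forall i, kernel (rho i) = wp i)
  (nu : forall i, {lrmorphism B i -> mpseries 1 k})
  (nu_closure : forall i, integral_closure_map (nu i)) :
  let x := fun l : 'I_n => pi (svar k l) in
  let phi := fun (i : 'I_r) (a : O) => nu i (rho i a) in
  let Lambda := differential_values x phi in
  let Gamma_ := fun i => branch_values (nu i) in
  let Lambda_ := fun i =>
    branch_differential_values (fun l => rho i (x l)) (nu i) in
  exists (tau delta : nat) (delta_ r_ Theta_ : 'I_r -> nat),
    [/\ tjurina pi tau,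
        curve_delta phi delta,
        forall i, branch_delta (nu i) (delta_ i),
        forall i, Lambda_ i `\` Gamma_ i #= `I_(r_ i)
      & forall i, Theta_set Lambda i #= `I_(Theta_ i)]
    /\ tau%:Z = delta%:Z
         + \sum_(i < r) ((delta_ i)%:Z - (r_ i)%:Z + (Theta_ i)%:Z).
Proof.
move=> x phi Lambda Gamma_ Lambda_.
have char0 i : i.+1%:R != 0 :> k by rewrite ((pcharf0P k).1 char_k).
have pi_surj' a : exists g, pi g = a.
  have : range pi a by rewrite pi_surj.
  by case=> g _ <-; exists g.
have rho_surj' i b : exists a, rho i a = b.
  have : range (rho i) b by rewrite rho_surj.
  by case=> a _ <-; exists a.
pose ph i : {lrmorphism O -> mpseries 1 k} := nu i \o rho i.
have nu_inj i : injective (nu i) by have [] := nu_closure i.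
have kerE i a : wp i a <-> ph i a = 0.
  rewrite -rho_ker; split=> [e|e]; first by rewrite /= e rmorph0.
  by apply: (nu_inj i); rewrite rmorph0.
have mp i : minimal_prime (wp i).
  have : range wp (wp i) by exists i.
  by rewrite wp_min.
have ph_inj a : (forall p, ph p a = 0) -> a = 0.
  move=> h; apply: (minimal_primes_meet O_reduced) => P mP.
  have : range wp P by rewrite wp_min.
  by case=> i _ <-; apply/kerE.
have r_gt0 : (0 < r)%N.
  rewrite lt0n; apply/eqP => r0; have /eqP : (1 : O) = 0.
    by apply: ph_inj => p; have := ltn_ord p; rewrite [X in (_ < X)%N]r0.
  by rewrite oner_eq0.
pose psi := branch_map pi ph.
(* Every series is in the integral closure, so [nu_closure] writes it as a fraction of elements of
   the branch; clearing the denominator leaves an equation between series. *)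
have frac p s : exists a b, psi p b != 0 /\ s * psi p b = psi p a.
  have [_ /(_ (@tofrac (mpseries 1 k) s))[_]] := nu_closure p.
  case; first by exists s.
  move=> [a [b [nzb e]]] _.
  have [a' ea] := rho_surj' p a; have [b' eb] := rho_surj' p b.
  have [a2 ea2] := pi_surj' a'; have [b2 eb2] := pi_surj' b'.
  have nzn : nu p b != 0.
    by apply: contra nzb => /eqP e0; apply/eqP/(nu_inj p); rewrite rmorph0.
  exists a2, b2; rewrite /psi /= ea2 eb2 ea eb; split => //.
  apply/eqP; rewrite -tofrac_eq tofracM e divfK //.
  by rewrite tofrac_eq0.
have sep p : exists z, psi p z != 0 /\ forall q, q != p -> psi q z = 0.
  have [z [nz hz]] := minimal_primes_separated wp_inj mp p.
  have [g eg] := pi_surj' z; exists g; rewrite /psi /= eg; split.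
    by apply/eqP => e; apply: nz; apply/kerE.
  by move=> q /hz/kerE.
have [N conductor] := conductor_exists frac sep.
(* With no variables the image consists of constants, which contradicts the conductor containing a
   power of t. Hence n is positive. *)
case: n pi pi_surj O_edim O_ci @x @Lambda @Lambda_ pi_surj' @psi frac sep conductor
    => [|m] {}pi {}pi_surj {}O_edim {}O_ci x Lambda Lambda_ pi_surj' psi frac sep conductor.
  have [g hg] := conductor _ (@single_deep k r N.+1 (Ordinal r_gt0) _ (@ord_ge_tX k N.+1)).
  have := hg (Ordinal r_gt0); rewrite ffunE eqxx.
  have [h ->] := series_decomp g; rewrite big_ord0 addr0 lrmorph_alg.
  move=> /(congr1 (fun F => tcoef F N.+1))/eqP.
  by rewrite tcoef_tX tcoefA eqxx mulr0 oner_eq0.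
have [f ker_pi] := O_ci.
have [L [tau [delta [LN htau hdelta formula]]]] :=
  length_formula char0 pi_surj' ph_inj r_gt0 ker_pi conductor.
pose M := differential_set pi ph.
have kM : ksub M by apply: ksub_differential_set.
have LM : deep L `<=` M.
  move=> s hs; apply: (deep_differential_set char0 conductor) => p.
  exact: ord_geW (hs p).
have L_gt0 : (0 < L)%N by apply: leq_trans LN.
have nu_deep i s : ord_ge L s -> exists b, nu i b = s.
  move=> os; have [|g hg] := conductor (single i s).
    by apply: single_deep; apply: ord_geW os.
  by exists (rho i (pi g)); have := hg i; rewrite ffunE eqxx.
have LambdaE : Lambda = value_set M.
  rewrite /Lambda; apply/seteqP; split=> [_ [g _ <-]|_ [s [g hs] <-]].
    exists [ffun p => differential_pullback x (ph p) g].
      by exists g => p; rewrite ffunE.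
    by apply/funext => p; rewrite ffunE.
  by exists g => //; apply/funext => p; rewrite hs.
have Lambda_P i z : Lambda_ i z <-> exists2 s, M s & ord_t (s i) = z.
  rewrite /Lambda_; split=> [[g _ <-]|[s [g hs] <-]].
    have /choice[h hh] := fun l => rho_surj' i (g l).
    exists [ffun p => differential_pullback x (ph p) h].
      by exists h => p; rewrite ffunE.
    rewrite ffunE /differential_pullback; congr (ord_t (_ * _)).
    by apply: eq_bigr => l _; rewrite /= hh.
  by exists (fun l => rho i (g l)); rewrite ?hs.
have GammaP i d : Gamma_ i (Some d%:Z) <-> has_value (range (nu i)) d.
  rewrite /Gamma_; split=> [[b _ e]|/asboolP[_ [b _ <-] e]]; last by exists b.
  by apply/asboolP; exists (nu i b) => //; exists b.
pose lam i d := component_value M i d.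
pose gam i d := has_value (range (nu i)) d.
exists tau, delta, (fun i => L - \sum_(d < L) gam i d)%N,
  (fun i => \sum_(d < L) (lam i d && ~~ gam i d)%N)%N,
  (fun i => \sum_(d < L) (lam i d && ~~ lead_at M i d)%N)%N.
split; first split => //.
- by move=> i; apply: branch_length; apply: nu_deep.
- move=> i; apply: (card_nat_values (q := fun d => lam i d && ~~ gam i d)) => z; split.
    move=> [/Lambda_P[s Ms e] nG].
    have [s0|[d ed]] := ord_t_cases (s i).
      case: nG; rewrite -e s0; exists 0 => //; by rewrite rmorph0.
    have ngd : ~~ gam i d by apply/negP => /GammaP; rewrite -ed e.
    exists d; split; last by rewrite -e.
      rewrite ltnNge; apply: contra ngd => le; apply/asboolP.
      have [|b hb] := @nu_deep i (tvar k ^+ d); first by apply: (ord_geW le); apply: ord_ge_tX.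
      exists (tvar k ^+ d); first by exists b.
      by apply/ord_tP; split; [apply: ord_ge_tX | rewrite tcoef_tX eqxx oner_eq0].
    by rewrite ngd andbT; apply/asboolP; exists s.
  move=> [d [lt /andP[/asboolP ex ngd] ->]]; split; first exact/Lambda_P.
  by move/GammaP; apply/negP.
- move=> i; apply: (card_nat_values (q := fun d => lam i d && ~~ lead_at M i d)) => z.
  by rewrite LambdaE; exact: (Theta_setP char0 kM LM).
(* Through the values of differentials on branch i, the summand delta_i - r_i + Theta_i becomes [L]
   - 1 minus the number of leads of [M] on that branch. *)
have step i : (L - \sum_(d < L) gam i d)%N%:Z - (\sum_(d < L) (lam i d && ~~ gam i d))%N%:Z
    + (\sum_(d < L) (lam i d && ~~ lead_at M i d))%N%:Z
    = L%:Z - 1 - (\sum_(d < L) lead_at M i d)%N%:Z.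
  have c1 : (\sum_(d < L) gam i d + \sum_(d < L) (lam i d && ~~ gam i d)
      = \sum_(d < L) lam i d + 1)%N.
    apply: count_values => //.
    - apply/asboolP; exists 1; first by exists 1 => //; rewrite rmorph1.
      by apply/ord_tP; split=> //; rewrite -(expr0 (tvar k)) tcoef_tX eqxx oner_eq0.
    - apply/asboolP => -[s [g hs] /ord_tP[_]].
      by rewrite hs differential_pullbackE -[tvar k]expr1 tcoef_tXM eqxx.
    (* A value of a function that is positive is also the value of an exact differential: t d/dt
       multiplies the leading coefficient by the order, which is nonzero in characteristic 0. *)
    move=> d /asboolP[_ [b _ <-] /ord_tP[o nz]]; apply/asboolP.
    have [a ea] := rho_surj' i b; have [g eg] := pi_surj' a.
    pose s : {ffun 'I_r -> mpseries 1 k} := [ffun p =>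
      differential_pullback x (ph p) (fun l => pi (sderiv l g))].
    exists s; first by eexists => p; rewrite ffunE.
    rewrite ffunE differential_exact /= eg ea; apply/ord_tP; split.
      apply/ord_ge_tcoef => j lt; rewrite tcoef_t_deriv.
      by move/ord_ge_tcoef: o => ->; rewrite ?mul0rn.
    by rewrite tcoef_t_deriv -mulr_natr mulf_neq0.
  have c2 := count_leads L M i.
  have c3 : (\sum_(d < L) gam i d <= L)%N.
    rewrite -[X in (_ <= X)%N]card_ord -sum1_card; apply: leq_sum => d _.
    by case: (gam i d).
  move: c1 c2 c3; rewrite -/(lam i).
  set s1 := (\sum_(d < L) gam i d)%N; set s2 := (\sum_(d < L) lam i d)%N.
  set s3 := (\sum_(d < L) (lam i d && ~~ gam i d))%N.
  set s4 := (\sum_(d < L) (lam i d && ~~ lead_at M i d))%N.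
  set s5 := (\sum_(d < L) lead_at M i d)%N.
  lia.
under eq_bigr => i _ do rewrite step.
have -> : \sum_(i < r) (L%:Z - 1 - (\sum_(d < L) lead_at M i d)%N%:Z) =
    (r * L)%N%:Z - r%:Z - (lead_count L M)%:Z.
  rewrite !sumrB !sumr_const card_ord -/(lead_count L M).
  rewrite -(big_morph Posz PoszD (erefl _)) -/(lead_count L M).
  by rewrite -mulr_natl natz -PoszM.
move: formula; rewrite -/M => formula.
have {}formula : tau%:Z + (lead_count L M)%:Z + r%:Z = delta%:Z + (r * L)%N%:Z.
  by rewrite -!PoszD formula.
have -> : tau%:Z = tau%:Z + (lead_count L M)%:Z + r%:Z - r%:Z - (lead_count L M)%:Z by ring.
by rewrite formula; ring.
Qed.
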